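(* Let $S_\mu(r)=f(\rho_\mu(r))$, $\rho_\mu(0)=\mu$, $\mu\in I$ ($I$ a compact interval), be a $C^2$ compact branch of radial equilibria satisfying (P), $(\mathrm E_s)$ and (F) (see context), with the same fixed function $f$ for every $\mu$. Suppose $\mu_*\in\operatorname{int}I$ is a simple mass extremum and $$M'_{\mu_*}=0,\qquad M''_{\mu_*}\ne0,\qquad c'_{\mu_*}\ne0,\qquad n^-(L_{\mu_*})=1,\qquad \operatorname{Ker}L_{\mu_*}=\{0\},$$ where $c_\mu=M_\mu/R_\mu$. Then $\mathcal Q_{\mu_*}|_{H_{\mu_*}}$ is coercive. It remains coercive for $\mu$ in a neighborhood of $\mu_*$; hence there is no growing radial mode there and $\mu_*$ is not a radial stability transition. In particular, if $\mu_*$ is the first simple mass extremum of the branch, the first turning-point principle fails.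
   Context: Newton operator: $((-\Delta)^{-1}h)(x)=\frac1{4\pi}\int_{\mathbb R^3}\frac{h(y)}{|x-y|}dy$ (functions on balls extended by zero), $V_h=-4\pi(-\Delta)^{-1}h$. $n^-$ is the Morse index (maximal dimension of a subspace on which the form is negative definite); $\operatorname{Ker}$ of a form is its radical. Hypothesis (P). $P\in C^3(\mathbb R\times(0,\infty))\cap C^1(\mathbb R\times[0,\infty))$, $P=P(S,\rho)$, $P(S,0)=0$, and $P_\rho>0$, $P_S>0$ for $\rho>0$. There are $\gamma_0\in(6/5,2)$, $\alpha_0>0$ such that for every compact interval $J\subset\mathbb R$ there is $K\in C^2(J)$ with $\inf_JK>0$ and $\partial_S^j\partial_\rho^k(P(S,\rho)-K(S)\rho^{\gamma_0})=O_J(\rho^{\gamma_0-k+\alpha_0})$ as $\rho\downarrow0$, uniformly in $S\in J$, for $j+k\le2$; and $|\partial_S^j\partial_\rho^kP(S,\rho)|\le C_J\rho^{\gamma_0-k}$ for $j+k=3$, $0<\rho\le1$, $S\in J$. Hypothesis $(\mathrm E_s)$ for $(\rho_0,S_0,0)$ (imposed on each $(\rho_\mu,S_\mu,0)$). $(\rho_0(r),S_0(r),0)$, $r=|x|$, is a compactly supported radial equilibrium of the Euler–Poisson system: $\operatorname{supp}\rho_0=\overline{B_R}$, $B_R=\{x\in\mathbb R^3:|x|<R\}$, $\nabla P(S_0,\rho_0)+\rho_0\nabla V_{\rho_0}=0$ in $B_R$, with mass $M=4\pi\int_0^Rr^2\rho_0\,dr>0$; $\rho_0\in C^2([0,R))\cap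 C^1([0,R])$, $\rho_0(0)>0$, $\rho_0'<0$ on $(0,R)$, $\rho_0(R)=0$. There is $f\in C^1([0,\rho_0(0)])\cap C^2((0,\rho_0(0)))$ with $S_0=f(\rho_0)$; with $\widetilde P(\rho)=P(f(\rho),\rho)$ one has $\widetilde P'(\rho_0)>0$. The coefficient $\mathfrak G(r)=-P_S(S_0,\rho_0)f'(\rho_0)/\rho_0$ satisfies $\mathfrak G>0$ for a.e. $0<r<R$, $\mathfrak G^{-1}\in L^1_{\rm loc}(B_R)$, $0<\mathfrak G(r)\le C\rho_0^{\gamma_0-1}(r)$ for $r$ near $R$, and $\lim_{\rho\downarrow0}\widetilde P'(\rho)/\rho^{\gamma_0-1}=\gamma_0K(f(0))>0$. Forms along the branch. $R_\mu,M_\mu$ are the radius and mass, $\widetilde P_f(\rho)=P(f(\rho),\rho)$, $\mathfrak G_\mu=-P_S(f(\rho_\mu),\rho_\mu)f'(\rho_\mu)/\rho_\mu$. $X_{1,\mu}^{\rm rad}$ is the space of radial functions in $L^2$ on $B_{R_\mu}$ with weight $\widetilde P_f'(\rho_\mu)/\rho_\mu$. $H_\mu=\{\eta\in X_{1,\mu}^{\rm rad}:\int_{B_{R_\mu}}\eta\,dx=0\}$, $I_\eta(r)=4\pi\int_0^rs^2\eta(s)ds$, $T_\mu\eta=\frac{\rho_\mu'}{4\pi r^2\rho_\mu}I_\eta$, $$L_\mu[\eta]=\int\frac{\widetilde P_f'(\rho_\mu)}{\rho_\mu}\eta^2dx-4\pi\langle(-\Delta)^{-1}\eta,\eta\rangle\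 \text{ on }X_{1,\mu}^{\rm rad},\qquad \mathcal Q_\mu[\eta]=L_\mu[\eta]+\int\mathfrak G_\mu|\eta-T_\mu\eta|^2dx\ \text{ on }H_\mu.$$ Family hypothesis (F) on $I$. $M_\mu,R_\mu$ are $C^2$ in $\mu$; the profiles are $C^2$ in $\mu$ on compact subsets of the positive-density interior; $v_\mu=\partial_\mu\rho_\mu$ (at fixed physical radius, extended by zero) belongs to $X_{1,\mu}^{\rm rad}$ and $\int v_\mu\,dx=M_\mu'$. The pullbacks $(\mathcal U_\mu\eta)(s)=R_\mu^3\eta(R_\mu s)$, $0<s<1$, identify the moving spaces with one fixed radial Hilbert space; in this realization the quadratic forms ($L_\mu$ on $X_{1,\mu}^{\rm rad}$, $\mathcal Q_\mu$ on $H_\mu$) are norm-continuous in $\mu$, and each is the sum of a uniformly coercive bounded symmetric form and a compact form and has finite Morse index. Growing radial modes. At an equilibrium satisfying $(\mathrm E_s)$ put $w_1=\widetilde P'(\rho_0)/\rho_0$, $w_2=\mathfrak G$, $a_0=\nabla\rho_0/\rho_0$, $X=L^2_{w_1}(B_R)\times L^2_{w_2}(B_R)$, $Y=L^2_{\rho_0}(B_R;\mathbb R^3)$ (weighted $L^2$ spaces; duals identified via $\int hk\,dx$). With $\eta=\delta\rho$, $\zeta=\delta\rho-\delta S/f'(\rho_0)$, velocity perturbation $u$, the linearized system is $\partial_t(\eta,\zeta)=BAu$, $\partial_tu=-B'\mathbb L(\eta,\zeta)$, where $Au=\rho_0u$, $\mathbb L(\eta,\zeta)=(w_1\eta-4\pi(-\Delta)^{-1}\eta,w_2\zeta)$,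 $Bq=(-\operatorname{div}q,-\operatorname{div}q+a_0\cdot q)$ with maximal domain $\{q\in L^2_{1/\rho_0}:Bq\in X\}$, $B'$ its dual. A growing radial mode is an eigenvalue with $\operatorname{Re}\lambda>0$ of this generator within radial perturbations ($\eta,\zeta$ radial, $u$ a radial vector field). Turning-point notions. A simple mass extremum $\mu_*$ ($M'(\mu_* )=0$, $M''(\mu_* )\neq0$) is a radial stability transition if the constrained form $\mathcal Q_\mu|_{H_\mu}$ has a one-dimensional kernel at $\mu_*$, is nondegenerate immediately on either side, and its Morse index changes by one across $\mu_*$. The family satisfies the first turning-point principle on an interval if its first radial stability transition is its first simple mass extremum. *)

(* Defs.v *)
From HB Require Import structures.
From mathcomp Require Import all_boot all_order all_algebra.
From mathcomp Require Import all_classical all_reals all_analysis.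

Set Implicit Arguments.
Unset Strict Implicit.
Unset Printing Implicit Defensive.

Import Order.TTheory GRing.Theory Num.Theory.
Import numFieldNormedType.Exports.

Local Open Scope classical_set_scope.
Local Open Scope ring_scope.

Section Regularity.
Context {R : realType}.
Implicit Types (A B : set R) (g : R -> R) (P : R -> R -> R).

(* Difference quotients are restricted to [A]: at an end point of a closed
   interval this is the one-sided derivative, and at an interior point of [A]
   it is the usual derivative. *)
Definition quotient_in A g (x : R) :=
  (h^-1 * (g (h + x) - g x)) @[h --> within [set h | A (h + x)] 0^'].

Definition derivable_in A g (x : R) : Prop := cvg (quotient_in A g x).

Definition derive_in A g (x : R) : R := lim (quotient_in A g x).

Fixpoint Ck_on A (k : nat) g : Prop :=
  {within A, continuous g} /\
  (if k is k'.+1 then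
     (forall x : R, A x -> derivable_in A g x) /\ Ck_on A k' (derive_in A g)
   else True).

Fixpoint Ck2_on A B (k : nat) P : Prop :=
  {within A `*` B, continuous (fun p : R * R => P p.1 p.2)} /\
  (if k is k'.+1 then
     [/\ forall s t : R, A s -> B t ->
           derivable_in A (P^~ t) s /\ derivable_in B (P s) t,
         Ck2_on A B k' (fun s t => derive_in A (P^~ t) s) &
         Ck2_on A B k' (fun s t => derive_in B (P s) t)]
   else True).

(* d_S^j d_rho^k P *)
Definition pderiv A B (j k : nat) P (s t : R) : R :=
  iter j (derive_in A) (fun s' => iter k (derive_in B) (P s') t) s.

End Regularity.

Section Space.
Context {R : realType}.
Local Notation E3 := (R * R * R)%type.

Definition leb3 := ((@lebesgue_measure R \x @lebesgue_measure R)
                    \x @lebesgue_measure R)%E.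

Definition dot3 (x y : E3) : R := x.1.1 * y.1.1 + x.1.2 * y.1.2 + x.2 * y.2.

(* The library norm on a product is the sup norm, hence the explicit Euclidean
   norm. *)
Definition enorm (x : E3) : R := Num.sqrt (dot3 x x).

Definition eball (r : R) : set E3 := [set x | enorm x < r].

(* The function on R^3 with radial profile [g]. *)
Definition radial (g : R -> R) (x : E3) : R := g (enorm x).

Definition grad (h : E3 -> R) (x : E3) : E3 :=
  ('D_((1, 0, 0) : E3) h x, 'D_((0, 1, 0) : E3) h x, 'D_((0, 0, 1) : E3) h x).

(* (-Delta)^{-1} h *)
Definition newton (h : E3 -> R) (x : E3) : R :=
  (4 * pi)^-1 * \int[leb3]_y (h y / enorm (x - y)).

Definition potential (h : E3 -> R) (x : E3) : R := - (4 * pi) * newton h x.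

Definition L2w (D : set E3) (w : E3 -> R) : set (E3 -> R) :=
  [set h : E3 -> R | measurable_fun D h /\
           (\int[leb3]_(x in D) (w x * h x ^+ 2)%:E < +oo)%E].

Definition L2wv (D : set E3) (w : E3 -> R) : set (E3 -> E3) :=
  [set q : E3 -> E3 | measurable_fun D q /\
           (\int[leb3]_(x in D) (w x * dot3 (q x) (q x))%:E < +oo)%E].

Definition test_function (D : set E3) (phi : E3 -> R) : Prop :=
  [/\ exists K : set E3,
        [/\ compact K, K `<=` D & forall x, ~ K x -> phi x = 0],
      forall x, differentiable phi x &
      continuous (grad phi)].

(* Tests of class C^1 suffice: for locally integrable [q] and [g], mollification
   gives the same notion as smooth tests. *)
Definition weak_div (D : set E3) (q : E3 -> E3) (g : E3 -> R) : Prop :=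
  forall phi, test_function D phi ->
    \int[leb3]_(x in D) dot3 (q x) (grad phi x)
    = - \int[leb3]_(x in D) (g x * phi x).

End Space.

(* Radial functions are represented by their profiles; a symmetric form is
   given by its bilinear version, the quadratic form being its diagonal. *)
Section Forms.
Context {R : realType}.
Local Notation form := ((R -> R) -> (R -> R) -> R).
Implicit Types (V : set (R -> R)) (q k : form).

Definition L2rad (Rd : R) (w : R -> R) : set (R -> R) :=
  [set eta | L2w (eball Rd) (radial w) (radial eta)].

Definition sqnorm (Rd : R) (w eta : R -> R) : R :=
  \int[leb3]_(x in eball Rd) (radial w x * radial eta x ^+ 2).

Definition zero_mean (Rd : R) : set (R -> R) :=
  [set eta | \int[leb3]_(x in eball Rd) radial eta x = 0].

(* [q] is negative definite on some [n]-dimensional subspace of [V]: strict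
   negativity for all nonzero coefficients makes the family [e] independent,
   also modulo almost everywhere equality. *)
Definition has_negative_subspace V q (n : nat) : Prop :=
  exists e : 'I_n -> R -> R,
    (forall i, V (e i)) /\
    (forall c : 'I_n -> R, (exists i, c i != 0) ->
       q (\sum_i c i *: e i) (\sum_i c i *: e i) < 0).

Definition morse_index V q (n : nat) : Prop :=
  has_negative_subspace V q n /\
  (forall m, has_negative_subspace V q m -> (m <= n)%N).

Definition form_ker V q : set (R -> R) :=
  [set eta | V eta /\ forall xi, V xi -> q eta xi = 0].

Definition ae_zero (Rd : R) (eta : R -> R) : Prop :=
  {ae leb3, forall x, eball Rd x -> radial eta x = 0}.

Definition trivial_ker (Rd : R) V q : Prop :=
  forall eta, form_ker V q eta -> ae_zero Rd eta.

Definition one_dim_ker (Rd : R) V q : Prop :=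
  exists eta0, [/\ form_ker V q eta0, ~ ae_zero Rd eta0 &
    forall eta, form_ker V q eta -> exists c : R, ae_zero Rd (eta - c *: eta0)].

(* [N] is the square of the norm in the definitions below. *)
Definition coercive V (N : (R -> R) -> R) q : Prop :=
  exists2 kappa : R, 0 < kappa & forall eta, V eta -> kappa * N eta <= q eta eta.

Definition bilinear_on V q : Prop :=
  forall (c : R) xi xi' zeta, V xi -> V xi' -> V zeta ->
    q (c *: xi + xi') zeta = c * q xi zeta + q xi' zeta /\
    q zeta (c *: xi + xi') = c * q zeta xi + q zeta xi'.

Definition symmetric_on V q : Prop :=
  forall xi zeta, V xi -> V zeta -> q xi zeta = q zeta xi.

Definition bounded_form V (N : (R -> R) -> R) q : Prop :=
  exists C : R, forall xi zeta, V xi -> V zeta ->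
    `|q xi zeta| <= C * Num.sqrt (N xi) * Num.sqrt (N zeta).

(* The induced operator xi |-> k(xi, .) into the dual is compact: the images of
   a bounded sequence have a subsequence that is Cauchy for the dual norm. *)
Definition compact_form V (N : (R -> R) -> R) k : Prop :=
  [/\ bilinear_on V k, bounded_form V N k &
    forall xi : nat -> R -> R, (forall n, V (xi n)) ->
      (exists C : R, forall n, N (xi n) <= C) ->
      exists2 s : nat -> nat, {homo s : m n / (m < n)%N} &
        forall eps : R, 0 < eps -> exists n0 : nat, forall m n,
          (n0 <= m)%N -> (n0 <= n)%N -> forall zeta, V zeta ->
            `|k (xi (s m)) zeta - k (xi (s n)) zeta|
              <= eps * Num.sqrt (N zeta)].

Definition norm_continuous (I : set R) V (N : (R -> R) -> R) (q : R -> form) :=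
  forall mu0, I mu0 -> forall eps : R, 0 < eps ->
    \forall mu \near within I (nbhs mu0),
      forall xi, V xi -> `|q mu xi xi - q mu0 xi xi| <= eps * N xi.

Definition coercive_plus_compact
    (I : set R) V (N : (R -> R) -> R) (q : R -> form) : Prop :=
  exists (a k : R -> form) (kappa : R), 0 < kappa /\
    forall mu, I mu ->
      [/\ bilinear_on V (a mu), symmetric_on V (a mu), bounded_form V N (a mu),
          forall xi, V xi -> kappa * N xi <= a mu xi xi &
          compact_form V N (k mu) /\
          forall xi zeta, V xi -> V zeta ->
            q mu xi zeta = a mu xi zeta + k mu xi zeta].

Definition regular_form_family
    (I : set R) V (N : (R -> R) -> R) (q : R -> form) : Prop :=
  [/\ norm_continuous I V N q, coercive_plus_compact I V N q &
      forall mu, I mu -> exists n, morse_index V (q mu) n].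

Definition pullback (Rd : R) (eta : R -> R) (s : R) : R := Rd ^+ 3 * eta (Rd * s).

Definition pullback_inv (Rd : R) (xi : R -> R) (r : R) : R :=
  Rd ^- 3 * xi (r / Rd).

Definition pull_form (Rd : R) q : form :=
  fun xi zeta => q (pullback_inv Rd xi) (pullback_inv Rd zeta).

End Forms.

(* [rho] is the radial profile of the density, [Rd] the radius of the star, and
   the entropy is [f \o rho]. *)
Section Star.
Context {R : realType}.
Variables (P : R -> R -> R) (f : R -> R).
Local Notation E3 := (R * R * R)%type.
Local Notation leb := (@lebesgue_measure R).

Definition vacuum_expansion (g0 al0 : R) (J : set R) (K : R -> R) : Prop :=
  [/\ Ck_on J 2 K, 0 < inf (K @` J) &
    forall j k : nat, (j + k <= 2)%N ->
      exists (C delta : R), 0 < delta /\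
        forall S t : R, J S -> 0 < t < delta ->
          `|pderiv J `]0, +oo[ j k (fun s t' => P s t' - K s * t' `^ g0) S t|
            <= C * t `^ (g0 - k%:R + al0)].

Record hypP (g0 al0 : R) : Prop := HypP {
  P_C3 : Ck2_on setT `]0, +oo[ 3 P;
  P_C1 : Ck2_on setT `[0, +oo[ 1 P;
  P_vacuum : forall S, P S 0 = 0;
  P_rho_gt0 : forall S t : R, 0 < t -> 0 < derive1 (P S) t;
  P_S_gt0 : forall S t : R, 0 < t -> 0 < derive1 (P^~ t) S;
  P_gamma : 6 / 5 < g0 < 2;
  P_alpha : 0 < al0;
  P_expansion : forall j0 j1 : R, j0 < j1 ->
    exists K, vacuum_expansion g0 al0 `[j0, j1] K;
  P_third : forall j0 j1 : R, j0 < j1 ->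
    exists C : R, forall j k : nat, (j + k = 3)%N ->
      forall S t : R, j0 <= S <= j1 -> 0 < t <= 1 ->
        `|pderiv setT `]0, +oo[ j k P S t| <= C * t `^ (g0 - k%:R) }.

Definition Ptilde (t : R) : R := P (f t) t.

Variables (rho : R -> R) (Rd : R).

(* Derivatives with respect to the density are relative to [0, rho(0)], the
   interval on which [f] is regular. *)
Definition dPtilde (t : R) : R := derive_in `[0, rho 0] Ptilde t.

Definition df (t : R) : R := derive_in `[0, rho 0] f t.

Definition weight1 (r : R) : R := dPtilde (rho r) / rho r.

Definition coefG (r : R) : R :=
  - derive1 (P^~ (rho r)) (f (rho r)) * df (rho r) / rho r.

Definition mass : R := 4 * pi * \int[leb]_(r in `[0, Rd]) (r ^+ 2 * rho r).

Record hypEs (g0 al0 : R) : Prop := HypEs {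
  Es_radius : 0 < Rd;
  Es_supp : closure [set x : E3 | radial rho x != 0] = [set x | enorm x <= Rd];
  Es_equilibrium : forall x : E3, eball Rd x ->
    [/\ differentiable (fun y : E3 => P (f (radial rho y)) (radial rho y)) x,
        differentiable (potential (radial rho) : E3 -> R) x &
        grad (fun y : E3 => P (f (radial rho y)) (radial rho y)) x
        + radial rho x *: grad (potential (radial rho)) x = 0];
  Es_mass : 0 < mass;
  Es_rho_C2 : Ck_on `[0, Rd[ 2 rho;
  Es_rho_C1 : Ck_on `[0, Rd] 1 rho;
  Es_rho_center : 0 < rho 0;
  Es_rho_decr : forall r : R, 0 < r < Rd -> derive1 rho r < 0;
  Es_rho_bdry : rho Rd = 0;
  Es_f_C1 : Ck_on `[0, rho 0] 1 f;
  Es_f_C2 : Ck_on `]0, rho 0[ 2 f;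
  Es_dPtilde : forall r : R, 0 <= r < Rd -> 0 < dPtilde (rho r);
  Es_G_gt0 : {ae leb, forall r : R, 0 < r < Rd -> 0 < coefG r};
  Es_G_inv : forall K : set E3, compact K -> K `<=` eball Rd ->
    leb3.-integrable K (fun x => (radial coefG x)^-1%:E);
  Es_G_bdry : exists C : R, \forall r \near Rd^'-,
    0 < coefG r <= C * rho r `^ (g0 - 1);
  Es_sound : exists (j0 j1 : R) (K : R -> R),
    [/\ j0 < j1, j0 <= f 0 <= j1, vacuum_expansion g0 al0 `[j0, j1] K,
        0 < g0 * K (f 0) &
        dPtilde t / t `^ (g0 - 1) @[t --> 0^'+] --> g0 * K (f 0)] }.

Definition X1rad : set (R -> R) := L2rad Rd weight1.

Definition X1sqnorm (eta : R -> R) : R := sqnorm Rd weight1 eta.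

Definition Hrad : set (R -> R) := X1rad `&` zero_mean Rd.

Definition Imass (eta : R -> R) (r : R) : R :=
  4 * pi * \int[leb]_(s in `[0, r]) (s ^+ 2 * eta s).

Definition Top (eta : R -> R) (r : R) : R :=
  derive1 rho r / (4 * pi * r ^+ 2 * rho r) * Imass eta r.

Definition Lform (eta xi : R -> R) : R :=
  \int[leb3]_(x in eball Rd) (radial weight1 x * radial eta x * radial xi x)
  - 4 * pi * \int[leb3]_(x in eball Rd)
      (newton (radial eta \_ (eball Rd)) x * radial xi x).

Definition Qform (eta xi : R -> R) : R :=
  Lform eta xi +
  \int[leb3]_(x in eball Rd)
    (radial coefG x * radial (eta - Top eta) x * radial (xi - Top xi) x).

Definition state : Type := ((E3 -> R) * (E3 -> R) * (E3 -> E3))%type.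

Definition inX (eta zeta : E3 -> R) : Prop :=
  L2w (eball Rd) (radial weight1) eta /\ L2w (eball Rd) (radial coefG) zeta.

Definition inXdual (p1 p2 : E3 -> R) : Prop :=
  L2w (eball Rd) (fun x => (radial weight1 x)^-1) p1 /\
  L2w (eball Rd) (fun x => (radial coefG x)^-1) p2.

Definition inY (u : E3 -> E3) : Prop := L2wv (eball Rd) (radial rho) u.

Definition inYdual (q : E3 -> E3) : Prop :=
  L2wv (eball Rd) (fun x => (radial rho x)^-1) q.

Definition a0 (x : E3) : E3 := (radial rho x)^-1 *: grad (radial rho) x.

(* Graph of B on its maximal domain: B q = (k1, k2). *)
Definition Bgraph (q : E3 -> E3) (k1 k2 : E3 -> R) : Prop :=
  [/\ inYdual q, inX k1 k2, weak_div (eball Rd) q (fun x => - k1 x) &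
      {ae leb3, forall x, eball Rd x -> k2 x = k1 x + dot3 (a0 x) (q x)}].

(* Graph of the dual B' : X* -> Y of B: B'(p1, p2) = y. *)
Definition Bdual_graph (p1 p2 : E3 -> R) (y : E3 -> E3) : Prop :=
  [/\ inXdual p1 p2, inY y &
    forall q k1 k2, Bgraph q k1 k2 ->
      \int[leb3]_(x in eball Rd) (p1 x * k1 x + p2 x * k2 x)
      = \int[leb3]_(x in eball Rd) dot3 (y x) (q x)].

Definition Aop (u : E3 -> E3) (x : E3) : E3 := radial rho x *: u x.

Definition bigL1 (eta : E3 -> R) (x : E3) : R :=
  radial weight1 x * eta x - 4 * pi * newton (eta \_ (eball Rd)) x.

Definition bigL2 (zeta : E3 -> R) (x : E3) : R := radial coefG x * zeta x.

(* Graph of the generator: z' = (B A u, - B' L (eta, zeta)) for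
   z = (eta, zeta, u). *)
Definition generator_graph (z z' : state) : Prop :=
  let: (eta, zeta, u) := z in
  let: (eta', zeta', u') := z' in
  Bgraph (Aop u) eta' zeta' /\
  Bdual_graph (bigL1 eta) (bigL2 zeta) (fun x => - u' x).

Definition radial_state (z : state) : Prop :=
  let: (eta, zeta, u) := z in
  exists g1 g2 g3 : R -> R, forall x, eball Rd x ->
    [/\ eta x = g1 (enorm x), zeta x = g2 (enorm x) &
        u x = (g3 (enorm x) / enorm x) *: x].

Definition in_phase_space (z : state) : Prop :=
  let: (eta, zeta, u) := z in inX eta zeta /\ inY u.

Definition null_state (z : state) : Prop :=
  let: (eta, zeta, u) := z in
  {ae leb3, forall x, eball Rd x -> [/\ eta x = 0, zeta x = 0 & u x = 0]}.

(* The generator is real: z1 + i z2 is an eigenvector of its complexification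
   for the eigenvalue a + i b iff the two real equations below hold. *)
Definition growing_radial_mode : Prop :=
  exists (a b : R) (z1 z2 : state), 0 < a /\
    [/\ in_phase_space z1 /\ in_phase_space z2,
        radial_state z1 /\ radial_state z2,
        ~ (null_state z1 /\ null_state z2),
        generator_graph z1 (a *: z1 - b *: z2) &
        generator_graph z2 (b *: z1 + a *: z2)].

End Star.

Section Branch.
Context {R : realType}.
Variables (P : R -> R -> R) (f : R -> R).
Variables (a b : R) (rho : R -> R -> R) (radius : R -> R).
Local Notation E3 := (R * R * R)%type.
Local Notation I := (`[a, b]%classic : set R).

Definition Mass (mu : R) : R := mass (rho mu) (radius mu).

Definition dMass : R -> R := derive_in I Mass.

Definition d2Mass : R -> R := derive_in I dMass.

Definition compactness (mu : R) : R := Mass mu / radius mu.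

Definition drho (mu r : R) : R := derive_in I (rho^~ r) mu.

Definition d2rho (mu r : R) : R := derive_in I (drho^~ r) mu.

Definition v_ (mu r : R) : R := if r < radius mu then drho mu r else 0.

Definition L_ (mu : R) := Lform P f (rho mu) (radius mu).

Definition Q_ (mu : R) := Qform P f (rho mu) (radius mu).

Definition X_ (mu : R) := X1rad P f (rho mu) (radius mu).

Definition X_sqnorm (mu : R) := X1sqnorm P f (rho mu) (radius mu).

Definition H_ (mu : R) := Hrad P f (rho mu) (radius mu).

(* the positive-density interior, in the (mu, r) half-plane *)
Definition interior_region : set (R * R) :=
  [set p | I p.1 /\ 0 <= p.2 < radius p.1].

(* The fixed radial Hilbert space is a weighted L^2 space on the unit ball;
   there is no other choice up to equivalent norms, since it is isomorphic
   through [pullback] to a weighted L^2 space. *)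
Record hypF : Prop := HypF {
  F_mass : Ck_on I 2 Mass;
  F_radius : Ck_on I 2 radius;
  F_rho_derivable : forall mu r, interior_region (mu, r) ->
    derivable_in I (rho^~ r) mu /\ derivable_in I (drho^~ r) mu;
  F_rho_cont : {within interior_region, continuous (fun p => rho p.1 p.2)};
  F_drho_cont : {within interior_region, continuous (fun p => drho p.1 p.2)};
  F_d2rho_cont : {within interior_region, continuous (fun p => d2rho p.1 p.2)};
  F_v : forall mu, I mu -> X_ mu (v_ mu);
  F_v_mass : forall mu, I mu ->
    \int[leb3]_(x in eball (radius mu)) radial (v_ mu) x = dMass mu;
  F_forms : exists omega : R -> R,
    [/\ measurable_fun (`]0, 1[ : set R) omega,
        forall s : R, 0 < s < 1 -> 0 < omega s,
        forall mu, I mu ->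
          (forall eta, X_ mu eta <-> L2rad 1 omega (pullback (radius mu) eta)) /\
          exists c C : R, [/\ 0 < c, 0 < C & forall eta, X_ mu eta ->
            c * X_sqnorm mu eta <= sqnorm 1 omega (pullback (radius mu) eta)
              <= C * X_sqnorm mu eta],
        regular_form_family I (L2rad 1 omega) (sqnorm 1 omega)
          (fun mu => pull_form (radius mu) (L_ mu)) &
        regular_form_family I (L2rad 1 omega `&` zero_mean 1) (sqnorm 1 omega)
          (fun mu => pull_form (radius mu) (Q_ mu))] }.

Definition simple_mass_extremum (mu : R) : Prop :=
  [/\ I mu, dMass mu = 0 & d2Mass mu != 0].

Definition radial_stability_transition (mu : R) : Prop :=
  [/\ simple_mass_extremum mu, a < mu < b,
      one_dim_ker (radius mu) (H_ mu) (Q_ mu) &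
      exists delta : R, 0 < delta /\ exists n m : nat,
        [/\ n = m.+1 \/ m = n.+1,
            forall nu, I nu -> 0 < `|nu - mu| < delta ->
              trivial_ker (radius nu) (H_ nu) (Q_ nu),
            forall nu, I nu -> mu - delta < nu < mu ->
              morse_index (H_ nu) (Q_ nu) n &
            forall nu, I nu -> mu < nu < mu + delta ->
              morse_index (H_ nu) (Q_ nu) m]].

Definition is_first (E : R -> Prop) (mu : R) : Prop :=
  E mu /\ forall nu, E nu -> mu <= nu.

Definition first_turning_point_principle : Prop :=
  exists mu, is_first radial_stability_transition mu /\
             is_first simple_mass_extremum mu.

End Branch.

(* Main.v *)
Require Import Defs.
From HB Require Import structures.
From mathcomp Require Import all_boot all_order all_algebra.
From mathcomp Require Import all_classical all_reals all_analysis.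
From mathcomp Require Import measurable_realfun ring lra.

Set Implicit Arguments.
Unset Strict Implicit.
Unset Printing Implicit Defensive.

Import Order.TTheory GRing.Theory Num.Theory.
Import numFieldNormedType.Exports.

Local Open Scope classical_set_scope.
Local Open Scope ring_scope.

(** At a mass extremum the tangent [v] of the branch is a perturbation of zero
    mass, and differentiating the equation of hydrostatic equilibrium along the
    branch ([branch_equation]) shows that [w v - 4 pi U v] is constant. Hence
    [L v] is a multiple of the mass functional: [v] is isotropic for [L] and
    orthogonal to all perturbations of zero mass. Since [Ker L = 0], [v] pairs
    nontrivially with some vector, and together they span a hyperbolic plane which
    contains the only negative direction of [L]. Therefore [L] is nonnegative on
    the perturbations of zero mass, with null vectors the multiples of [v]
    ([isotropic_orthogonal_ge0], [isotropic_orthogonal_null]).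

    The entropy part of [Q] removes this null direction. It is nonnegative, and it
    vanishes at [v] only if [v = T v], that is, if the mass enclosed by [v] is
    proportional to the density; the enclosed mass vanishes at the center, where
    the density does not, so [v] would be zero, against [v 0 = 1]
    ([branch_v_center], [entropy_gap]). Thus [Q] is positive definite on the
    perturbations of zero mass ([Q_definite]), and being the sum of a coercive and
    a compact form it is coercive ([coercive_of_positive]). Transported to the
    unit ball the forms are norm-continuous in the parameter, so coercivity
    persists near the extremum. A coercive form has no kernel, which excludes a
    stability transition at the extremum, and the first turning-point principle if
    the extremum is the first one.

    For a growing mode, the two equations of the eigenvalue problem paired with
    the mode itself give a vanishing total energy. The first half of the system
    is a continuity equation. Testing it with squares of truncated paraboloids
    shows that the radial momentum is minus the enclosed mass over the square of
    the radius ([flux_of_moments]); the total mass vanishes because the kinetic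
    energy is finite and the density decays at least linearly at the surface
    ([no_flux_at_surface]); and the entropy variable is [eta - T eta]
    ([continuity_equation]). The energy is then [Q] plus the kinetic energy, and
    coercivity makes the mode zero ([no_growing_radial_mode]).

    All of this is one-dimensional once integrals over balls are written in the
    radius and the Newtonian potential of a radial density is given by the formula
    for spherical shells ([integral_newton], [newton_radial_ball]). *)

(** * Linear changes of variables for the Lebesgue measure *)
Section LinearSubstitution.
Context {R : realType}.
Local Open Scope ereal_scope.
Local Notation leb := (@lebesgue_measure R).
Implicit Types (f : R -> \bar R) (c d : R).

Lemma measurable_affine c d : measurable_fun [set: R] (fun x : R => (c * x + d)%R).
Proof. by apply: measurable_funD => //; exact: mulrl_measurable. Qed.

Lemma lebesgue_measure_affine c d : (0 < c)%R -> forall A : set R, measurable A ->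
  leb A = (c%:E * leb ((fun x : R => (c * x + d)%R) @^-1` A)).
Proof.
move=> c0 A mA.
pose phi : measurableTypeR R -> measurableTypeR R := fun x : R => (c * x + d)%R.
have mphi : measurable_fun [set: measurableTypeR R] phi by exact: measurable_affine.
pose c' : {nonneg R} := NngNum (ltW c0).
pose nu := (mscale c' (pushforward leb phi) : {measure set (measurableTypeR R) -> \bar R}).
have nuE : forall B, nu mphi B = c%:E * leb (phi @^-1` B) by [].
rewrite -nuE; apply: lebesgue_measure_unique => // _ [[a b]] _ <-.
rewrite nuE /mscale /pushforward/=.
have -> : phi @^-1` `]a, b] = `]((a - d) / c)%R, ((b - d) / c)%R]%classic.
  apply/seteqP; split => x /=; rewrite !in_itv/= /phi ler_pdivlMr// ltr_pdivrMr//
    lerBrDr ltrBlDr mulrC; lra.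
rewrite !lebesgue_measure_itv/= !lte_fin ltr_pM2r ?invr_gt0// ltrD2r.
case: ifP => _; last by rewrite mule0.
by rewrite !EFinN -!EFinD -EFinM; congr EFin; field; rewrite gt_eqF.
Qed.

Lemma ge0_integral_affine c d f : (0 < c)%R ->
  measurable_fun [set: R] f -> (forall x, 0 <= f x) ->
  \int[leb]_x f x = c%:E * \int[leb]_x f (c * x + d)%R.
Proof.
move=> c0 mf f0.
pose phi : measurableTypeR R -> measurableTypeR R := fun x : R => (c * x + d)%R.
have mphi : measurable_fun [set: measurableTypeR R] phi by exact: measurable_affine.
pose c' : {nonneg R} := NngNum (ltW c0).
pose nu := (mscale c' (pushforward leb phi) : {measure set (measurableTypeR R) -> \bar R}).
transitivity (\int[nu mphi]_x f x).
  by apply: eq_measure_integral => A mA _; exact: lebesgue_measure_affine.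
rewrite /nu ge0_integral_mscale//; congr (_ * _).
by rewrite (ge0_integral_pushforward mphi)// preimage_setT.
Qed.

Lemma ge0_integral_shift d f : measurable_fun [set: R] f ->
  (forall x, 0 <= f x) -> \int[leb]_x f x = \int[leb]_x f (x + d)%R.
Proof.
move=> mf f0; rewrite (@ge0_integral_affine 1 d)// mul1e.
by apply: eq_integral => x _; rewrite mul1r.
Qed.

Lemma ge0_integral_scale c f : (0 < c)%R -> measurable_fun [set: R] f ->
  (forall x, 0 <= f x) -> \int[leb]_x f x = c%:E * \int[leb]_x f (c * x)%R.
Proof.
move=> c0 mf f0; rewrite (@ge0_integral_affine c 0)//; congr (_ * _).
by apply: eq_integral => x _; rewrite addr0.
Qed.

Lemma ge0_integral_reflect f : measurable_fun [set: R] f ->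
  (forall x, 0 <= f x) -> \int[leb]_x f x = \int[leb]_x f (- x)%R.
Proof.
move=> mf f0.
pose phi : measurableTypeR R -> measurableTypeR R := -%R.
have mphi : measurable_fun [set: measurableTypeR R] phi by exact: oppr_measurable.
transitivity (\int[pushforward leb phi]_x f x).
  by apply: eq_measure_integral => A mA _; exact/esym/lebesgue_measureN.
by rewrite (ge0_integral_pushforward mphi)// preimage_setT.
Qed.

End LinearSubstitution.

(** * Measurability of elementary expressions *)
Section Measurability.
Context {R : realType}.

Lemma measurable_inv : measurable_fun [set: R] (fun x : R => x^-1).
Proof.
have -> : [set: R] = [set x | x != 0] `|` [set 0].
  by apply/seteqP; split => // x _ /=; case: eqVneq => [->|]; [right|left].
have o : open [set x : R | x != 0] by exact: open_neq.
apply/measurable_funU => //; first exact: open_measurable.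
split; last exact: measurable_fun_set1.
apply: open_continuous_measurable_fun => // x; rewrite inE/= => x0.
exact: inv_continuous.
Qed.

Lemma measurable_sqrtr : measurable_fun [set: R] (fun x : R => Num.sqrt x).
Proof. by apply: continuous_measurable_fun; exact: sqrt_continuous. Qed.

End Measurability.

Ltac meas := repeat match goal with
  | |- measurable_fun _ (fun x => x) => exact: measurable_id
  | |- measurable_fun _ (fun x => GRing.add (@?f x) (GRing.opp (@?g x))) =>
      apply: (measurable_funB (f := f) (g := g))
  | |- measurable_fun _ (fun x => GRing.add (@?f x) (@?g x)) =>
      apply: (measurable_funD (f := f) (g := g))
  | |- measurable_fun _ (fun x => GRing.mul (@?f x) (@?g x)) =>
      apply: (measurable_funM (f := f) (g := g))
  | |- measurable_fun _ (fun x => GRing.exp (@?f x) _) =>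
      apply: (measurable_funX (f := f))
  | |- measurable_fun _ (fun x => GRing.opp (@?f x)) =>
      apply: (measurable_funN (f := f))
  | |- measurable_fun _ (fun x => GRing.inv (@?f x)) =>
      apply: (measurableT_comp measurable_inv (g := f))
  | |- measurable_fun _ (fun x => Num.sqrt (@?f x)) =>
      apply: (measurableT_comp measurable_sqrtr (g := f))
  | |- measurable_fun _ (fun x => Order.max (@?f x) (@?g x)) =>
      apply: (measurable_maxr (f := f) (g := g))
  | |- measurable_fun _ (fun x => EFin (@?f x)) =>
      apply/measurable_EFinP
  | |- measurable_fun _ (fun x => mule (@?f x) (@?g x)) =>
      apply: (emeasurable_funM (f := f) (g := g))
  | |- measurable_fun _ (fun x => (@?f x, @?g x)) =>
      apply: (measurable_fun_pair (f := f) (g := g))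
  | |- measurable_fun _ (fun x => fst (@?f x)) =>
      apply: (measurableT_comp measurable_fst (g := f))
  | |- measurable_fun _ (fun x => snd (@?f x)) =>
      apply: (measurableT_comp measurable_snd (g := f))
  | |- measurable_fun _ (fun x => ?F (@?f x)) =>
      (* a measurable function in the context *)
      match goal with H : measurable_fun _ F |- _ => apply: (measurableT_comp H (g := f)) end
  | |- _ => progress (by [])
  end.

(** * Polar coordinates in the plane and in space *)
Section Polar.
Context {R : realType}.
Local Open Scope ereal_scope.
Local Notation leb := (@lebesgue_measure R).
Local Notation posp x := (Num.max x 0)%R.

Definition leb2 : set (measurableTypeR R * measurableTypeR R)%type -> \bar R :=
  leb \x leb.
HB.instance Definition _ := Measure.on leb2.

Lemma leb2_sigma_finite : sigma_finite setT leb2.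
Proof.
have /sigma_finiteP[F [TF ndF Foo]] := sigma_finiteT leb.
exists (fun n => F n `*` F n).
  rewrite -setXTT TF predeqE => -[x y]; split.
    move=> [/= [n _ Fnx] [k _ Gky]]; exists (maxn n k) => //; split.
    - by move: x Fnx; exact/subsetPset/ndF/leq_maxl.
    - by move: y Gky; exact/subsetPset/ndF/leq_maxr.
  by move=> [n _ []/= ? ?]; split; exists n.
move=> k; have [? ?] := Foo k.
split; first exact: measurableX.
by rewrite /leb2 product_measure1E// lte_mul_pinfty// ge0_fin_numE.
Qed.
HB.instance Definition _ :=
  Measure_isSigmaFinite.Build _ _ _ leb2 leb2_sigma_finite.

Lemma leb2_integral (f : R * R -> \bar R) : measurable_fun [set: R * R] f ->
  (forall x, 0 <= f x) -> \int[leb2]_z f z = \int[leb]_x \int[leb]_y f (x, y).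
Proof. by move=> mf f0; exact: (@fubini_tonelli1 _ _ _ _ _ leb leb f mf f0). Qed.

Lemma integral_swap (f : R * R -> \bar R) : measurable_fun [set: R * R] f ->
  (forall x, 0 <= f x) ->
  \int[leb]_x \int[leb]_y f (x, y) = \int[leb]_y \int[leb]_x f (x, y).
Proof. by move=> mf f0; exact: (@fubini_tonelli _ _ _ _ _ leb leb f mf f0). Qed.

Lemma leb3_integral21 (f : R * R * R -> \bar R) :
  measurable_fun [set: R * R * R] f -> (forall x, 0 <= f x) ->
  \int[leb3]_z f z = \int[leb]_x \int[leb2]_y f (y, x).
Proof. by move=> mf f0; exact: (@fubini_tonelli2 _ _ _ _ _ leb2 leb f mf f0). Qed.

Lemma leb3_integral12 (f : R * R * R -> \bar R) :
  measurable_fun [set: R * R * R] f -> (forall x, 0 <= f x) ->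
  \int[leb3]_z f z = \int[leb2]_x \int[leb]_y f (x, y).
Proof. by move=> mf f0; exact: (@fubini_tonelli1 _ _ _ _ _ leb2 leb f mf f0). Qed.

Lemma measurable_integral (f : R * R -> \bar R) : measurable_fun [set: R * R] f ->
  (forall x, 0 <= f x) -> measurable_fun [set: R] (fun x => \int[leb]_y f (x, y)).
Proof. by move=> mf f0; exact: (@measurable_fun_fubini_tonelli_F _ _ _ _ _ leb f mf f0). Qed.

Lemma ge0_integral_muler (k : \bar R) (f : R -> \bar R) : 0 <= k ->
  measurable_fun [set: R] f -> (forall x, 0 <= f x) ->
  \int[leb]_x (f x * k) = (\int[leb]_x f x) * k.
Proof.
move=> k0 mf f0; rewrite muleC -ge0_integralZl//.
by apply: eq_integral => x _; rewrite muleC.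
Qed.

Let J (t : R) : R := Num.sqrt (1 + t ^+ 2).

Let mJ : measurable_fun [set: R] J.
Proof. by rewrite /J; meas. Qed.

Let J_gt0 t : (0 < J t)%R.
Proof. by rewrite sqrtr_gt0 ltr_pwDl// sqr_ge0. Qed.

Let sqrtJ (x t : R) : Num.sqrt (x ^+ 2 + (x * t) ^+ 2)%R = (`|x| * J t)%R.
Proof. by rewrite exprMn -{1}(mulr1 (x ^+ 2)%R) -mulrDr sqrtrM ?sqr_ge0// sqrtr_sqr. Qed.

Let normr_posp (x : R) : `|x|%R = (posp x + posp (- x))%R.
Proof.
case: (leP x 0%R) => x0; first by rewrite ler0_norm// add0r; case: leP => //; lra.
by rewrite gtr0_norm//; case: leP => //; lra.
Qed.

Lemma integral_even_weight (K : R -> \bar R) : measurable_fun [set: R] K ->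
  (forall x, 0 <= K x) ->
  \int[leb]_x (`|x|%:E * K `|x|%R) = 2%:E * \int[leb]_x ((posp x)%:E * K x).
Proof.
move=> mK K0.
have mn : measurable_fun [set: R] (fun x : R => `|x|%R) by exact: normr_measurable.
have pE (x : R) : (posp x)%:E * K `|x|%R = (posp x)%:E * K x.
  by have [x0|x0] := leP x 0%R; rewrite ?mul0e// gtr0_norm.
transitivity (\int[leb]_x ((posp x)%:E * K `|x|%R + (posp (- x))%:E * K `|x|%R)).
  apply: eq_integral => x _; rewrite -ge0_muleDl ?lee_fin ?le_max ?lexx ?orbT//.
  by rewrite -EFinD; congr (_%:E * _); exact: normr_posp.
have mp : measurable_fun [set: R] (fun x : R => (posp x)%:E * K `|x|%R) by meas.
have p0 : forall x : R, 0 <= (posp x)%:E * K `|x|%R.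
  by move=> y; rewrite mule_ge0// lee_fin le_max lexx orbT.
rewrite ge0_integralD//=; last 2 first.
- by move=> x _; rewrite mule_ge0// lee_fin le_max lexx orbT.
- by meas.
rewrite -[X in _ + X](_ : \int[leb]_x ((posp (- - x))%:E * K `|- - x|%R) = _); last first.
  rewrite [RHS]ge0_integral_reflect//.
  - by apply: eq_integral => x _; rewrite normrN opprK.
  - by meas.
  - by move=> x; rewrite mule_ge0// lee_fin le_max lexx orbT.
under [X in _ + X]eq_integral do rewrite opprK.
rewrite (_ : 2%:E = 1 + 1)%E; last by rewrite -EFinD.
rewrite ge0_muleDl// mul1e; congr (_ + _); apply: eq_integral => x _; exact: pE.
Qed.

Lemma integral_half_lines (f : R -> \bar R) : measurable_fun [set: R] f ->
  (forall x, 0 <= f x) -> \int[leb]_x f x =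
  \int[leb]_(x in `[0%R, +oo[) f x + \int[leb]_(x in `[0%R, +oo[) f (- x)%R.
Proof.
move=> mf f0.
have mfN : measurable_fun [set: R] (fun x : R => f (- x)%R).
  by apply: measurableT_comp => //; exact: oppr_measurable.
rewrite [X in _ + X]ge0_integration_by_substitution0//.
under [X in _ + X]eq_integral do rewrite opprK.
rewrite -(setUv (`]-oo, 0%R]%classic : set R)) ge0_integral_setU//; last 3 first.
- by rewrite setCitvl.
- by rewrite setUv.
- by apply/disj_setPS => x [].
rewrite addeC; congr (_ + _); rewrite setCitvl -[RHS](integral_setD1 (r := 0%R))//.
- congr (integral _ _ _); apply/seteqP; split => x /=; rewrite !in_itv/= !andbT.
    by move=> x0; split; [exact: ltW|move=> xE; rewrite xE ltxx in x0].
  by move=> [x0 /eqP xN0]; rewrite lt_neqAle eq_sym xN0.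
- by apply: measurableD.
- exact: measurable_funTS.
Qed.

Lemma integral_oneDsqrV : \int[leb]_t ((J t ^+ 2)^-1)%:E = pi%:E.
Proof.
have JE t : (J t ^+ 2 = 1 + t ^+ 2)%R.
  by rewrite sqr_sqrtr// addr_ge0 ?sqr_ge0.
rewrite integral_half_lines; last 2 first.
- by meas.
- by move=> t; rewrite lee_fin invr_ge0 sqr_ge0.
rewrite [in RHS](splitr pi) EFinD; congr (_ + _).
  by rewrite -integral0y_oneDsqr; apply: eq_integral => t _; rewrite JE.
by rewrite -integral0y_oneDsqr; apply: eq_integral => t _; rewrite JE sqrrN.
Qed.

(** No polar coordinates: on each vertical line substitute the slope for the
    height, exchange the integrals and scale. The angular integral becomes the
    integral of [1 / (1 + t ^ 2)]. *)
Lemma integral_planar_radial (G : R -> \bar R) : measurable_fun [set: R] G ->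
  (forall x, 0 <= G x) ->
  \int[leb2]_p G (Num.sqrt (p.1 ^+ 2 + p.2 ^+ 2))%R =
  (2 * pi)%:E * \int[leb]_s ((posp s)%:E * G s).
Proof.
move=> mG G0.
have mGJ : measurable_fun [set: R * R] (fun p => G (p.1 * J p.2)%R) by meas.
pose H (x : R) := \int[leb]_t G (x * J t)%R.
have mH : measurable_fun [set: R] H.
  by apply: (measurable_integral mGJ).
have H0 x : 0 <= H x by exact: integral_ge0.
have mn : measurable_fun [set: R] (fun x : R => `|x|%R) by exact: normr_measurable.
have mf : measurable_fun [set: R * R]
    (fun p => G (Num.sqrt (p.1 ^+ 2 + p.2 ^+ 2))%R) by meas.
rewrite leb2_integral//=.
transitivity (\int[leb]_x (`|x|%:E * H `|x|%R)).
  have m0 : measurable ([set: R] `\ 0%R) by apply: measurableD.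
  rewrite -[LHS](integral_setD1 (r := 0%R))//; last first.
    by apply/measurable_funTS; apply: (measurable_integral mf).
  rewrite -[RHS](integral_setD1 (r := 0%R))//; last first.
    by apply/measurable_funTS; meas.
  apply: eq_integral => x; rewrite inE/= => -[_ /eqP x0].
  rewrite (@ge0_integral_scale _ `|x|%R) ?normr_gt0//; last first.
    by apply: (measurableT_comp mf (g := fun y => (x, y))); meas.
  congr (_ * _); apply: eq_integral => t _; congr G.
  by rewrite -(real_normK (num_real x)) sqrtJ normr_id.
rewrite integral_even_weight//.
rewrite EFinM -muleA; congr (_ * _).
pose C := \int[leb]_s ((posp s)%:E * G s).
transitivity (\int[leb]_x \int[leb]_t ((posp x)%:E * G (x * J t)%R)).
  apply: eq_integral => x _; rewrite ge0_integralZl//.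
  - by apply: (measurableT_comp mG); meas.
  - by rewrite lee_fin le_max lexx orbT.
rewrite (@integral_swap (fun p => (posp p.1)%:E * G (p.1 * J p.2)%R)); last 2 first.
- by meas.
- by move=> p; rewrite mule_ge0// lee_fin le_max lexx orbT.
rewrite -/C -integral_oneDsqrV -ge0_integral_muler//; last 3 first.
- by apply: integral_ge0 => s _; rewrite mule_ge0// lee_fin le_max lexx orbT.
- by meas.
- by move=> t; rewrite lee_fin invr_ge0 sqr_ge0.
apply: eq_integral => t _ /=.
rewrite /C (@ge0_integral_scale _ (J t))//; last 2 first.
- by meas.
- by move=> x; rewrite mule_ge0// lee_fin le_max lexx orbT.
rewrite muleA -EFinM.
rewrite -ge0_integralZl//; last 3 first.
- by meas.
- by move=> x _; rewrite mule_ge0// lee_fin le_max lexx orbT.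
- by rewrite lee_fin mulr_ge0// ?invr_ge0 ?sqr_ge0// ltW.
apply: eq_integral => x _; rewrite muleA -EFinM [(J t * x)%R]mulrC.
congr (_%:E * _).
have -> : Num.max (x * J t)%R 0%R = (posp x * J t)%R.
  by rewrite maxr_pMl ?mul0r// ltW.
by field; rewrite gt_eqF.
Qed.

End Polar.

Section Axial.
Context {R : realType}.
Local Open Scope ereal_scope.
Local Notation leb := (@lebesgue_measure R).
Local Notation posp x := (Num.max x 0)%R.
Let J (t : R) : R := Num.sqrt (1 + t ^+ 2).

Let mJ : measurable_fun [set: R] J.
Proof. by rewrite /J; meas. Qed.

Let J2 t : (J t ^+ 2 = 1 + t ^+ 2)%R.
Proof. by rewrite sqr_sqrtr// addr_ge0 ?sqr_ge0. Qed.

Let J_gt0 t : (0 < J t)%R.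
Proof. by rewrite sqrtr_gt0 ltr_pwDl// sqr_ge0. Qed.

Let posp_ge0 (x : R) : (0 <= posp x)%R.
Proof. by rewrite le_max lexx orbT. Qed.

Let pm0 (x : R) y : 0 <= y -> 0 <= (posp x)%:E * y.
Proof. by move=> y0; rewrite mule_ge0// lee_fin. Qed.

(** The integral in space of a function of the radius and of the height: in
    each horizontal plane polar coordinates are used, and the height is then
    replaced by its ratio [t] to the distance from the axis, so that only linear
    changes of variables are involved. *)
Lemma integral_space_axial (F : R * R -> \bar R) :
  measurable_fun [set: R * R] F -> (forall x, 0 <= F x) ->
  \int[leb3]_y F (enorm y, y.2) = (2 * pi)%:E *
    \int[leb]_s ((posp s ^+ 2)%:E *
      \int[leb]_t ((J t ^- 3)%:E * F (s, s * (t / J t))%R)).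
Proof.
move=> mF F0.
have Jn0 t : J t != 0%R by rewrite gt_eqF.
have mf : measurable_fun [set: R * R * R] (fun y => F (enorm y, y.2)).
  by rewrite /enorm /dot3; meas.
rewrite leb3_integral21//=.
pose G (z q : R) := F (Num.sqrt (q ^+ 2 + z ^+ 2)%R, z).
have G0 z q : 0 <= G z q by rewrite /G.
have mG2 : measurable_fun [set: R * R] (fun p => G p.1 p.2) by rewrite /G; meas.
transitivity (\int[leb]_z ((2 * pi)%:E * \int[leb]_q ((posp q)%:E * G z q))).
  apply: eq_integral => z _; rewrite -integral_planar_radial//; last first.
    by rewrite /G; meas.
  apply: eq_integral => p _; rewrite /G /enorm /dot3 /=.
  by congr (F (Num.sqrt _, _)); rewrite sqr_sqrtr ?addr_ge0 ?sqr_ge0// !expr2.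
have m1 : measurable_fun [set: R * R] (fun p => (posp p.2)%:E * G p.1 p.2).
  by rewrite /G; meas.
have m2 : measurable_fun [set: R * R]
    (fun p => (posp p.1 ^+ 2)%:E * F (p.1 * J p.2, p.1 * p.2)%R) by meas.
have m3 : measurable_fun [set: R * R]
    (fun p => (posp p.1 ^+ 2)%:E * ((J p.2 ^- 3)%:E * F (p.1, p.1 * (p.2 / J p.2))%R)).
  by meas.
rewrite ge0_integralZl//; last 3 first.
- by apply: (measurable_integral m1) => p; exact: pm0.
- by move=> z _; apply: integral_ge0 => q _; exact: pm0.
- by rewrite lee_fin mulr_ge0// pi_ge0.
congr (_ * _).
rewrite (integral_swap m1)//=; last by move=> p; exact: pm0.
transitivity (\int[leb]_q \int[leb]_t ((posp q ^+ 2)%:E * F (q * J t, q * t)%R)).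
  apply: eq_integral => q _; have [q0|q0] := leP q 0%R.
    by rewrite !integral0_eq// => x _; rewrite ?expr0n ?mul0e.
  rewrite [LHS](@ge0_integral_scale _ q)//; last 2 first.
  - by rewrite /G; meas.
  - by move=> z; rewrite mule_ge0// lee_fin ltW.
  rewrite -ge0_integralZl//; last 3 first.
  - by rewrite /G; meas.
  - by move=> z _; rewrite mule_ge0// lee_fin ltW.
  - by rewrite lee_fin ltW.
  apply: eq_integral => t _; rewrite muleA -EFinM /G; congr (_ * F (_, _)).
  by rewrite -[in RHS](gtr0_norm q0) -sqrtr_sqr /J -sqrtrM ?sqr_ge0//
     exprMn mulrDr mulr1.
rewrite (integral_swap m2)//=; last by move=> p; rewrite mule_ge0// lee_fin sqr_ge0.
transitivity (\int[leb]_t \int[leb]_s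
   ((posp s ^+ 2)%:E * ((J t ^- 3)%:E * F (s, s * (t / J t))%R))).
  apply: eq_integral => t _.
  rewrite [RHS](@ge0_integral_scale _ (J t))//; last 2 first.
  - by meas.
  - by move=> s; rewrite !mule_ge0// lee_fin ?sqr_ge0// invr_ge0 exprn_ge0// ltW.
  rewrite -ge0_integralZl//; last 3 first.
  - by meas.
  - by move=> s _; rewrite !mule_ge0// lee_fin ?sqr_ge0// invr_ge0 exprn_ge0// ltW.
  - by rewrite lee_fin ltW.
  apply: eq_integral => s _; rewrite !muleA -!EFinM.
  have -> : posp (J t * s)%R = (posp s * J t)%R.
    by rewrite maxr_pMl ?mul0r ?ltW// mulrC.
  congr (_%:E * F (_, _)); first by field.
  - by rewrite mulrC.
  - by field.
rewrite -(integral_swap m3)//=; last first.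
  by move=> s; rewrite !mule_ge0// lee_fin ?sqr_ge0// invr_ge0 exprn_ge0// ltW.
apply: eq_integral => s _; rewrite ge0_integralZl//.
- by meas.
- by move=> t _; rewrite mule_ge0// lee_fin invr_ge0 exprn_ge0// ltW.
- by rewrite lee_fin sqr_ge0.
Qed.

End Axial.

Section Cosine.
Context {R : realType}.
Local Notation leb := (@lebesgue_measure R).
Let J (t : R) : R := Num.sqrt (1 + t ^+ 2).

Let mJ : measurable_fun [set: R] J.
Proof. by rewrite /J; meas. Qed.

Let J2 t : (J t ^+ 2 = 1 + t ^+ 2)%R.
Proof. by rewrite sqr_sqrtr// addr_ge0 ?sqr_ge0. Qed.

Let J_gt0 t : (0 < J t)%R.
Proof. by rewrite sqrtr_gt0 ltr_pwDl// sqr_ge0. Qed.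

Lemma is_derive_continuous (f : R -> R) (x d : R) :
  is_derive x 1 f d -> {for x, continuous f}.
Proof. by move=> [h _]; apply/differentiable_continuous/derivable1_diffP. Qed.

Let dJ (t : R) : is_derive t 1 J (t / J t).
Proof.
have h : is_derive t 1 (fun t : R => 1 + t ^+ 2) (t *+ 2).
  by apply: is_derive_eq; rewrite /GRing.scale /=; ring.
have p : 0 < 1 + t ^+ 2 by rewrite ltr_pwDl// sqr_ge0.
have := @is_derive1_comp _ Num.sqrt (fun t : R => 1 + t ^+ 2) t _ _ (is_derive1_sqrt p) h.
move=> h2; apply: (is_derive_eq h2).
by rewrite -/(J t); field; rewrite gt_eqF.
Qed.

Let du (t : R) : is_derive t 1 (fun t => t / J t) (J t ^- 3).
Proof.
have Jn0 : J t != 0 by rewrite gt_eqF.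
have hV := is_deriveV Jn0 (dJ t).
have := @is_deriveM _ _ id (fun y => (J y)^-1) t 1 _ _ (is_derive_id _ _) hV.
move=> h; apply: (is_derive_eq h).
rewrite /= /GRing.scale/=.
apply: (mulfI (expf_neq0 3 Jn0)); rewrite divff ?expf_neq0//.
have := J2 t; set j := J t in Jn0 *; move=> j2.
transitivity (j ^+ 2 - t ^+ 2); last by rewrite j2; ring.
by field.
Qed.

Let u_abs t : -1 <= t / J t <= 1.
Proof.
rewrite ler_pdivlMr// ler_pdivrMr// mul1r mulN1r -ler_norml.
by rewrite -(ler_pXn2r (n := 2)) ?nnegrE ?(ltW (J_gt0 t))// J2 real_normK ?num_real// lerDr.
Qed.

Let u_cvg : (fun t => t / J t) t @[t --> +oo%R] --> (1 : R).
Proof.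
apply/cvgrPdist_le => e e0.
near=> t.
have t0 : 0 < t by near: t; exact: nbhs_pinfty_gt.
have te : e^-1 <= t by near: t; apply: nbhs_pinfty_ge; exact: num_real.
have Jt : t <= J t.
  apply: (le_trans (ler_norm t)).
  by rewrite -sqrtr_sqr /J ler_sqrt ?lerDr// ?addr_ge0 ?sqr_ge0.
rewrite ger0_norm ?subr_ge0 ?ler_pdivrMr ?mul1r//.
have JtE : (J t - t) * (J t + t) = 1 by rewrite -subr_sqr J2; ring.
have : J t - t <= t^-1.
  rewrite -[leLHS](mulfK (_ : J t + t != 0)) ?gt_eqF ?addr_gt0// JtE mul1r.
  by rewrite lef_pV2 ?posrE ?addr_gt0// lerDr ltW.
move=> h; apply: le_trans (_ : J t - t <= _).
  rewrite -[X in X - _](divff (_ : J t != 0)) ?gt_eqF// -mulrBl.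
  rewrite ler_pdivrMr// ler_peMr ?subr_ge0//.
  by rewrite -[leLHS]sqrtr1 /J ler_sqrt ?lerDl ?addr_ge0 ?sqr_ge0.
by apply: (le_trans h); rewrite -[leRHS]invrK lef_pV2 ?posrE// invr_gt0.
Unshelve. all: by end_near. Qed.

Let half_line (k K : R -> R) :
  (forall u, -1 <= u <= 1 -> [/\ 0 <= k u, {for u, continuous k} & is_derive u 1 K (k u)]) ->
  (\int[leb]_(t in `[0%R, +oo[) (J t ^- 3 * k (t / J t))%:E = (K 1 - K 0)%:E)%E.
Proof.
move=> h.
have dK (t : R) : is_derive t 1 (fun t => K (t / J t)) (J t ^- 3 * k (t / J t)).
  have [_ _ dk] := h _ (u_abs t).
  apply: (is_derive_eq (@is_derive1_comp _ K (fun t => t / J t) t _ _ dk (du t))).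
  by rewrite mulrC.
rewrite (@ge0_continuous_FTC2y _ _ (fun t => K (t / J t)) _ (K 1)).
- by rewrite mul0r EFinB.
- move=> t _; have [k0 _ _] := h _ (u_abs t).
  by rewrite mulr_ge0// invr_ge0 exprn_ge0// ltW.
- have cf : continuous (fun t => J t ^- 3 * k (t / J t)).
    move=> t; apply: (@continuousM _ _ (fun t => J t ^- 3) (fun t => k (t / J t))).
      have c3 : {for t, continuous (fun t => J t ^+ 3)}.
        exact: (continuous_comp (is_derive_continuous (dJ t)) (@exprn_continuous R 3 (J t))).
      have n3 : J t ^+ 3 != 0 by rewrite expf_neq0// gt_eqF.
      exact: (continuous_comp c3 (inv_continuous n3)).
    have [_ ck _] := h _ (u_abs t).
    exact: (continuous_comp (is_derive_continuous (du t)) ck).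
  exact: continuous_subspaceT.
- have h1 : -1 <= (1:R) <= 1 by rewrite lexx andbT; lra.
  have [_ _ /is_derive_continuous cK] := h _ h1.
  exact: (continuous_cvg _ cK u_cvg).
- by move=> t _; apply: ex_derive.
- apply: cvg_at_right_filter.
  exact: (is_derive_continuous (dK 0)).
- by move=> t _; rewrite derive1E; apply: derive_val.
Qed.

(** [t / J t] is the cosine of the polar angle: this is the fundamental theorem
    of calculus in that variable. *)
Lemma integral_cosine (k K : R -> R) : measurable_fun [set: R] k ->
  (forall u, -1 <= u <= 1 -> [/\ 0 <= k u, {for u, continuous k} & is_derive u 1 K (k u)]) ->
  (\int[leb]_t (J t ^- 3 * k (t / J t))%:E = (K 1 - K (-1))%:E)%E.
Proof.
move=> mk h; rewrite integral_half_lines; last 2 first.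
- by meas.
- move=> t; have [k0 _ _] := h _ (u_abs t).
  by rewrite lee_fin mulr_ge0// invr_ge0 exprn_ge0// ltW.
rewrite (half_line h).
rewrite [X in (_ + X)%E](_ : _ = (\int[leb]_(t in `[0%R, +oo[)
   (J t ^- 3 * (fun u => k (- u)) (t / J t))%:E)%E); last first.
  by apply: eq_integral => t _; rewrite /J sqrrN mulNr.
rewrite (@half_line (fun u => k (- u)) (fun u => - K (- u))); last first.
  move=> u u1; have u1' : -1 <= - u <= 1 by lra.
  have [k0 ck dk] := h _ u1'; split => //.
    by apply: (continuous_comp (f := -%R)) => //; exact: opp_continuous.
  have dN : is_derive u 1 (fun x : R => - x) (-1) by apply: is_derive_eq.
  have := is_deriveN (@is_derive1_comp _ K (fun x => - x) u _ _ dk dN).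
  by move=> h'; apply: (is_derive_eq h'); rewrite mulrN1 opprK.
by rewrite -EFinD oppr0; congr EFin; ring.
Qed.

End Cosine.

Section Newtonian.
Context {R : realType}.
Local Notation leb := (@lebesgue_measure R).
Local Notation posp x := (Num.max x 0)%R.
Local Notation E3 := (R * R * R)%type.
Let J (t : R) : R := Num.sqrt (1 + t ^+ 2).

Let mJ : measurable_fun [set: R] J.
Proof. by rewrite /J; meas. Qed.

Let J_gt0 t : (0 < J t)%R.
Proof. by rewrite sqrtr_gt0 ltr_pwDl// sqr_ge0. Qed.

Lemma measurable_enorm : measurable_fun [set: E3] (@enorm R).
Proof. by rewrite /enorm /dot3; meas. Qed.

Lemma dot3xx_ge0 (x : E3) : 0 <= dot3 x x.
Proof. by rewrite /dot3 -!expr2 !addr_ge0 ?sqr_ge0. Qed.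

Lemma enorm_sqr (x : E3) : enorm x ^+ 2 = dot3 x x.
Proof. by rewrite sqr_sqrtr// dot3xx_ge0. Qed.

Lemma enorm_ge0 (x : E3) : 0 <= enorm x.
Proof. exact: sqrtr_ge0. Qed.

Let cosine_int (c s : R) : 0 < s -> s != `|c| ->
  (\int[leb]_t (J t ^- 3 * (Num.sqrt (s ^+ 2 + c ^+ 2 - 2 * c * (s * (t / J t))))^-1)%:E
   = (2 / Num.max s `|c|)%:E)%E.
Proof.
move=> s0 sc.
pose q (u : R) := s ^+ 2 + c ^+ 2 - 2 * c * (s * u).
have mq : measurable_fun [set: R] q by rewrite /q; meas.
have q0 (u : R) : -1 <= u <= 1 -> 0 < q u.
  move=> /andP[u1 u2].
  apply: (@lt_le_trans _ _ ((s - `|c|) ^+ 2)).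
    by rewrite lt0r sqr_ge0 andbT expf_neq0// subr_eq0.
  have -> : (s - `|c|) ^+ 2 = s ^+ 2 + c ^+ 2 - s * `|c| * 2.
    by rewrite -(real_normK (num_real c)); ring.
  have cu : c * u <= `|c|.
    apply: (le_trans (ler_norm _)); rewrite normrM -[leRHS]mulr1 ler_wpM2l//.
    by rewrite ler_norml u1 u2.
  have : s * (c * u) <= s * `|c| by rewrite ler_pM2l.
  by rewrite /q; lra.
have dq (u : R) : is_derive u 1 q (- (2 * c * s)).
  by rewrite /q; apply: is_derive_eq; rewrite /GRing.scale/=; ring.
have dsq (u : R) : -1 <= u <= 1 ->
    is_derive u 1 (fun u => Num.sqrt (q u)) (- (c * s) / Num.sqrt (q u)).
  move=> u1.
  apply: (is_derive_eq (@is_derive1_comp _ Num.sqrt q u _ _ (is_derive1_sqrt (q0 _ u1)) (dq u))).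
  by field; rewrite gt_eqF// sqrtr_gt0 q0.
pose k u := (Num.sqrt (q u))^-1.
have mk : measurable_fun [set: R] k by rewrite /k; meas.
have k0 u : 0 <= k u by rewrite invr_ge0 sqrtr_ge0.
have ck (u : R) : -1 <= u <= 1 -> {for u, continuous k}.
  move=> u1; have sn0 : Num.sqrt (q u) != 0 by rewrite gt_eqF// sqrtr_gt0 q0.
  exact: (continuous_comp (is_derive_continuous (dsq u u1)) (inv_continuous sn0)).
have [c0|c0] := eqVneq c 0.
  rewrite (@integral_cosine _ k (fun u => u / s))//.
    by rewrite c0 normr0 max_l ?ltW//; congr EFin; field; rewrite gt_eqF.
  move=> u u1; split; [exact: k0|exact: ck|].
  rewrite /k /q c0 mulr0 mul0r subr0 expr0n addr0 sqrtr_sqr gtr0_norm//.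
  by apply: is_derive_eq; rewrite /GRing.scale/=; ring.
rewrite (@integral_cosine _ k (fun u => - (c * s)^-1 * Num.sqrt (q u)))//; last first.
  move=> u u1; split; [exact: k0|exact: ck|].
  have := dsq u u1; move=> d1.
  have h := @is_deriveZ _ _ _ (fun u => Num.sqrt (q u)) (- (c * s)^-1) u 1 _ d1.
  apply: (is_derive_eq h); rewrite /GRing.scale/= /k.
  by field; rewrite c0 !gt_eqF// sqrtr_gt0 q0.
congr EFin; rewrite /q mulr1 mulrN1.
have -> : s ^+ 2 + c ^+ 2 - 2 * c * s = (s - c) ^+ 2 by ring.
have -> : s ^+ 2 + c ^+ 2 - 2 * c * - s = (s + c) ^+ 2 by ring.
rewrite !sqrtr_sqr.
have [cp|cn] := leP 0 c.
  have cp' : 0 < c by rewrite lt_neqAle eq_sym c0.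
  rewrite (ger0_norm cp) in sc *; rewrite (gtr0_norm (addr_gt0 s0 cp')).
  have [sc'|sc'] := leP s c.
    by rewrite ler0_norm ?subr_le0//; field; rewrite c0 gt_eqF.
  by rewrite gtr0_norm ?subr_gt0//; field; rewrite c0 gt_eqF.
rewrite (ltr0_norm cn) in sc *; have p : 0 < s - c by lra.
rewrite (gtr0_norm p).
have [sc'|sc'] := leP s (- c).
  by rewrite ler0_norm; [field; rewrite c0 gt_eqF|lra].
by rewrite gtr0_norm; [field; rewrite c0 gt_eqF|lra].
Qed.

(** In the cosine of the polar angle the inverse distance to a point of the axis
    has an explicit primitive. *)
Lemma integral_axis_newton (G : R -> \bar R) (c : R) : measurable_fun [set: R] G ->
  (forall x, 0 <= G x)%E ->
  (\int[leb3]_y (G (enorm y) * ((enorm (((0, 0), c) - y))^-1)%:E) =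
   (4 * pi)%:E * \int[leb]_s ((posp s ^+ 2 / Num.max s `|c|)%:E * G s))%E.
Proof.
move=> mG G0.
have mx : measurable_fun [set: R] (fun x : R => Num.max x `|c|) by meas.
pose F (p : R * R) : \bar R :=
  (G p.1 * ((Num.sqrt (p.1 ^+ 2 + c ^+ 2 - 2 * c * p.2))^-1)%:E)%E.
have mF : measurable_fun [set: R * R] F by rewrite /F; meas.
have F0 p : (0 <= F p)%E by rewrite mule_ge0// lee_fin invr_ge0 sqrtr_ge0.
transitivity (\int[leb3]_y F (enorm y, y.2))%E.
  apply: eq_integral => y _; rewrite /F/=; congr (_ * (_^-1)%:E)%E.
  by rewrite {1}/enorm; congr Num.sqrt; rewrite enorm_sqr /dot3/=; ring.
rewrite integral_space_axial// -/J (_ : 4 * pi = 2 * pi * 2); last by ring.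
rewrite [(2 * pi * 2)%:E]EFinM -muleA; congr (_ * _)%E.
rewrite -ge0_integralZl//; last 2 first.
- by meas.
- by move=> x _; rewrite mule_ge0// lee_fin divr_ge0 ?sqr_ge0// le_max normr_ge0 orbT.
have m0 : measurable ([set: R] `\ `|c|) by apply: measurableD.
rewrite -[LHS](integral_setD1 (r := `|c|))//; last first.
  apply/measurable_funTS; meas.
  apply: (measurable_integral (f := fun p => (J p.2 ^- 3)%:E * F (p.1, p.1 * (p.2 / J p.2))%R)%E).
    by meas.
  by move=> p; rewrite mule_ge0// lee_fin invr_ge0 exprn_ge0// ltW.
rewrite -[RHS](integral_setD1 (r := `|c|))//; last by apply/measurable_funTS; meas.
apply: eq_integral => s; rewrite inE/= => -[_ /eqP sc].
have [s0|s0] := leP s 0; first by rewrite expr0n mul0r !mul0e mule0.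
rewrite /F/=.
transitivity ((s ^+ 2)%:E * (G s * (2 / Num.max s `|c|)%:E))%E; last first.
  by rewrite [(G s * _)%E]muleC !muleA -!EFinM; congr (_%:E * _)%E; ring.
congr (_ * _)%E; rewrite -cosine_int//.
rewrite -ge0_integralZl//; last 2 first.
- by meas.
- by move=> x _; rewrite lee_fin mulr_ge0// invr_ge0 ?sqrtr_ge0// exprn_ge0// ltW.
by apply: eq_integral => t _; rewrite muleCA -EFinM.
Qed.

Lemma integral_radial (G : R -> \bar R) : measurable_fun [set: R] G ->
  (forall x, 0 <= G x)%E ->
  (\int[leb3]_y G (enorm y) = (4 * pi)%:E * \int[leb]_s ((posp s ^+ 2)%:E * G s))%E.
Proof.
move=> mG G0.
rewrite (@integral_space_axial _ (fun p => G p.1))//; last by meas.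
rewrite -/J (_ : 4 * pi = 2 * pi * 2); last by ring.
rewrite [(2 * pi * 2)%:E]EFinM -muleA; congr (_ * _)%E.
rewrite -ge0_integralZl//; last 2 first.
- by meas.
- by move=> x _; rewrite mule_ge0// lee_fin sqr_ge0.
apply: eq_integral => s _ /=; rewrite muleCA; congr (_ * _)%E.
rewrite ge0_integral_muler//; last by meas.
congr (_ * _)%E.
transitivity (\int[leb]_t (J t ^- 3 * cst 1 (t / J t))%:E)%E.
  by apply: eq_integral => t _; rewrite /= mulr1.
rewrite (@integral_cosine R (cst 1) id)//; first by congr EFin; rewrite /=; ring.
by move=> u _; split => //=; [exact: cvg_cst|exact: is_derive_id].
Qed.

(** ** Invariance of the volume under rotations *)

Let shear1 (n1 n2 a : R) (y : E3) : E3 :=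
  (y.1.1 + y.2 * (a * n1), y.1.2 + y.2 * (a * n2), y.2).
Let shear2 (n1 n2 b : R) (y : E3) : E3 :=
  (y.1, y.2 + b * (n1 * y.1.1 + n2 * y.1.2)).

Let integral_shear1 n1 n2 a (f : E3 -> \bar R) : measurable_fun [set: E3] f ->
  (forall x, 0 <= f x)%E ->
  (\int[leb3]_y f y = \int[leb3]_y f (shear1 n1 n2 a y))%E.
Proof.
move=> mf f0.
have ms : measurable_fun [set: E3] (fun y => f (shear1 n1 n2 a y)).
  by rewrite /shear1; meas.
rewrite (leb3_integral21 mf f0) [RHS](leb3_integral21 ms (fun y => f0 (shear1 n1 n2 a y))).
apply: eq_integral => z _.
rewrite leb2_integral//; last by meas.
rewrite [RHS]leb2_integral//; last by rewrite /shear1/=; meas.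
rewrite /shear1 /=.
rewrite (ge0_integral_shift (z * (a * n1)))//=; last 2 first.
- by apply: (measurable_integral (f := fun p => f (p.1, p.2, z))); meas.
- by move=> x; exact: integral_ge0.
apply: eq_integral => x _.
by rewrite (ge0_integral_shift (z * (a * n2)))//=; meas.
Qed.

Let integral_shear2 n1 n2 b (f : E3 -> \bar R) : measurable_fun [set: E3] f ->
  (forall x, 0 <= f x)%E ->
  (\int[leb3]_y f y = \int[leb3]_y f (shear2 n1 n2 b y))%E.
Proof.
move=> mf f0.
have ms : measurable_fun [set: E3] (fun y => f (shear2 n1 n2 b y)).
  by rewrite /shear2; meas.
rewrite (leb3_integral12 mf f0) [RHS](leb3_integral12 ms (fun y => f0 (shear2 n1 n2 b y))).
apply: eq_integral => p _.
by rewrite (ge0_integral_shift (b * (n1 * p.1 + n2 * p.2)))//=; meas.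
Qed.

(** Newton's theorem, the potential of a radial density: a rotation, which is a
    product of three shears, brings [x] on the vertical axis. *)
Lemma integral_newton (G : R -> \bar R) (x : E3) : measurable_fun [set: R] G ->
  (forall s, 0 <= G s)%E ->
  (\int[leb3]_y (G (enorm y) * ((enorm (x - y))^-1)%:E) =
   (4 * pi)%:E * \int[leb]_s ((posp s ^+ 2 / Num.max s (enorm x))%:E * G s))%E.
Proof.
move=> mG G0; move: x => [[x1 x2] x3].
pose l := Num.sqrt (x1 ^+ 2 + x2 ^+ 2).
have l0 : 0 <= l by exact: sqrtr_ge0.
have l2 : l ^+ 2 = x1 ^+ 2 + x2 ^+ 2 by rewrite sqr_sqrtr// addr_ge0// sqr_ge0.
have [lz|ln0] := eqVneq l 0.
  have /eqP := l2; rewrite lz expr0n/= eq_sym paddr_eq0 ?sqr_ge0// !sqrf_eq0.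
  move=> /andP[/eqP -> /eqP ->]; rewrite integral_axis_newton//.
  by rewrite /enorm /dot3/= !mulr0 !add0r -expr2 sqrtr_sqr.
pose r := enorm (x1, x2, x3).
have r2 : r ^+ 2 = l ^+ 2 + x3 ^+ 2 by rewrite enorm_sqr l2 /dot3/=; ring.
have lp : 0 < l by rewrite lt_neqAle eq_sym ln0.
have rp : 0 < r.
  rewrite lt_neqAle enorm_ge0 andbT eq_sym -sqrf_eq0 r2 paddr_eq0 ?sqr_ge0//.
  by rewrite sqrf_eq0 (negbTE ln0).
have rx3 : r + x3 != 0.
  apply/eqP => h; have : x3 ^+ 2 = r ^+ 2 by rewrite (_ : x3 = - r) ?sqrrN//; lra.
  rewrite r2 => h2; have /eqP : l ^+ 2 = 0 by lra.
  by rewrite sqrf_eq0 (negbTE ln0).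
have rn0 : r != 0 by rewrite gt_eqF.
pose n1 := x1 / l; pose n2 := x2 / l.
pose t := l / (r + x3); pose s := l / r.
pose Ry y := shear1 n1 n2 (- t) (shear2 n1 n2 s (shear1 n1 n2 (- t) y)).
pose w (y : E3) := n1 * y.1.1 + n2 * y.1.2.
have n12 : n1 ^+ 2 + n2 ^+ 2 = 1.
  by rewrite /n1 /n2 !expr_div_n -mulrDl -l2 divff// expf_neq0.
have wS (y : E3) : n1 * (y.1.1 + y.2 * (- t * n1)) + n2 * (y.1.2 + y.2 * (- t * n2))
   = w y - t * y.2.
  transitivity (w y - t * y.2 * (n1 ^+ 2 + n2 ^+ 2)); last by rewrite n12 mulr1.
  by rewrite /w; ring.
have R2 y : (Ry y).2 = s * w y + x3 / r * y.2.
  rewrite /Ry /shear1 /shear2/= wS /s /t.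
  have e : l * l = (r - x3) * (r + x3).
    by rewrite -expr2 -subr_sqr r2; ring.
  transitivity (y.2 + l / r * w y - (l * l) / (r * (r + x3)) * y.2).
    by field; rewrite rx3 rn0.
  by rewrite e; field; rewrite rx3 rn0.
have Rn y : enorm (Ry y) = enorm y.
  rewrite /enorm; congr Num.sqrt.
  have zE := R2 y; set z := (Ry y).2 in zE.
  have e1 : (Ry y).1.1 = y.1.1 - t * (y.2 + z) * n1.
    by rewrite /z /Ry /shear1 /shear2/=; ring.
  have e2 : (Ry y).1.2 = y.1.2 - t * (y.2 + z) * n2.
    by rewrite /z /Ry /shear1 /shear2/=; ring.
  rewrite /dot3 e1 e2 -/z.
  transitivity (y.1.1 ^+ 2 + y.1.2 ^+ 2 - 2 * (t * (y.2 + z)) * w y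
     + (t * (y.2 + z)) ^+ 2 * (n1 ^+ 2 + n2 ^+ 2) + z ^+ 2).
    by rewrite /w; ring.
  rewrite n12 mulr1.
  have tz : t * (y.2 + z) = (l / r) ^+ 2 * (r / (r + x3)) * w y + s * y.2.
    rewrite zE /t /s.
    by field; rewrite rx3 rn0.
  have e3 : (l / r) ^+ 2 * (r / (r + x3)) = (r - x3) / r.
    have -> : (l / r) ^+ 2 = (r - x3) * (r + x3) / r ^+ 2.
      by rewrite expr_div_n -subr_sqr r2; congr (_ / _); ring.
    by field; rewrite rx3 rn0.
  rewrite tz e3 zE /s.
  have -> : y.1.1 * y.1.1 + y.1.2 * y.1.2 + y.2 * y.2 = y.1.1 ^+ 2 + y.1.2 ^+ 2 + y.2 ^+ 2.
    by ring.
  have : l ^+ 2 = r ^+ 2 - x3 ^+ 2 by rewrite r2; ring.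
  move: (w y) (y.1.1) (y.1.2) (y.2) => W y1 y2 y3 LE.
  transitivity (y1 ^+ 2 + y2 ^+ 2
    + (- 2 * ((r - x3) / r) * W ^+ 2 + ((r - x3) / r) ^+ 2 * W ^+ 2)
    + l ^+ 2 / r ^+ 2 * (W ^+ 2 + y3 ^+ 2) + (x3 / r) ^+ 2 * y3 ^+ 2
    + 2 * W * y3 * (l / r) * ((r - x3) / r - 1 + x3 / r)).
    by field.
  by rewrite LE; field.
have dE y : enorm (((0, 0), r) - Ry y) = enorm ((x1, x2, x3) - y).
  rewrite /enorm; congr Num.sqrt.
  transitivity (enorm (Ry y) ^+ 2 + r ^+ 2 - 2 * r * (Ry y).2).
    by rewrite enorm_sqr /dot3/=; ring.
  rewrite Rn R2 enorm_sqr r2 l2 /dot3/= /w /s /n1 /n2; field.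
  by rewrite rn0 ln0.
pose f (y : E3) : \bar R := (G (enorm y) * ((enorm (((0, 0), r) - y))^-1)%:E)%E.
have mf : measurable_fun [set: E3] f.
  by rewrite /f /enorm /dot3 /=; meas.
have f0 y : (0 <= f y)%E by rewrite mule_ge0// lee_fin invr_ge0 enorm_ge0.
have := integral_axis_newton r mG G0; rewrite (ger0_norm (ltW rp)) => <-.
rewrite [RHS](integral_shear1 n1 n2 (- t) mf f0).
rewrite [RHS](integral_shear2 n1 n2 s)//; last by rewrite /shear1; meas.
rewrite [RHS](integral_shear1 n1 n2 (- t))//; last by rewrite /shear1 /shear2; meas.
by apply: eq_integral => y _; rewrite -/(Ry y) /f Rn dE.
Qed.

End Newtonian.

(** * Integrals of radial functions over a ball *)
Section RadialBall.
Context {R : realType}.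
Local Notation leb := (@lebesgue_measure R).
Local Notation posp x := (Num.max x 0)%R.
Local Notation E3 := (R * R * R)%type.

Lemma measurable_eball (r : R) : measurable (eball r : set E3).
Proof.
rewrite (_ : eball r = setT `&` (@enorm R) @^-1` `]-oo, r[%classic).
  by apply: measurable_enorm => //.
by apply/seteqP; split => x; rewrite /= in_itv//= => -[].
Qed.

Let N := [set y : E3 | enorm y = 0].

Let mN : measurable N.
Proof.
rewrite (_ : N = setT `&` (@enorm R) @^-1` [set 0]).
  by apply: measurable_enorm => //.
by apply/seteqP; split => x //= -[].
Qed.

Let N0 : leb3 N = 0%E.
Proof.
transitivity (\int[leb3]_y (\1_N y : R)%:E)%E; first by rewrite integral_indic// setIT.
transitivity (\int[leb3]_y (\1_([set 0] : set R) (enorm y) : R)%:E)%E; first by [].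
have m0 : measurable_fun [set: R] (fun s => (\1_([set 0] : set R) s : R)%:E).
  by apply/measurable_EFinP; exact: measurable_indic.
have p0 s : (0 <= (\1_([set 0] : set R) s : R)%:E)%E by rewrite lee_fin.
rewrite (integral_radial m0 p0).
rewrite integral0_eq ?mule0// => s _; rewrite indicE.
have [->|s0] := eqVneq s 0; first by rewrite maxxx expr0n mul0e.
by rewrite memNset ?mule0//; apply/eqP.
Qed.

Let ae_off_origin (f g : E3 -> \bar R) : measurable_fun [set: E3] f ->
  measurable_fun [set: E3] g -> (forall y, enorm y != 0 -> f y = g y) ->
  (\int[leb3]_y f y = \int[leb3]_y g y)%E.
Proof.
move=> mf mg fg; apply: ae_eq_integral => //.
exists N; split => // y /= /not_implyP[_ h].
by apply: contrapT => /eqP y0; apply: h; exact: fg.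
Qed.

Let mule_sub (k : R) (A B : \bar R) : (0 < k)%R -> (0 <= A)%E -> (0 <= B)%E ->
  (k%:E * A - k%:E * B = k%:E * (A - B))%E.
Proof.
move=> k0; case: A B => [x| |] [y| |] //= _ _.
- by congr EFin; ring.
- by rewrite gt0_muley ?lte_fin//= gt0_muleNy ?lte_fin.
- by rewrite gt0_muley ?lte_fin.
- by rewrite gt0_muley ?lte_fin//= gt0_muleNy ?lte_fin.
Qed.

Let maxe_mul (a k : R) : (0 <= k)%R -> (maxe (a * k)%:E 0 = maxe a%:E 0 * k%:E)%E.
Proof. by move=> k0; rewrite -!EFin_max -EFinM maxr_pMl// mul0r. Qed.

(** An integral formula for nonnegative densities passes to signed ones, also
    when both sides are degenerate. *)
Let signed_formula (kap : E3 -> R) (kap' : R -> R) (k : R) : (0 < k)%R ->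
  measurable_fun [set: E3] kap -> measurable_fun [set: R] kap' ->
  (forall y, 0 <= kap y)%R -> (forall s, 0 <= kap' s)%R ->
  (forall G : R -> \bar R, measurable_fun [set: R] G -> (forall s, 0 <= G s)%E ->
   \int[leb3]_y (G (enorm y) * (kap y)%:E) = k%:E * \int[leb]_s ((kap' s)%:E * G s))%E ->
  forall g : R -> R, measurable_fun [set: R] g ->
  (\int[leb3]_y (g (enorm y) * kap y)%:E = k%:E * \int[leb]_s (kap' s * g s)%:E)%E.
Proof.
move=> k0 mk mk' kge0 k'ge0 h g mg.
have mp : measurable_fun [set: R] (fun s => (EFin \o g)^\+ s)%E.
  by apply: measurable_funepos; exact/measurable_EFinP.
have mn : measurable_fun [set: R] (fun s => (EFin \o g)^\- s)%E.
  by apply: measurable_funeneg; exact/measurable_EFinP.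
rewrite integralE [in RHS]integralE -mule_sub//; last 2 first.
- by apply: integral_ge0 => s _.
- by apply: integral_ge0 => s _.
congr (_ - _)%E.
- transitivity (\int[leb3]_y ((EFin \o g)^\+ (enorm y) * (kap y)%:E))%E.
    by apply: eq_integral => y _; rewrite !funeposE/= maxe_mul.
  rewrite h//; congr (_ * _)%E; apply: eq_integral => s _; rewrite !funeposE/=.
  by rewrite mulrC maxe_mul// muleC.
- transitivity (\int[leb3]_y ((EFin \o g)^\- (enorm y) * (kap y)%:E))%E.
    by apply: eq_integral => y _; rewrite !funenegE/= -mulNr maxe_mul.
  rewrite h//; congr (_ * _)%E; apply: eq_integral => s _; rewrite !funenegE/=.
  by rewrite mulrC -mulNr maxe_mul// muleC.
Qed.

Variable Rd : R.
Hypothesis Rd0 : 0 < Rd.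
Local Notation I := (`]0, Rd[%classic : set R).

Let axis (s : R) : E3 := (s, 0, 0).

Lemma enorm_axis (s : R) : 0 <= s -> enorm (s, 0, 0) = s.
Proof. by move=> s0; rewrite /enorm /dot3/= !mulr0 !addr0 -expr2 sqrtr_sqr ger0_norm. Qed.

Let maxis : measurable_fun [set: R] axis.
Proof. by rewrite /axis; meas. Qed.

Lemma measurable_axis (d : measure_display) (T' : measurableType d)
    (q : E3 -> T') : measurable_fun (eball Rd) q ->
  measurable_fun I (fun s => q (s, 0, 0)).
Proof.
move=> mq.
have sub : axis @` I `<=` eball Rd.
  move=> _ [s /= + <-]; rewrite in_itv/= => /andP[s0 sR].
  by change (enorm (s, 0, 0) < Rd); rewrite enorm_axis ?ltW.
exact: (measurable_comp (measurable_eball Rd) sub mq (measurable_funTS maxis)).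
Qed.

Let gext (g : R -> R) : R -> R := g \_ I.

Let mgext g : measurable_fun I g -> measurable_fun [set: R] (gext g).
Proof. by move=> mg; exact: (measurable_restrictT _ _).1. Qed.

Let gextE (g : R -> R) y : enorm y != 0 ->
  gext g (enorm y) = (radial g \_ (eball Rd)) y.
Proof.
move=> y0; rewrite /gext !patchE; congr (if _ then _ else _).
have y1 : 0 < enorm y by rewrite lt_neqAle enorm_ge0 eq_sym y0.
by apply/idP/idP; rewrite !inE /eball/= in_itv/= y1.
Qed.

Lemma measurable_radial (g : R -> R) :
  measurable_fun (eball Rd) (radial g) <-> measurable_fun I g.
Proof.
split=> [mg|mg].
  have := measurable_axis mg; apply: eq_measurable_fun => s.
  by rewrite inE/= in_itv/= => /andP[s0 _]; rewrite /radial enorm_axis ?ltW.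
have -> : eball Rd = (eball Rd `&` ~` N) `|` N :> set E3.
  apply/seteqP; split => [y yR|y [[]//|]].
    by have [yN|yN] := pselect (N y); [right|left].
  by rewrite /N /eball/= => ->.
have mC : measurable (eball Rd `&` ~` N).
  by apply: measurableI; [exact: measurable_eball|exact: measurableC].
apply/measurable_funU => //; split.
  apply: (eq_measurable_fun (fun y => gext g (enorm y))).
    move=> y; rewrite inE => -[yR /eqP yN].
    by rewrite gextE// patchE mem_set.
  by apply: measurable_funTS; apply: measurableT_comp; [exact: mgext|exact: measurable_enorm].
apply: (eq_measurable_fun (cst (g 0))); last exact: measurable_cst.
by move=> y; rewrite inE /radial => ->.
Qed.

Let mradial_ext (g : R -> R) : measurable_fun I g ->
  measurable_fun [set: E3] (radial g \_ (eball Rd)).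
Proof.
move=> /measurable_radial mg.
exact: (measurable_restrictT _ (measurable_eball Rd)).1.
Qed.

Let integral_ext (k' g : R -> R) :
  (\int[leb]_s (k' s * gext g s)%:E = \int[leb]_(s in I) (k' s * g s)%:E)%E.
Proof.
rewrite [RHS]integral_mkcond; apply: eq_integral => s _.
by rewrite /gext !patchE; case: ifP => // _; rewrite mulr0.
Qed.

Lemma integral_radial_ball (g : R -> R) : measurable_fun I g ->
  (\int[leb3]_(x in eball Rd) (radial g x)%:E =
   (4 * pi)%:E * \int[leb]_(s in I) (s ^+ 2 * g s)%:E)%E.
Proof.
move=> mg.
transitivity (\int[leb3]_y ((radial g \_ (eball Rd)) y)%:E)%E.
  by rewrite integral_mkcond; apply: eq_integral => y _; rewrite !patchE; case: ifP.
transitivity (\int[leb3]_y (gext g (enorm y) * 1)%:E)%E.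
  apply: ae_off_origin.
  - by apply/measurable_EFinP; exact: mradial_ext.
  - apply/measurable_EFinP; under eq_fun do rewrite mulr1.
    by apply: measurableT_comp; [exact: mgext|exact: measurable_enorm].
  - by move=> y y0; rewrite mulr1 gextE.
rewrite (@signed_formula (cst 1) (fun s => posp s ^+ 2) (4 * pi))//.
- rewrite integral_ext; congr (_ * _)%E; apply: eq_integral => s.
  by rewrite inE/= in_itv/= => /andP[s0 _]; rewrite (max_idPl _)// ltW.
- by rewrite mulr_gt0 ?pi_gt0.
- by meas.
- by move=> s; exact: sqr_ge0.
- by move=> G mG G0; rewrite -integral_radial//; apply: eq_integral => y _; rewrite mule1.
- exact: mgext.
Qed.

Definition shell_potential (g : R -> R) (r : R) : R :=
  \int[leb]_(s in I) (s ^+ 2 / Num.max s r * g s).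

Lemma Rintegral_radial_ball (g : R -> R) : measurable_fun I g ->
  \int[leb3]_(x in eball Rd) radial g x = 4 * pi * \int[leb]_(s in I) (s ^+ 2 * g s).
Proof.
move=> mg; rewrite /Rintegral integral_radial_ball//.
have p : 0 < 4 * pi :> R by rewrite mulr_gt0 ?pi_gt0.
by case: (integral _ _ _) => [r| |] //=;
  rewrite ?gt0_muley ?gt0_muleNy ?lte_fin//= mulr0.
Qed.

Lemma newton_radial_ball (g : R -> R) (x : E3) : measurable_fun I g ->
  newton (radial g \_ (eball Rd)) x = shell_potential g (enorm x).
Proof.
move=> mg.
have p : 0 < 4 * pi :> R by rewrite mulr_gt0 ?pi_gt0.
have mx : measurable_fun [set: E3] (fun y => (enorm (x - y))^-1).
  by rewrite /enorm /dot3/=; meas.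
suff h : (\int[leb3]_y ((radial g \_ (eball Rd)) y / enorm (x - y))%:E =
    (4 * pi)%:E * \int[leb]_(s in I) (s ^+ 2 / Num.max s (enorm x) * g s)%:E)%E.
  rewrite /newton /shell_potential /Rintegral h.
  case: (integral _ _ _) => [r| |] /=.
  - by rewrite mulrA mulVf ?mul1r// gt_eqF.
  - by rewrite gt0_muley ?lte_fin//= mulr0.
  - by rewrite gt0_muleNy ?lte_fin//= mulr0.
transitivity (\int[leb3]_y (gext g (enorm y) * (enorm (x - y))^-1)%:E)%E.
  apply: ae_off_origin.
  - by apply/measurable_EFinP; apply: measurable_funM => //; exact: mradial_ext.
  - apply/measurable_EFinP; apply: measurable_funM => //.
    by apply: measurableT_comp; [exact: mgext|exact: measurable_enorm].
  - by move=> y y0; rewrite gextE.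
rewrite (@signed_formula _ (fun s => posp s ^+ 2 / Num.max s (enorm x)) (4 * pi))//.
- rewrite integral_ext; congr (_ * _)%E; apply: eq_integral => s.
  by rewrite inE/= in_itv/= => /andP[s0 _]; rewrite (max_idPl (ltW s0)).
- by meas.
- by move=> y; rewrite invr_ge0 enorm_ge0.
- by move=> s; rewrite divr_ge0 ?sqr_ge0// le_max enorm_ge0 orbT.
- by move=> G mG G0; rewrite -integral_newton//.
- exact: mgext.
Qed.

End RadialBall.

(** * Quadratic forms with a single negative direction *)
Section IndexOne.
Context {R : realType}.
Variables (V : set (R -> R)) (q : (R -> R) -> (R -> R) -> R).
Hypothesis Vlin : forall c x y, V x -> V y -> V (c *: x + y).
Hypothesis bil : bilinear_on V q.

Let Vsub c x y : V x -> V y -> V (y - c *: x).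
Proof. by move=> Vx Vy; rewrite addrC -scaleNr; exact: Vlin. Qed.

Lemma bilinear_linl c x y z : V x -> V y -> V z ->
  q (c *: x + y) z = c * q x z + q y z.
Proof. by move=> Vx Vy Vz; have [] := bil c Vx Vy Vz. Qed.

Lemma bilinear_linr c x y z : V x -> V y -> V z ->
  q z (c *: x + y) = c * q z x + q z y.
Proof. by move=> Vx Vy Vz; have [] := bil c Vx Vy Vz. Qed.

Lemma bilinear_subl c x y z : V x -> V y -> V z ->
  q (y - c *: x) z = q y z - c * q x z.
Proof.
by move=> Vx Vy Vz; rewrite [y - _]addrC -scaleNr bilinear_linl// mulNr addrC.
Qed.

Lemma bilinear_subr c x y z : V x -> V y -> V z ->
  q z (y - c *: x) = q z y - c * q z x.
Proof.
by move=> Vx Vy Vz; rewrite [y - _]addrC -scaleNr bilinear_linr// mulNr addrC.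
Qed.

Hypothesis sym : symmetric_on V q.

Lemma quadratic_sub c x y : V x -> V y ->
  q (y - c *: x) (y - c *: x) = q y y - 2 * c * q y x + c ^+ 2 * q x x.
Proof.
move=> Vx Vy; have Vxy := Vsub c Vx Vy.
by rewrite bilinear_subl// !bilinear_subr// (sym Vx Vy); ring.
Qed.

Lemma quadratic_lin c x y : V x -> V y ->
  q (c *: x + y) (c *: x + y) = c ^+ 2 * q x x + 2 * c * q x y + q y y.
Proof.
move=> Vx Vy; have Vxy := Vlin c Vx Vy.
by rewrite bilinear_linl// !bilinear_linr// (sym Vy Vx); ring.
Qed.

(** If [q x y] did not vanish, [q] would be negative at [y - c *: x] for a
    suitable [c]. *)
Lemma psd_null (W : set (R -> R)) x y : W `<=` V ->
  (forall c x y, W x -> W y -> W (y - c *: x)) ->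
  (forall x, W x -> 0 <= q x x) -> W x -> W y -> q x x = 0 -> q x y = 0.
Proof.
move=> WV Wsub psd Wx Wy qx; apply/eqP; apply: contraT => qxy.
pose c := (q y y + 1) / (2 * q x y).
have := psd _ (Wsub c _ _ Wx Wy).
rewrite quadratic_sub ?qx; try exact: WV.
rewrite (sym (WV _ Wy) (WV _ Wx)) mulr0 addr0.
have -> : 2 * c * q x y = q y y + 1 by rewrite /c; field.
by lra.
Qed.

Hypothesis no2 : ~ has_negative_subspace V q 2.
Variables (v w : R -> R).
Hypotheses (Vv : V v) (Vw : V w) (qvv : q v v = 0) (qvw : q v w != 0).

(** On the orthogonal of an isotropic vector [v] outside the radical there is no
    negative vector: it would add up with a negative vector of the hyperbolic
    plane spanned by [v] and [w]. *)
Lemma isotropic_orthogonal_ge0 x : V x -> q v x = 0 -> 0 <= q x x.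
Proof.
move=> Vx qvx; rewrite leNgt; apply/negP => qx; apply: no2.
pose x' := x - (q x w / q v w) *: v.
pose u := w - ((q w w + 1) / (2 * q v w)) *: v.
have Vx' : V x' by exact: Vsub.
have Vu : V u by exact: Vsub.
have qx' : q x' x' = q x x.
  by rewrite quadratic_sub// qvv (sym Vx Vv) qvx !mulr0 subr0 addr0.
have qu : q u u = -1.
  by rewrite quadratic_sub// qvv (sym Vw Vv); field.
have qx'u : q x' u = 0.
  rewrite bilinear_subr// !bilinear_subl// qvv (sym Vx Vv) qvx.
  by field.
exists (fun i => if i == ord0 then x' else u); split=> [i|c [i ci]].
  by case: ifP.
rewrite !big_ord_recl big_ord0 /= addr0.
have Vcu : V (c (lift ord0 ord0) *: u).
  have := Vsub (1 - c (lift ord0 ord0)) Vu Vu.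
  by rewrite scalerBl scale1r opprB addrC subrK.
rewrite quadratic_lin// qx' -[c _ *: u]addr0.
have V0 : V 0 by have := Vsub 1 Vu Vu; rewrite scale1r subrr.
have q0 z : V z -> q z 0 = 0.
  by move=> Vz; have := bilinear_subr 1 Vu Vu Vz; rewrite scale1r subrr mul1r subrr.
rewrite quadratic_lin// bilinear_linr// !q0// qu qx'u.
have : c ord0 != 0 \/ c (lift ord0 ord0) != 0.
  case: (unliftP ord0 i) ci => [j ->|->]; last by left.
  by rewrite (ord1 j); right.
have := sqr_ge0 (c ord0); have := sqr_ge0 (c (lift ord0 ord0)).
move: (c ord0) (c (lift ord0 ord0)) => c0 c1 h1 h0 hc.
have {hc} : 0 < c0 ^+ 2 \/ 0 < c1 ^+ 2.
  by case: hc => hc; [left|right]; rewrite lt0r sqrf_eq0 hc ?h0 ?h1.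
case=> hc; nra.
Qed.

Lemma isotropic_orthogonal_null x : V x -> q v x = 0 -> q x x = 0 ->
  exists c, form_ker V q (x - c *: v).
Proof.
move=> Vx qvx qxx; exists (q x w / q v w).
have Vs := Vsub (q x w / q v w) Vv Vx; split => // z Vz.
pose W := [set y | V y /\ q v y = 0].
have WV : W `<=` V by move=> y [].
have Wsub c y y' : W y -> W y' -> W (y' - c *: y).
  move=> [Vy qy] [Vy' qy']; split; first exact: Vsub.
  by rewrite bilinear_subr// qy qy' mulr0 subr0.
have psd y : W y -> 0 <= q y y by move=> [Vy qy]; exact: isotropic_orthogonal_ge0.
pose a := q v z / q v w.
have Wz : W (z - a *: w).
  split; first exact: Vsub.
  by rewrite bilinear_subr// /a mulfVK// subrr.
have := psd_null WV Wsub psd (conj Vx qvx) Wz qxx.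
rewrite bilinear_subr// bilinear_subl// /a => /eqP; rewrite subr_eq0 => /eqP ->.
by field.
Qed.

End IndexOne.

Section AlmostEverywhere.
Context {d : measure_display} {T : measurableType d} {R : realType}.
Variable mu : {measure set T -> \bar R}.

Lemma ae_imp (P Q : T -> Prop) : (forall x, P x -> Q x) ->
  {ae mu, forall x, P x} -> {ae mu, forall x, Q x}.
Proof. exact: filterS. Qed.

Lemma ae_and (P Q : T -> Prop) : {ae mu, forall x, P x} ->
  {ae mu, forall x, Q x} -> {ae mu, forall x, P x /\ Q x}.
Proof. by move=> hP hQ; apply: filterS2 hP hQ. Qed.

End AlmostEverywhere.

(** * Weighted square integrable functions on a set of reals *)
Section WeightedL2.
Context {R : realType}.
Local Notation leb := (@lebesgue_measure R).
Variables (D : set R) (p : R -> R).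
Hypotheses (mD : measurable (D : set (measurableTypeR R))) (mp : measurable_fun D p).
Hypothesis p_gt0 : forall s, D s -> 0 < p s.
Implicit Types f g h : R -> R.

Definition WL2 f : Prop :=
  measurable_fun D f /\ leb.-integrable D (fun s => (p s * f s ^+ 2)%:E).

Definition wip f g : R := \int[leb]_(s in D) (p s * (f s * g s)).

Lemma WL2P f : measurable_fun D f ->
  (\int[leb]_(s in D) (p s * f s ^+ 2)%:E < +oo)%E <-> WL2 f.
Proof.
move=> mf.
have m : measurable_fun D (fun s => (p s * f s ^+ 2)%:E).
  by apply/measurable_EFinP; apply: measurable_funM => //; exact: measurable_funX.
have e : (\int[leb]_(s in D) `|(p s * f s ^+ 2)%:E| =
          \int[leb]_(s in D) (p s * f s ^+ 2)%:E)%E.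
  apply: eq_integral => s; rewrite inE => Ds; rewrite gee0_abs// lee_fin.
  by rewrite mulr_ge0 ?sqr_ge0// ltW// p_gt0.
split=> [h|[_ /integrableP[_]]]; last by rewrite e.
by split=> //; apply/integrableP; split=> //; rewrite e.
Qed.

Lemma WL2_measurable f : WL2 f -> measurable_fun D f. Proof. by case. Qed.

Lemma wip_integrable f g : WL2 f -> WL2 g ->
  leb.-integrable D (fun s => (p s * (f s * g s))%:E).
Proof.
move=> [mf fi] [mg gi].
apply: (le_integrable mD _ _ (integrableD mD fi gi)).
  by apply/measurable_EFinP; do 2 apply: measurable_funM => //.
move=> s Ds; rewrite /= lee_fin normrM (gtr0_norm (p_gt0 Ds)) -mulrDr.
rewrite [leRHS]ger0_norm ?mulr_ge0 ?addr_ge0 ?sqr_ge0 ?(ltW (p_gt0 Ds))//.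
rewrite ler_pM2l ?p_gt0// ler_norml; apply/andP; split; nra.
Qed.

Let fun_linE c f g s : (c *: f + g) s = c * f s + g s. Proof. by []. Qed.

Lemma WL2_lin c f g : WL2 f -> WL2 g -> WL2 (c *: f + g).
Proof.
move=> Ff Fg; split.
  apply: (measurable_funD (f := fun s => c * f s) (g := g)); last by case: Fg.
  by apply: measurable_funM => //; case: Ff.
have i1 := integrableZl mD (c ^+ 2) Ff.2.
have i2 := integrableZl mD (2 * c) (wip_integrable Ff Fg).
have := integrableD mD (integrableD mD i1 i2) Fg.2.
apply: eq_integrable => // s _ /=.
by rewrite -!EFinM -!EFinD; congr EFin; rewrite fun_linE; ring.
Qed.

Lemma WL20 : WL2 0.
Proof.
split; first exact: measurable_cst.
apply: (eq_integrable mD (cst 0%E)); last exact: integrable0.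
by move=> s _; rewrite /= expr0n mulr0.
Qed.

Lemma WL2Z c f : WL2 f -> WL2 (c *: f).
Proof. by move=> Ff; rewrite -[c *: f]addr0; apply: WL2_lin => //; exact: WL20. Qed.

Lemma WL2B f g : WL2 f -> WL2 g -> WL2 (f - g).
Proof. by move=> Ff Fg; rewrite addrC -scaleN1r; exact: WL2_lin. Qed.

Lemma wipC f g : wip f g = wip g f.
Proof. by apply: eq_Rintegral => s _; rewrite [f s * _]mulrC. Qed.

Lemma wip_lin c f g h : WL2 f -> WL2 g -> WL2 h ->
  wip (c *: f + g) h = c * wip f h + wip g h.
Proof.
move=> Ff Fg Fh.
have i1 := wip_integrable Ff Fh; have i2 := wip_integrable Fg Fh.
rewrite /wip -RintegralZl// -RintegralD//; last by apply: (integrableZl mD c i1).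
by apply: eq_Rintegral => s _; rewrite /= fun_linE; ring.
Qed.

Lemma wip_bilinear : bilinear_on WL2 wip.
Proof.
move=> c f g h Ff Fg Fh; split; first exact: wip_lin.
by rewrite wipC wip_lin// (wipC f) (wipC g).
Qed.

Lemma wip_ge0 f : 0 <= wip f f.
Proof.
apply: Rintegral_ge0 => s Ds.
by rewrite mulr_ge0 ?(ltW (p_gt0 Ds))// -expr2 sqr_ge0.
Qed.

Lemma wip_eq0 f : WL2 f -> wip f f = 0 -> {ae leb, forall s, D s -> f s = 0}.
Proof.
move=> Ff f0; have fi := wip_integrable Ff Ff.
have mm : measurable_fun D (fun s => (p s * (f s * f s))%:E).
  by case/integrableP : fi.
have : ae_eq leb D (fun s => (p s * (f s * f s))%:E) (cst 0%E).
  apply/(ae_eq_integral_abs leb mD mm).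
  transitivity (\int[leb]_(s in D) (p s * (f s * f s))%:E)%E.
    apply: eq_integral => s; rewrite inE => Ds; rewrite gee0_abs// lee_fin.
    by rewrite mulr_ge0 ?(ltW (p_gt0 Ds))// -expr2 sqr_ge0.
  by rewrite -[LHS]fineK ?integrable_fin_num//; congr EFin.
apply: ae_imp => s /= hs Ds; have := hs Ds; case=> /eqP.
by rewrite mulf_eq0 gt_eqF ?p_gt0//= mulf_eq0 orbb => /eqP.
Qed.

Lemma ae_eq0_wip f g : measurable_fun D f -> measurable_fun D g ->
  {ae leb, forall s, D s -> f s = 0} -> wip f g = 0.
Proof.
move=> mf mg f0.
transitivity (\int[leb]_(s in D) (cst 0 s : R)); last first.
  by rewrite Rintegral_cst// mul0r.
rewrite /Rintegral; congr fine; apply: ae_eq_integral => //.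
- by apply/measurable_EFinP; do 2 apply: measurable_funM => //.
- by apply/measurable_EFinP; exact: measurable_cst.
- by apply: ae_imp f0 => s /= h Ds; rewrite h// mul0r mulr0.
Qed.

Lemma wip_parallelogram f g : WL2 f -> WL2 g ->
  wip (f - g) (f - g) <= 2 * wip f f + 2 * wip g g.
Proof.
move=> Ff Fg.
have q1 := quadratic_lin WL2_lin wip_bilinear (fun x y _ _ => wipC x y) 1 Fg Ff.
have q2 := quadratic_lin WL2_lin wip_bilinear (fun x y _ _ => wipC x y) (-1) Fg Ff.
have := wip_ge0 (1 *: g + f); rewrite q1.
by rewrite [f - g]addrC -[- g]scaleN1r q2; lra.
Qed.

Let Cauchy (f : nat -> R -> R) := forall eps, 0 < eps -> exists n0 : nat,
  forall m n, (n0 <= m)%N -> (n0 <= n)%N -> wip (f m - f n) (f m - f n) <= eps.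

(** Along a subsequence whose successive distances are summable the functions
    converge almost everywhere. *)
Let ae_limit (f : nat -> R -> R) : (forall n, WL2 (f n)) ->
  (forall n, wip (f n.+1 - f n) (f n.+1 - f n) <= (4^-1) ^+ n) ->
  {ae leb, forall s, D s -> cvgn (fun n => f n s)}.
Proof.
move=> Ff fc.
pose d n s := f n.+1 s - f n s.
pose u n s : \bar R := (2 ^+ n * (p s * (d n s * d n s)))%:E.
have u0 n s : D s -> (0 <= u n s)%E.
  move=> Ds; rewrite lee_fin mulr_ge0 ?exprn_ge0// mulr_ge0 ?(ltW (p_gt0 Ds))//.
  by rewrite -expr2 sqr_ge0.
have di n : leb.-integrable D (fun s => (p s * (d n s * d n s))%:E).
  by have := wip_integrable (WL2B (Ff n.+1) (Ff n)) (WL2B (Ff n.+1) (Ff n)).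
have ui n : leb.-integrable D (u n).
  by have := integrableZl mD (2 ^+ n) (di n); apply: eq_integrable => // s _.
have mu' n : measurable_fun D (u n) by case/integrableP : (ui n).
have intu n : (\int[leb]_(s in D) u n s <= ((2^-1) ^+ n)%:E)%E.
  have -> : (\int[leb]_(s in D) u n s = (2 ^+ n * wip (f n.+1 - f n) (f n.+1 - f n))%:E)%E.
    rewrite -[LHS]fineK ?integrable_fin_num//; congr EFin.
    by rewrite /wip -(RintegralZl _ mD (di n)).
  rewrite lee_fin; apply: (le_trans (ler_wpM2l _ (fc n))); first by rewrite exprn_ge0.
  by rewrite -exprMn; apply: lerXn2r; rewrite ?nnegrE; lra.
have sint : (\int[leb]_(s in D) (\sum_(n <oo) u n s) < +oo)%E.
  rewrite integral_nneseries//.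
  apply: (@le_lt_trans _ _ (\sum_(n <oo) ((2^-1) ^+ n)%:E)%E).
    apply: lee_nneseries => n _; last exact: intu.
    by move=> _; apply: integral_ge0 => s Ds; exact: u0.
  apply: (@le_lt_trans _ _ 2%:E); last exact: ltry.
  apply: lime_le; first by apply: is_cvg_nneseries => n _ _; rewrite lee_fin exprn_ge0.
  near=> n; rewrite sumEFin lee_fin.
  have e m : \sum_(0 <= i < m) (2^-1 : R) ^+ i = 2 - 2 * 2^-1 ^+ m.
    elim: m => [|m IH]; first by rewrite big_nil expr0; lra.
    by rewrite big_nat_recr//= IH exprS; lra.
  by rewrite e lerBlDr lerDl mulr_ge0// exprn_ge0.
have mS : measurable_fun D (fun s => \sum_(n <oo) u n s)%E.
  by apply: ge0_emeasurable_sum => // n s Ds _; exact: u0.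
have S0 s : D s -> (0 <= \sum_(n <oo) u n s)%E.
  by move=> Ds; apply: nneseries_ge0 => n _ _; exact: u0.
have Si : leb.-integrable D (fun s => \sum_(n <oo) u n s)%E.
  apply/integrableP; split => //.
  rewrite (_ : integral _ _ _ = \int[leb]_(s in D) (\sum_(n <oo) u n s))%E//.
  by apply: eq_integral => s; rewrite inE => Ds; rewrite gee0_abs// S0.
have := integrable_ae mD Si; apply: ae_imp => s /= fin Ds; have {}fin := fin Ds.
have ps := p_gt0 Ds.
have bnd : forall n, \sum_(0 <= i < n) (2 ^+ i * (d i s * d i s))
    <= (p s)^-1 * fine (\sum_(n <oo) u n s)%E.
  move=> n; rewrite ler_pdivlMl// mulr_sumr -lee_fin fineK// -sumEFin.
  rewrite (eq_bigr (fun i => u i s)); last by move=> i _; congr EFin; ring.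
  by apply: nneseries_lim_ge => i _ _; exact: u0.
have cv : cvgn (series (fun n => 2 ^+ n * (d n s * d n s))).
  apply: nondecreasing_is_cvgn.
    apply/nondecreasing_seqP => n; rewrite /series/= big_nat_recr//= lerDl.
    by rewrite mulr_ge0 ?exprn_ge0// -expr2 sqr_ge0.
  by exists ((p s)^-1 * fine (\sum_(n <oo) u n s)%E) => _ [n _ <-]; exact: bnd.
have cg : cvgn (series (fun n => (2^-1 : R) ^+ n)).
  have := @is_cvg_geometric_series R 1 2^-1.
  rewrite ger0_norm// => /(_ _); rewrite (_ : geometric 1 2^-1 = fun n => (2^-1 : R) ^+ n); last first.
    by apply/funext => n; rewrite /geometric/= mul1r.
  by apply; lra.
have : cvgn (series (fun n => d n s)).
  apply: normed_cvg.
  apply: (@series_le_cvg _ _ (fun n => (2^-1 : R) ^+ n + 2 ^+ n * (d n s * d n s))).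
  - by move=> n; exact: normr_ge0.
  - by move=> n; rewrite addr_ge0 ?exprn_ge0// mulr_ge0 ?exprn_ge0// -expr2 sqr_ge0.
  - move=> n; set a := 2 ^+ n; have a0 : 0 < a by rewrite exprn_gt0.
    have -> : (2^-1) ^+ n = a^-1 by rewrite exprVn.
    have aa : a * a^-1 = 1 by rewrite divff// gt_eqF.
    have b0 : 0 < a^-1 by rewrite invr_gt0.
    rewrite ler_norml; move: (d n s) (a^-1) aa b0 => x b aa b0.
    have h1 : 0 <= a * (x - b) ^+ 2 by rewrite mulr_ge0 ?sqr_ge0// ltW.
    have h2 : 0 <= a * (x + b) ^+ 2 by rewrite mulr_ge0 ?sqr_ge0// ltW.
    have h3 : 0 <= a * x ^+ 2 by rewrite mulr_ge0 ?sqr_ge0// ltW.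
    have e1 : a * (x - b) ^+ 2 = a * x ^+ 2 - 2 * (a * b) * x + (a * b) * b by ring.
    have e2 : a * (x + b) ^+ 2 = a * x ^+ 2 + 2 * (a * b) * x + (a * b) * b by ring.
    rewrite e1 e2 aa in h1 h2; rewrite -expr2; apply/andP; split; lra.
  - rewrite (_ : series _ = series (fun n => (2^-1 : R) ^+ n)
      + series (fun n => 2 ^+ n * (d n s * d n s))).
      exact: (is_cvgD cg cv).
    by apply/funext => n; rewrite /series/= big_split.
have -> : series (fun n => d n s) = (fun n => f n s - f 0%N s).
  by apply/funext => n; rewrite /series/= telescope_sumr.
move=> /cvg_ex[l hl]; apply/cvg_ex; exists (l + f 0%N s).
have -> : (fun n => f n s) = (fun n => (f n s - f 0%N s) + f 0%N s).
  by apply/funext => n; rewrite subrK.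
exact: (cvgD hl (cvg_cst _)).
Unshelve. all: by end_near. Qed.

Lemma WL2_complete (f : nat -> R -> R) : (forall n, WL2 (f n)) -> Cauchy f ->
  exists2 g, WL2 g & forall eps, 0 < eps -> exists n0 : nat,
    forall n, (n0 <= n)%N -> wip (g - f n) (g - f n) <= eps.
Proof.
move=> Ff Cf.
have [N hN] : {N : nat -> nat & forall k m n, (N k <= m)%N -> (N k <= n)%N ->
    wip (f m - f n) (f m - f n) <= (4^-1) ^+ k}.
  apply: (@choice _ _ (fun k M => forall m n, (M <= m)%N -> (M <= n)%N ->
    wip (f m - f n) (f m - f n) <= (4^-1) ^+ k)) => k.
  by apply: Cf; rewrite exprn_gt0.
pose n_ := fix n_ k := if k is k'.+1 then maxn (N k) (n_ k').+1 else N 0%N.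
have nN k : (N k <= n_ k)%N by case: k => [|k] //=; exact: leq_maxl.
have nk k : (n_ k < n_ k.+1)%N by rewrite /= leq_maxr.
have n_id k : (k <= n_ k)%N by elim: k => // k IH; exact: leq_ltn_trans (nk k).
pose h k := f (n_ k).
have Fh k : WL2 (h k) by exact: Ff.
have hc := ae_limit Fh (fun k => hN k _ _ (leq_trans (nN k) (ltnW (nk k))) (nN k)).
pose g s := fine (limn_esup (fun k => (h k s)%:E)).
have mg : measurable_fun D g.
  apply: (measurableT_comp (f := fine)); first exact: fine_measurable.
  apply: measurable_fun_limn_esup => k; apply/measurable_EFinP; exact: (Fh k).1.
have gE : {ae leb, forall s, D s -> (fun k => h k s) @ \oo --> g s}.
  apply: ae_imp hc => s /= cs Ds; have {}cs := cs Ds.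
  have ce : (fun k => (h k s)%:E) @ \oo --> (limn (fun k => h k s))%:E.
    by apply/fine_cvgP; split; [exact: nearW|exact: cs].
  rewrite /g is_cvg_limn_esupE; last by apply/cvg_ex; eexists; exact: ce.
  by rewrite (cvg_lim _ ce)//=; exact: cs.
have key eps : 0 < eps -> exists n0 : nat, forall n, (n0 <= n)%N ->
    (\int[leb]_(s in D) (p s * (g s - f n s) ^+ 2)%:E <= eps%:E)%E.
  move=> e0; have [n0 hn0] := Cf _ e0; exists n0 => n nn.
  have mk k : measurable_fun D (fun s => (p s * (h k s - f n s) ^+ 2)%:E).
    apply/measurable_EFinP; apply: measurable_funM => //; apply: measurable_funX.
    by apply: measurable_funB; [exact: (Fh k).1|exact: (Ff n).1].
  have := @fatou _ _ _ leb D mD (fun k s => (p s * (h k s - f n s) ^+ 2)%:E) mk.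
  have p0 k s : D s -> (0 <= (p s * (h k s - f n s) ^+ 2)%:E)%E.
    by move=> Ds; rewrite lee_fin mulr_ge0 ?sqr_ge0// ltW// p_gt0.
  move=> /(_ p0) fat.
  have -> : (\int[leb]_(s in D) (p s * (g s - f n s) ^+ 2)%:E =
    \int[leb]_(s in D) limn_einf (fun k => (p s * (h k s - f n s) ^+ 2)%:E))%E.
    apply: ae_eq_integral => //.
    - apply/measurable_EFinP; apply: measurable_funM => //; apply: measurable_funX.
      by apply: measurable_funB => //; exact: (Ff n).1.
    - rewrite (_ : (fun _ => _) = fun s => (- limn_esup (fun k =>
         (- (p s * (h k s - f n s) ^+ 2))%:E))%E); last first.
        by apply/funext => s; rewrite -limn_einfN; congr limn_einf;
           apply/funext => k /=; rewrite opprK.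
      apply: measurableT_comp => //; apply: measurable_fun_limn_esup => k.
      by apply/measurable_EFinP; apply: measurable_funN; apply/measurable_EFinP; exact: mk.
    - apply: ae_imp gE => s /= cs Ds; have {}cs := cs Ds.
      have c2 : (fun k => p s * (h k s - f n s) ^+ 2) @ \oo --> p s * (g s - f n s) ^+ 2.
        apply: cvgM; first exact: cvg_cst.
        by rewrite expr2; under eq_fun do rewrite expr2; apply: cvgM;
           (apply: cvgB; [exact: cs|exact: cvg_cst]).
      have ce : (fun k => (p s * (h k s - f n s) ^+ 2)%:E) @ \oo
         --> (p s * (g s - f n s) ^+ 2)%:E.
        by apply/fine_cvgP; split; [exact: nearW|exact: c2].
      rewrite is_cvg_limn_einfE; last by apply/cvg_ex; eexists; exact: ce.
      by rewrite (cvg_lim _ ce).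
  apply: (le_trans fat).
  have bk k : (n0 <= k)%N -> (\int[leb]_(s in D) (p s * (h k s - f n s) ^+ 2)%:E <= eps%:E)%E.
    move=> k0; have [_ hi] := WL2B (Fh k) (Ff n).
    rewrite -[leLHS]fineK; last exact: (integrable_fin_num mD hi).
    rewrite lee_fin; apply: le_trans (hn0 (n_ k) n (leq_trans k0 (n_id k)) nn).
    by rewrite le_eqVlt; apply/orP; left; apply/eqP; apply: eq_Rintegral => s _;
       rewrite expr2.
  rewrite limn_einf_lim; apply: lime_le; first exact: is_cvg_einfs.
  near=> k; apply: (@le_trans _ _ (\int[leb]_(s in D) (p s * (h k s - f n s) ^+ 2)%:E)%E).
    by apply: ereal_inf_lbound; exists k => //=.
  by apply: bk; near: k; exact: nbhs_infty_ge.
have Fg : WL2 g.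
  have [n0 /(_ n0 (leqnn _)) h0] := key 1 ltr01.
  have m0 : measurable_fun D (g - f n0) by apply: measurable_funB => //; exact: (Ff n0).1.
  have F0 : WL2 (g - f n0).
    by apply/(WL2P m0); exact: (le_lt_trans h0 (ltry _)).
  by have := WL2_lin 1 F0 (Ff n0); rewrite scale1r subrK.
exists g => // eps e0; have [n0 hn0] := key _ e0; exists n0 => n nn.
have [_ hi] := WL2B Fg (Ff n).
have := hn0 n nn; rewrite -[leLHS]fineK; last exact: (integrable_fin_num mD hi).
rewrite lee_fin; apply: le_trans; rewrite le_eqVlt; apply/orP; left; apply/eqP.
by apply: eq_Rintegral => s _; rewrite expr2.
Unshelve. all: by end_near. Qed.

End WeightedL2.

(** * Coercivity of positive compact perturbations *)
Section Coercivity.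
Context {R : realType}.
Variables (V : set (R -> R)) (N : (R -> R) -> R).
Hypothesis Vlin : forall c x y, V x -> V y -> V (c *: x + y).
Hypothesis N_ge0 : forall x, V x -> 0 <= N x.
Hypothesis NZ : forall c x, V x -> N (c *: x) = c ^+ 2 * N x.
Hypothesis NB : forall x y, V x -> V y -> N (x - y) <= 2 * N x + 2 * N y.
Hypothesis N_complete : forall x : nat -> R -> R, (forall n, V (x n)) ->
  (forall eps, 0 < eps -> exists n0 : nat, forall m n,
    (n0 <= m)%N -> (n0 <= n)%N -> N (x m - x n) <= eps) ->
  exists2 g, V g & forall eps, 0 < eps -> exists n0 : nat,
    forall n, (n0 <= n)%N -> N (g - x n) <= eps.
Variables (q a k : (R -> R) -> (R -> R) -> R) (kappa : R).
Hypotheses (kappa_gt0 : 0 < kappa) (abil : bilinear_on V a).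
Hypotheses (abnd : bounded_form V N a) (ak : forall x, V x -> kappa * N x <= a x x).
Hypotheses (kcpt : compact_form V N k).
Hypothesis qE : forall x y, V x -> V y -> q x y = a x y + k x y.
Hypothesis q_ge0 : forall x, V x -> 0 <= q x x.
Hypothesis q_eq0 : forall x, V x -> q x x = 0 -> N x = 0.

Let kbil : bilinear_on V k. Proof. by case: kcpt. Qed.

Let VB x y : V x -> V y -> V (x - y).
Proof. by move=> Vx Vy; rewrite addrC -scaleN1r; exact: Vlin. Qed.

Let VD x y : V x -> V y -> V (x + y).
Proof. by move=> Vx Vy; rewrite -[x]scale1r; exact: Vlin. Qed.

Let V0 x : V x -> V 0. Proof. by move=> Vx; rewrite -(subrr x); exact: VB. Qed.

Let VZ c x : V x -> V (c *: x).
Proof. by move=> Vx; rewrite -[_ *: _]addr0; apply: Vlin => //; exact: V0 Vx. Qed.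

Let qbil : bilinear_on V q.
Proof.
move=> c x y z Vx Vy Vz; have Vxy := Vlin c Vx Vy.
have [a1 a2] := abil c Vx Vy Vz; have [k1 k2] := kbil c Vx Vy Vz.
by rewrite !qE// a1 a2 k1 k2; split; ring.
Qed.

Let q_par x y : V x -> V y -> q (x - y) (x - y) <= 2 * q x x + 2 * q y y.
Proof.
move=> Vx Vy; have := q_ge0 (VD Vx Vy).
have e1 : x - y = x - 1 *: y by rewrite scale1r.
have e2 : x + y = 1 *: y + x by rewrite scale1r addrC.
rewrite e2 (bilinear_linl qbil)//; last by rewrite -e2; exact: VD.
rewrite !(bilinear_linr qbil)//.
rewrite {}e1 (bilinear_subl qbil)//; last by rewrite scale1r; exact: VB.
by rewrite !(bilinear_subr qbil)//; lra.
Qed.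

Let qbnd : exists2 C, 0 <= C & forall x, V x -> q x x <= C * N x.
Proof.
have [Ca ha] := abnd; have [_ [Ck hk] _] := kcpt.
exists (`|Ca| + `|Ck|); first by rewrite addr_ge0.
move=> x Vx; rewrite qE//.
have sq : Num.sqrt (N x) * Num.sqrt (N x) = N x by rewrite -expr2 sqr_sqrtr// N_ge0.
have := ha x x Vx Vx; have := hk x x Vx Vx; rewrite -!mulrA !sq => h1 h2.
rewrite mulrDl lerD//.
- apply: (le_trans (ler_norm _)); apply: (le_trans h2).
  by rewrite ler_wpM2r ?N_ge0// ler_norm.
- apply: (le_trans (ler_norm _)); apply: (le_trans h1).
  by rewrite ler_wpM2r ?N_ge0// ler_norm.
Qed.

(** A normalized minimizing sequence has, by compactness of [k] and coercivity
    of [a], a strongly convergent subsequence; its limit would be a nonzero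
    null vector of [q]. *)
Lemma coercive_of_positive : coercive V N q.
Proof.
apply: contrapT => nc.
have ex n : exists x, [/\ V x, N x = 1 & q x x <= n.+1%:R^-1].
  apply: contrapT => h; apply: nc; exists (n.+1%:R^-1); first by rewrite invr_gt0.
  move=> x Vx; rewrite leNgt; apply/negP => lt; apply: h.
  have Nx : 0 < N x.
    rewrite lt_neqAle N_ge0// andbT; apply/eqP => e0.
    by have := q_ge0 Vx; rewrite leNgt => /negP; apply; rewrite -e0 mulr0 in lt.
  have sN : Num.sqrt (N x) ^+ 2 = N x by rewrite sqr_sqrtr// ltW.
  exists ((Num.sqrt (N x))^-1 *: x); split; first exact: VZ.
    by rewrite NZ// exprVn sN mulVf// gt_eqF.
  have -> : q ((Num.sqrt (N x))^-1 *: x) ((Num.sqrt (N x))^-1 *: x) = (N x)^-1 * q x x.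
    have V0' := V0 Vx.
    have q0l z : V z -> q 0 z = 0.
      by move=> Vz; have := bilinear_subl qbil 1 Vx Vx Vz; rewrite scale1r subrr mul1r subrr.
    have q0r z : V z -> q z 0 = 0.
      by move=> Vz; have := bilinear_subr qbil 1 Vx Vx Vz; rewrite scale1r subrr mul1r subrr.
    rewrite -[_ *: x]addr0 (bilinear_linl qbil)//; last by exact: Vlin.
    by rewrite !(bilinear_linr qbil)// q0r// !q0l// !addr0 mulr0 addr0 mulrA -expr2 exprVn sN.
  by rewrite ler_pdivrMl// mulrC ltW.
have [x hx] := choice ex.
have Vx n : V (x n) by case: (hx n).
have Nx n : N (x n) = 1 by case: (hx n).
have qx n : q (x n) (x n) <= n.+1%:R^-1 by case: (hx n).
have [_ _ /(_ x Vx)[|s smono cau]] := kcpt; first by exists 1 => n; rewrite Nx.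
have sge n : (n <= s n)%N.
  by elim: n => // n IH; apply: (leq_ltn_trans IH); exact: smono.
pose y n := x (s n).
have Vy n : V (y n) by exact: Vx.
have qy n : q (y n) (y n) <= n.+1%:R^-1.
  by apply: (le_trans (qx _)); rewrite lef_pV2 ?posrE// ler_nat ltnS.
have small eps : 0 < eps -> exists n0 : nat, forall n, (n0 <= n)%N -> n.+1%:R^-1 <= eps :> R.
  move=> e0; exists (Num.truncn eps^-1) => n hn.
  rewrite -[leRHS]invrK lef_pV2 ?posrE ?invr_gt0//.
  apply: (le_trans (ltW (truncnS_gt _))).
  by rewrite ler_nat ltnS.
have ycau eps : 0 < eps -> exists n0 : nat, forall m n,
    (n0 <= m)%N -> (n0 <= n)%N -> N (y m - y n) <= eps.
  move=> e0; pose d := kappa * eps / 6.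
  have d0 : 0 < d by rewrite !mulr_gt0// invr_gt0.
  have [n1 h1] := cau _ d0; have [n2 h2] := small _ d0.
  exists (maxn n1 n2) => m n; rewrite !geq_max => /andP[m1 m2] /andP[n1' n2'].
  have Vd := VB (Vy m) (Vy n).
  have N4 : N (y m - y n) <= 4.
    by apply: (le_trans (NB (Vy m) (Vy n))); rewrite /y !Nx; lra.
  have s2 : Num.sqrt (N (y m - y n)) <= 2.
    rewrite -[leRHS]ger0_norm// -sqrtr_sqr ler_sqrt ?sqr_ge0//.
    by apply: (le_trans N4); lra.
  have kd : `|k (y m - y n) (y m - y n)| <= d * 2.
    rewrite -[X in k (_ - X) _](scale1r (y n)) (bilinear_subl kbil)// mul1r.
    apply: (le_trans (h1 _ _ m1 n1' _ Vd)).
    by rewrite ler_wpM2l// ltW.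
  have := q_par (Vy m) (Vy n); rewrite qE// => qd.
  have akd := ak Vd.
  have qm := le_trans (qy m) (h2 _ m2); have qn := le_trans (qy n) (h2 _ n2').
  move: kd; rewrite ler_norml => /andP[kd _].
  have de : kappa * eps = 6 * d by rewrite /d; field.
  by rewrite -(ler_pM2l kappa_gt0) de; lra.
have [g Vg hg] := N_complete Vy ycau.
have [C C0 hC] := qbnd.
have Ng : 4^-1 <= N g.
  have [n0 /(_ n0 (leqnn _)) hn] : exists n0 : nat, forall n, (n0 <= n)%N -> N (g - y n) <= 4^-1.
    by apply: hg; lra.
  have := NB Vg (VB Vg (Vy n0)); rewrite opprB addrC subrK /y Nx; move: hn; lra.
have : q g g <= 0.
  apply/ler_addgt0Pr => eps e0; rewrite add0r.
  have e1 : 0 < eps / 4 by rewrite divr_gt0.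
  have [n1 h1] := small _ e1.
  have e2 : 0 < eps / (4 * (C + 1)) by rewrite divr_gt0// mulr_gt0// ltr_wpDl.
  have [n2 h2] := hg _ e2.
  pose n := maxn n1 n2.
  have h1' := h1 n (leq_maxl _ _); have h2' := h2 n (leq_maxr _ _).
  have Vgy := VB Vg (Vy n).
  have := q_par (Vy n) (VB (Vy n) Vg); rewrite opprB addrC subrK.
  have -> : q (y n - g) (y n - g) = q (g - y n) (g - y n).
    have -> : y n - g = 0 - 1 *: (g - y n) by rewrite scale1r sub0r opprB.
    have V0' := V0 Vg.
    have q0l z : V z -> q 0 z = 0.
      by move=> Vz; have := bilinear_subl qbil 1 Vg Vg Vz; rewrite scale1r subrr mul1r subrr.
    have q0r z : V z -> q z 0 = 0.
      by move=> Vz; have := bilinear_subr qbil 1 Vg Vg Vz; rewrite scale1r subrr mul1r subrr.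
    rewrite (bilinear_subl qbil)//; last by rewrite scale1r; exact: VB.
    by rewrite !(bilinear_subr qbil)// !q0r// ?q0l//; lra.
  have := hC _ Vgy; have qn := le_trans (qy n) h1'.
  have : C * N (g - y n) <= eps / 4.
    apply: (@le_trans _ _ ((C + 1) * (eps / (4 * (C + 1))))); last first.
      by rewrite le_eqVlt; apply/orP; left; apply/eqP; field; rewrite gt_eqF// ltr_wpDl.
    by apply: ler_pM => //; [exact: N_ge0|rewrite lerDl].
  by lra.
move=> qg; have /q_eq0 : q g g = 0 by apply/eqP; rewrite eq_le qg q_ge0.
by move=> /(_ Vg) Ng0; move: Ng; rewrite Ng0; lra.
Qed.

End Coercivity.

Section RadialL2.
Context {R : realType}.
Local Notation leb := (@lebesgue_measure R).
Variables (Rd : R).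
Hypothesis Rd0 : 0 < Rd.
Local Notation I := (`]0, Rd[%classic : set R).

Lemma radial_ae_zero (eta : R -> R) : measurable_fun I eta ->
  ae_zero Rd eta <-> {ae leb, forall s, I s -> eta s = 0}.
Proof.
move=> meta.
have mI : measurable (I : set (measurableTypeR R)) by [].
have mB := @measurable_eball R Rd.
have me2 : measurable_fun I (fun s => eta s ^+ 2) by exact: measurable_funX.
have me3 : measurable_fun (eball Rd) (fun x => (radial eta x ^+ 2)%:E).
  by apply/measurable_EFinP; apply: measurable_funX; exact/(measurable_radial Rd0).
have ms2 : measurable_fun I (fun s => (s ^+ 2 * eta s ^+ 2)%:E).
  by apply/measurable_EFinP; apply: measurable_funM => //; apply: measurable_funX; exact: measurable_id.
have i3 := integral_radial_ball Rd0 me2.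
have a3 : (\int[leb3]_(x in eball Rd) `|(radial eta x ^+ 2)%:E| =
    \int[leb3]_(x in eball Rd) (radial (fun s => eta s ^+ 2) x)%:E)%E.
  by apply: eq_integral => x _; rewrite gee0_abs// lee_fin sqr_ge0.
have a1 : (\int[leb]_(s in I) `|(s ^+ 2 * eta s ^+ 2)%:E| =
    \int[leb]_(s in I) (s ^+ 2 * eta s ^+ 2)%:E)%E.
  by apply: eq_integral => s _; rewrite gee0_abs// lee_fin mulr_ge0 ?sqr_ge0.
have p4 : (4 * pi)%:E != 0%E :> \bar R by rewrite gt_eqF// lte_fin mulr_gt0 ?pi_gt0.
split=> h.
- have /(ae_eq_integral_abs leb mI ms2) : (\int[leb]_(s in I) `|(s ^+ 2 * eta s ^+ 2)%:E| = 0)%E.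
    rewrite a1; apply/eqP; have /eqP := i3; rewrite -a3.
    have -> : (\int[leb3]_(x in eball Rd) `|(radial eta x ^+ 2)%:E| = 0)%E.
      apply/(ae_eq_integral_abs leb3 mB me3).
      by apply: ae_imp h => x hx Bx /=; rewrite hx// expr0n.
    by rewrite eq_sym mule_eq0 (negbTE p4).
  apply: ae_imp => s hs Is; have [] := hs Is.
  have s0 : 0 < s by move: Is; rewrite /= in_itv/= => /andP[].
  by move=> /eqP; rewrite mulf_eq0 sqrf_eq0 gt_eqF//= sqrf_eq0 => /eqP.
- have : (\int[leb3]_(x in eball Rd) `|(radial eta x ^+ 2)%:E| = 0)%E.
    rewrite a3 i3 -a1.
    have /(ae_eq_integral_abs leb mI ms2) -> : ae_eq leb I
        (fun s => (s ^+ 2 * eta s ^+ 2)%:E) (cst 0%E).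
      by apply: ae_imp h => s hs Is /=; rewrite hs// expr0n mulr0.
    by rewrite mule0.
  move=> /(ae_eq_integral_abs leb3 mB me3); apply: ae_imp => x hx Bx.
  by have [] := hx Bx; move=> /eqP; rewrite sqrf_eq0 => /eqP.
Qed.

Variable w : R -> R.
Hypotheses (mw : measurable_fun I w) (w0 : forall s, I s -> 0 < w s).
Definition radial_weight s := s ^+ 2 * w s.
Local Notation p := radial_weight.

Lemma measurable_radial_weight : measurable_fun I p.
Proof. by apply: measurable_funM => //; apply: measurable_funX; exact: measurable_id. Qed.

Lemma radial_weight_gt0 s : I s -> 0 < p s.
Proof.
move=> Is; rewrite mulr_gt0 ?w0//; move: Is; rewrite /= in_itv/= => /andP[s0 _].
by rewrite exprn_gt0.
Qed.

Let mI : measurable (I : set (measurableTypeR R)). Proof. by []. Qed.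

Lemma L2radP eta : L2rad Rd w eta <-> WL2 I p eta.
Proof.
have e : measurable_fun I eta ->
    (\int[leb3]_(x in eball Rd) (radial w x * radial eta x ^+ 2)%:E =
     (4 * pi)%:E * \int[leb]_(s in I) (p s * eta s ^+ 2)%:E)%E.
  move=> me; rewrite -(_ : (fun x => (radial (fun s => w s * eta s ^+ 2) x)%:E) =
    fun x => (radial w x * radial eta x ^+ 2)%:E)//.
  rewrite integral_radial_ball//.
    by congr (_ * _)%E; apply: eq_integral => s _; rewrite mulrA.
  by apply: measurable_funM => //; exact: measurable_funX.
have p4 : (0 < (4 * pi)%:E :> \bar R)%E by rewrite lte_fin mulr_gt0 ?pi_gt0.
have i0 : (0 <= \int[leb]_(s in I) (p s * eta s ^+ 2)%:E)%E.
  by apply: integral_ge0 => s Is; rewrite lee_fin mulr_ge0 ?sqr_ge0// ltW// radial_weight_gt0.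
split.
- move=> [/(measurable_radial Rd0) me]; rewrite e// => h.
  apply/(WL2P measurable_radial_weight radial_weight_gt0 me).
  by rewrite ltey; apply/eqP => hy; move: h; rewrite hy gt0_muley.
- move=> Fe; have me := WL2_measurable Fe.
  split; first exact/(measurable_radial Rd0).
  rewrite e//; have /(WL2P measurable_radial_weight radial_weight_gt0 me) h := Fe.
  rewrite -(@fineK _ (integral _ _ _)); first by rewrite -EFinM ltry.
  by rewrite ge0_fin_numE.
Qed.

Lemma sqnormE eta : measurable_fun I eta ->
  sqnorm Rd w eta = 4 * pi * wip I p eta eta.
Proof.
move=> me; transitivity (\int[leb3]_(x in eball Rd) radial (fun s => w s * eta s ^+ 2) x).
  by [].
rewrite Rintegral_radial_ball//; last first.
  by apply: measurable_funM => //; exact: measurable_funX.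
by congr (_ * _); apply: eq_Rintegral => s _; rewrite mulrA -expr2.
Qed.

Lemma L2rad_lin c x y : L2rad Rd w x -> L2rad Rd w y -> L2rad Rd w (c *: x + y).
Proof.
move=> /L2radP Fx /L2radP Fy; apply/L2radP.
by apply: WL2_lin => //; [exact: measurable_radial_weight|exact: radial_weight_gt0].
Qed.

Lemma sqnorm_ge0 x : L2rad Rd w x -> 0 <= sqnorm Rd w x.
Proof.
move=> /L2radP/WL2_measurable mx; rewrite sqnormE// !mulr_ge0 ?pi_ge0//.
exact: (wip_ge0 radial_weight_gt0).
Qed.

Lemma sqnormZ c x : L2rad Rd w x -> sqnorm Rd w (c *: x) = c ^+ 2 * sqnorm Rd w x.
Proof.
move=> /L2radP Fx.
have Fc : WL2 I p (c *: x).
  by apply: WL2Z => //; [exact: measurable_radial_weight|exact: radial_weight_gt0].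
rewrite !sqnormE; [|exact: WL2_measurable Fx|exact: WL2_measurable Fc].
have F0 : WL2 I p 0 by exact: WL20.
have := quadratic_lin (WL2_lin mI measurable_radial_weight radial_weight_gt0)
  (wip_bilinear mI measurable_radial_weight radial_weight_gt0)
  (fun x y _ _ => wipC _ _ x y) c Fx F0.
rewrite addr0 => ->.
have e0 y : wip I p y 0 = 0.
  by rewrite /wip; under eq_Rintegral do rewrite mulr0 mulr0; rewrite Rintegral_cst// mul0r.
by rewrite !e0; ring.
Qed.

Lemma sqnormB x y : L2rad Rd w x -> L2rad Rd w y ->
  sqnorm Rd w (x - y) <= 2 * sqnorm Rd w x + 2 * sqnorm Rd w y.
Proof.
move=> /L2radP Fx /L2radP Fy.
have Fxy : WL2 I p (x - y).
  by apply: WL2B => //; [exact: measurable_radial_weight|exact: radial_weight_gt0].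
rewrite !sqnormE; try exact: WL2_measurable Fx; try exact: WL2_measurable Fy;
  try exact: WL2_measurable Fxy.
have := wip_parallelogram mI measurable_radial_weight radial_weight_gt0 Fx Fy.
have p4 : 0 < 4 * pi :> R by rewrite mulr_gt0 ?pi_gt0.
by rewrite -(ler_pM2l p4) => h; apply: (le_trans h); lra.
Qed.

Lemma sqnorm_eq0 x : L2rad Rd w x -> sqnorm Rd w x = 0 <-> ae_zero Rd x.
Proof.
move=> /L2radP Fx; have mx := WL2_measurable Fx.
rewrite sqnormE// radial_ae_zero//; split.
- move=> /eqP; rewrite mulf_eq0 gt_eqF ?mulr_gt0 ?pi_gt0//= => /eqP.
  exact: (wip_eq0 mI measurable_radial_weight radial_weight_gt0).
- move=> h; rewrite (ae_eq0_wip mI measurable_radial_weight _ _ h) ?mulr0//.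
Qed.

Lemma zero_meanE eta : measurable_fun I eta ->
  zero_mean Rd eta <-> \int[leb]_(s in I) (s ^+ 2 * eta s) = 0.
Proof.
move=> me; rewrite /zero_mean/= Rintegral_radial_ball//; split=> [/eqP|->]; last by rewrite mulr0.
by rewrite mulf_eq0 gt_eqF ?mulr_gt0 ?pi_gt0//= => /eqP.
Qed.

Lemma L2rad_complete (x : nat -> R -> R) : (forall n, L2rad Rd w (x n)) ->
  (forall eps, 0 < eps -> exists n0 : nat, forall m n,
    (n0 <= m)%N -> (n0 <= n)%N -> sqnorm Rd w (x m - x n) <= eps) ->
  exists2 g, L2rad Rd w g & forall eps, 0 < eps -> exists n0 : nat,
    forall n, (n0 <= n)%N -> sqnorm Rd w (g - x n) <= eps.
Proof.
move=> Vx hx; have Fx n : WL2 I p (x n) by exact/L2radP.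
have p4 : 0 < 4 * pi :> R by rewrite mulr_gt0 ?pi_gt0.
have FB y z : WL2 I p y -> WL2 I p z -> WL2 I p (y - z).
  by move=> Fy Fz; apply: WL2B => //; [exact: measurable_radial_weight|exact: radial_weight_gt0].
have [|g Fg hg] := WL2_complete mI measurable_radial_weight radial_weight_gt0 Fx.
  move=> eps e0; have [n0 h0] := hx _ (mulr_gt0 p4 e0).
  exists n0 => m n hm hn; have := h0 m n hm hn.
  by rewrite sqnormE ?ler_pM2l//; exact: WL2_measurable (FB _ _ (Fx m) (Fx n)).
exists g; first exact/L2radP.
move=> eps e0; have [n0 h0] := hg _ (divr_gt0 e0 p4); exists n0 => n hn.
rewrite sqnormE; last exact: WL2_measurable (FB _ _ Fg (Fx n)).
by rewrite -ler_pdivlMl// mulrC; exact: h0.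
Qed.

End RadialL2.

(** * One sided derivatives and the chain rule *)
Section Derivatives.
Context {R : realType}.

Lemma cvg_of_within {T U : topologicalType} (F : set_system T) (FF : Filter F)
    (A : set T) (f : T -> U) (l : U) :
  F A -> f @ within A F --> l -> f @ F --> l.
Proof.
move=> FA h W /h; rewrite /= /within /fmap /= => hW.
by apply: filterS2 FA hW => x Ax; apply.
Qed.

Lemma continuous_of_within {T U : topologicalType} (A : set T) (f : T -> U) x :
  nbhs x A -> {within A, continuous f} -> {for x, continuous f}.
Proof.
move=> nA cf; have Ax : A x by exact: nbhs_singleton.
apply: (@cvg_of_within _ _ (nbhs x) _ A) => //.
by have := cf x; rewrite /continuous_at /= nbhs_subspace_in.
Qed.

Let near_shift (A : set R) (x : R) : nbhs x A -> \forall h \near (0:R)^', A (h + x).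
Proof.
move=> nA; apply: cvg_within.
have c : (fun h : R => h + x) h @[h --> 0] --> 0 + x.
  by apply: cvgD; [exact: cvg_id|exact: cvg_cst].
by apply: c; rewrite add0r.
Qed.

Let quotE (g : R -> R) (x : R) :
  (fun h => h^-1 *: (g (h *: (1:R) + x) - g x)) = (fun h => h^-1 * (g (h + x) - g x)).
Proof. by apply/funext => h; rewrite /GRing.scale/= mulr1. Qed.

Lemma is_derive_cvg (g : R -> R) (x d : R) :
  is_derive x 1 g d <-> h^-1 * (g (h + x) - g x) @[h --> (0:R)^'] --> d.
Proof.
rewrite -quotE; split=> [[dg <-]|h]; first exact: dg.
by apply: DeriveDef; [apply/cvg_ex; exists d|apply/cvg_lim].
Qed.

Lemma derivable_in_interior (A : set R) (g : R -> R) (x : R) : nbhs x A ->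
  derivable_in A g x -> is_derive x 1 g (derive_in A g x).
Proof.
move=> nA dg; apply/is_derive_cvg.
exact: (@cvg_of_within _ _ _ _ _ _ _ (near_shift nA)).
Qed.

Lemma derive_in_derive1 (A : set R) (g : R -> R) (x : R) : nbhs x A ->
  derivable_in A g x -> derive_in A g x = derive1 g x.
Proof.
by move=> nA /(derivable_in_interior nA) [_ <-]; rewrite derive1E.
Qed.

Lemma derive_in_itv (g : R -> R) (m x d : R) : 0 < x <= m ->
  is_derive x 1 g d -> derive_in `[0, m]%classic g x = d.
Proof.
move=> /andP[x0 xm] /is_derive_cvg dg; apply: cvg_lim => //; last first.
  by apply: cvg_within_filter; exact: dg.
suff : ProperFilter (within [set h | `[0, m]%classic (h + x)] (0:R)^') by [].
apply: Build_ProperFilter_ex => P [e /= e0 he].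
pose h := - (Num.min e x / 2).
have mn : 0 < Num.min e x by rewrite lt_min e0.
have h0 : h < 0 by rewrite oppr_lt0 divr_gt0.
exists h; apply: he => /=.
- rewrite sub0r normrN ltr0_norm// opprK.
  apply: (@lt_le_trans _ _ (Num.min e x)); last by rewrite ge_min lexx.
  by rewrite ltr_pdivrMr// mulr2n mulrDr mulr1 ltrDl.
- by rewrite lt_eqF.
- have : Num.min e x / 2 <= x.
    apply: (@le_trans _ _ (Num.min e x)); last by rewrite ge_min lexx orbT.
    by rewrite ler_pdivrMr// mulr2n mulrDr mulr1 lerDl ltW.
  by rewrite in_itv/= /h => hx; apply/andP; split; lra.
Qed.

Lemma MVT_unordered (g dg : R -> R) : (forall x : R, is_derive x 1 g (dg x)) ->
  forall u v, exists2 c, `|c - u| <= `|v - u| & g v - g u = dg c * (v - u).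
Proof.
move=> hg u v.
have cg A : {within A, continuous g}.
  by apply: continuous_subspaceT => x; exact: is_derive_continuous (hg x).
have [uv|vu] := leP u v.
- have [c] := @MVT_segment _ g dg u v uv (fun x _ => hg x) (cg _).
  rewrite in_itv/= => /andP[uc cv] ->; exists c => //.
  by rewrite !ger0_norm ?subr_ge0// lerD2r.
- have [c] := @MVT_segment _ g dg v u (ltW vu) (fun x _ => hg x) (cg _).
  rewrite in_itv/= => /andP[vc cu] e; exists c.
    by rewrite !ler0_norm ?subr_le0 ?(ltW vu)// !opprB lerD2l lerN2.
  by rewrite -[LHS]opprB e -mulrN opprB.
Qed.

(** The chain rule along a graph [t |-> (f t, t)], for a function of class C^1. *)
Lemma chain_rule (P PS PT : R -> R -> R) (f : R -> R) (t df : R) : 0 < t ->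
  (forall s u : R, 0 < u -> is_derive s 1 (P^~ u) (PS s u)) ->
  (forall s u : R, 0 < u -> is_derive u 1 (P s) (PT s u)) ->
  {for (f t, t), continuous (fun p : R * R => PS p.1 p.2)} ->
  is_derive t 1 f df ->
  is_derive t 1 (fun t => P (f t) t) (PS (f t) t * df + PT (f t) t).
Proof.
move=> t0 dS dT cS dF.
have cf := is_derive_continuous dF.
apply/is_derive_cvg.
pose A h := h^-1 * (P (f (h + t)) (h + t) - P (f t) (h + t)).
pose B h := h^-1 * (P (f t) (h + t) - P (f t) t).
have -> : (fun h => h^-1 * (P (f (h + t)) (h + t) - P (f t) t)) = A \+ B.
  by apply/funext => h; rewrite /A /B /= -mulrDr; congr (_ * _); ring.
have sh : (fun h : R => h + t) @ (0:R)^' --> t.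
  apply: cvg_trans (cvg_app _ (cvg_within _)) _.
  by rewrite -[X in _ --> X]add0r; apply: cvgD; [exact: cvg_id|exact: cvg_cst].
apply: cvgD; last by apply/is_derive_cvg; exact: dT.
have pos : \forall h \near (0:R)^', 0 < h + t.
  exact: (@cvgr_gt _ _ _ _ (fun h : R => h + t) t sh 0 t0).
have [c hc] : exists c : R -> R, forall h, 0 < h + t ->
    `|c h - f t| <= `|f (h + t) - f t| /\
    P (f (h + t)) (h + t) - P (f t) (h + t) = PS (c h) (h + t) * (f (h + t) - f t).
  suff ex h : exists c, 0 < h + t -> `|c - f t| <= `|f (h + t) - f t| /\
      P (f (h + t)) (h + t) - P (f t) (h + t) = PS c (h + t) * (f (h + t) - f t).
    by have [c hc] := choice ex; exists c.
  have [ht|ht] := ltP 0 (h + t); last by exists 0.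
  have [c c1 c2] := MVT_unordered (fun s => dS s (h + t) ht) (f t) (f (h + t)).
  by exists c => _; split.
have cft : (fun h => f (h + t)) @ (0:R)^' --> f t.
  exact: (cvg_comp _ _ sh cf).
have cc : c @ (0:R)^' --> f t.
  apply/cvgrPdist_le => e e0.
  move/cvgrPdist_le : cft => /(_ _ e0) cft.
  near=> h; rewrite distrC.
  have [h1 _] : `|c h - f t| <= `|f (h + t) - f t| /\ True.
    by split => //; have [] := hc h _ => //; near: h; exact: pos.
  by apply: (le_trans h1); rewrite distrC; near: h; exact: cft.
have cPS : (fun h => PS (c h) (h + t)) @ (0:R)^' --> PS (f t) t.
  exact: (cvg_comp2 cc sh cS).
have cq : (fun h => h^-1 * (f (h + t) - f t)) @ (0:R)^' --> df by exact/is_derive_cvg.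
apply: cvg_trans (cvgM cPS cq); apply: near_eq_cvg; near=> h.
have ht : 0 < h + t by near: h; exact: pos.
by rewrite /A; have [_ ->] := hc h ht; rewrite /= mulrCA.
Unshelve. all: by end_near. Qed.

End Derivatives.

(** * The structure of a single equilibrium *)
Section IsDeriveNear.
Context {R : realType}.

Lemma is_derive_axis (h : R * R * R -> R) (r : R) :
  derivable h (r, 0, 0) (1, 0, 0) ->
  is_derive r 1 (fun s => h (s, 0, 0)) ('D_(1, 0, 0) h (r, 0, 0)).
Proof.
move=> dh; apply/is_derive_cvg.
suff -> : (fun t : R => t^-1 * (h (t + r, 0, 0) - h (r, 0, 0))) =
  (fun t : R => t^-1 *: (h (t *: ((1, 0, 0) : R * R * R) + (r, 0, 0)) - h (r, 0, 0))) by exact: dh.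
apply/funext => t.
have -> : t *: ((1, 0, 0) : R * R * R) + (r, 0, 0) = (t * 1 + r, t * 0 + 0, t * 0 + 0) by [].
by rewrite mulr1 mulr0 addr0.
Qed.

Lemma continuous_near (g1 g2 : R -> R) (x : R) :
  (\forall y \near x, g1 y = g2 y) -> {for x, continuous g1} -> {for x, continuous g2}.
Proof.
move=> h c; rewrite /prop_for /continuous_at -(nbhs_singleton h).
by apply: cvg_trans c; apply: near_eq_cvg.
Qed.

End IsDeriveNear.

Section Star.
Context {R : realType}.
Local Notation E3 := (R * R * R)%type.
Local Notation leb := (@lebesgue_measure R).
Variables (P : R -> R -> R) (f : R -> R) (g0 al0 : R) (rho : R -> R) (Rd b : R).
Hypothesis HP : hypP P g0 al0.
Hypothesis HE : hypEs P f rho Rd g0 al0.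
Hypothesis rho0b : rho 0 < b.
Hypothesis Hf : Ck_on `[0, b]%classic 1 f.
Local Notation I := (`]0, Rd[%classic : set R).

Definition PS (s t : R) : R := derive1 (P^~ t) s.
Definition PT (s t : R) : R := derive1 (P s) t.

Let nbhs_pos (t : R) : 0 < t -> nbhs t (`]0, +oo[%classic : set R).
Proof. by move=> t0; apply: open_nbhs_nbhs; split; [exact: interval_open|rewrite /= in_itv/= t0]. Qed.

Let nbhs_strip (s t : R) : 0 < t ->
  nbhs (s, t) ((setT : set R) `*` (`]0, +oo[%classic : set R)).
Proof.
by move=> t0; exists (setT, `]0, +oo[%classic) => //; split; [exact: filterT|exact: nbhs_pos].
Qed.

Lemma PS_derive (s t : R) : 0 < t -> is_derive s 1 (P^~ t) (PS s t).
Proof.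
move=> t0; have [_ [/(_ s t Logic.I) h _ _]] := P_C3 HP.
have [|d1 _] := h; first by rewrite /= in_itv/= t0.
by rewrite /PS -(derive_in_derive1 _ d1); [apply: derivable_in_interior|]; try exact: filterT.
Qed.

Lemma PT_derive (s t : R) : 0 < t -> is_derive t 1 (P s) (PT s t).
Proof.
move=> t0; have [_ [/(_ s t Logic.I) h _ _]] := P_C3 HP.
have [|_ d1] := h; first by rewrite /= in_itv/= t0.
by rewrite /PT -(derive_in_derive1 _ d1); [apply: derivable_in_interior|]; try exact: nbhs_pos.
Qed.

Let cont2 (F G : R -> R -> R) (s t : R) : 0 < t ->
  (forall s t : R, 0 < t -> F s t = G s t) ->
  {within setT `*` `]0, +oo[%classic, continuous (fun p : R * R => F p.1 p.2)} ->
  {for (s, t), continuous (fun p : R * R => G p.1 p.2)}.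
Proof.
move=> t0 FG /(continuous_of_within (nbhs_strip s t0)) c.
rewrite /prop_for /continuous_at/= -FG//.
apply: cvg_trans c; apply: near_eq_cvg.
by apply: filterS (nbhs_strip s t0) => -[u v] [_ /=]; rewrite in_itv/= andbT => v0; exact: FG.
Qed.

Lemma PS_continuous (s t : R) : 0 < t -> {for (s, t), continuous (fun p : R * R => PS p.1 p.2)}.
Proof.
move=> t0; have [_ [h [c _] _]] := P_C3 HP.
apply: (cont2 t0 _ c) => u v v0.
have [|d1 _] := h u v Logic.I; first by rewrite /= in_itv/= v0.
exact: (derive_in_derive1 (@filterT _ _ _) d1).
Qed.

Lemma PT_continuous (s t : R) : 0 < t -> {for (s, t), continuous (fun p : R * R => PT p.1 p.2)}.
Proof.
move=> t0; have [_ [h _ [c _]]] := P_C3 HP.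
apply: (cont2 t0 _ c) => u v v0.
have [|_ d1] := h u v Logic.I; first by rewrite /= in_itv/= v0.
exact: (derive_in_derive1 (nbhs_pos v0) d1).
Qed.

Let nbhs_oo (u v t : R) : u < t < v -> nbhs t (`[u, v]%classic : set R).
Proof.
move=> tuv; apply: (@filterS _ _ _ `]u, v[%classic).
  by move=> x /=; rewrite !in_itv/= => /andP[/ltW -> /ltW ->].
by apply: open_nbhs_nbhs; split; [exact: interval_open|rewrite /= in_itv/=].
Qed.

Let in_cc (u v t : R) : u < t < v -> `[u, v]%classic t.
Proof. by move=> /andP[ut tv]; rewrite /= in_itv/= !ltW. Qed.

Lemma f_derive (t : R) : 0 < t < b -> is_derive t 1 f (derive1 f t).
Proof.
move=> tb; have [_ [d _]] := Hf; have n := nbhs_oo tb; have dt := d t (in_cc tb).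
by rewrite -(derive_in_derive1 n dt); exact: derivable_in_interior.
Qed.

Let near_oo (u v t : R) : u < t < v -> \forall s \near t, u < s < v.
Proof.
move=> tuv; apply: (@filterS _ _ _ `]u, v[%classic); first by move=> x /=; rewrite in_itv.
by apply: open_nbhs_nbhs; split; [exact: interval_open|rewrite /= in_itv/=].
Qed.

Lemma df_continuous (t : R) : 0 < t < b -> {for t, continuous (derive1 f)}.
Proof.
move=> tb; have [_ [d [c _]]] := Hf.
apply: (@continuous_near _ (derive_in `[0, b]%classic f)).
  apply: filterS (near_oo tb) => s sb.
  by apply: derive_in_derive1; [exact: nbhs_oo|exact: d (in_cc sb)].
exact: continuous_of_within (nbhs_oo tb) c.
Qed.

Definition dPt (t : R) : R := PS (f t) t * derive1 f t + PT (f t) t.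
(** The weight [weight1] as a function of the density. *)
Definition W (t : R) : R := dPt t / t.

Lemma Ptilde_derive (t : R) : 0 < t < b -> is_derive t 1 (Ptilde P f) (dPt t).
Proof.
move=> tb; have [t0 _] := andP tb.
apply: (chain_rule t0 PS_derive PT_derive); [exact: PS_continuous|exact: f_derive].
Qed.

Lemma graph_continuous (F : R -> R -> R) (t : R) : 0 < t < b ->
  {for (f t, t), continuous (fun p : R * R => F p.1 p.2)} ->
  {for t, continuous (fun t => F (f t) t)}.
Proof.
move=> tb cF; have cf := is_derive_continuous (f_derive tb).
exact: (cvg_comp2 cf cvg_id cF).
Qed.

Lemma dPt_continuous (t : R) : 0 < t < b -> {for t, continuous dPt}.
Proof.
move=> tb; have [t0 _] := andP tb; rewrite /dPt.
apply: cvgD; last by apply: graph_continuous => //; exact: PT_continuous.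
apply: cvgM; last exact: df_continuous.
by apply: graph_continuous => //; exact: PS_continuous.
Qed.

Lemma W_continuous (t : R) : 0 < t < b -> {for t, continuous W}.
Proof.
move=> tb; have [t0 _] := andP tb; apply: cvgM; first exact: dPt_continuous.
by apply: inv_continuous; rewrite gt_eqF.
Qed.

Lemma dPtildeE (t : R) : 0 < t <= rho 0 -> dPtilde P f rho t = dPt t.
Proof.
move=> /andP[t0 tr]; apply: derive_in_itv; first by rewrite t0.
by apply: Ptilde_derive; rewrite t0 (le_lt_trans tr).
Qed.

Lemma dfE (t : R) : 0 < t <= rho 0 -> df f rho t = derive1 f t.
Proof.
move=> /andP[t0 tr]; apply: derive_in_itv; first by rewrite t0.
by apply: f_derive; rewrite t0 (le_lt_trans tr).
Qed.

(** ** The density profile *)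

Let Rd0 : 0 < Rd. Proof. exact: Es_radius HE. Qed.

Lemma rho_within : {within `[0, Rd]%classic, continuous rho}.
Proof. by have [] := Es_rho_C1 HE. Qed.

Lemma rho_derive (r : R) : 0 < r < Rd -> is_derive r 1 rho (derive1 rho r).
Proof.
move=> rR; have [_ [d _]] := Es_rho_C1 HE; have n := nbhs_oo rR.
by rewrite -(derive_in_derive1 n (d _ (in_cc rR))); apply: derivable_in_interior => //; exact: d (in_cc rR).
Qed.

Lemma drho_continuous (r : R) : 0 < r < Rd -> {for r, continuous (derive1 rho)}.
Proof.
move=> rR; have [_ [d [c _]]] := Es_rho_C1 HE.
apply: (@continuous_near _ (derive_in `[0, Rd]%classic rho)).
  apply: filterS (near_oo rR) => s sR.
  by apply: derive_in_derive1; [exact: nbhs_oo|exact: d (in_cc sR)].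
exact: continuous_of_within (nbhs_oo rR) c.
Qed.

Lemma drho_bounded : exists2 C, 0 < C & forall r, 0 < r < Rd -> `|derive1 rho r| <= C.
Proof.
have [_ [d [c _]]] := Es_rho_C1 HE.
have cn : {within `[0, Rd]%classic, continuous (fun r => `|derive_in `[0, Rd]%classic rho r|)}.
  by move=> x; apply: continuous_comp; [exact: c|exact: norm_continuous].
have [z zI hz] := EVT_max (ltW Rd0) cn.
exists (`|derive_in `[0, Rd]%classic rho z| + 1); first by rewrite ltr_wpDl.
move=> r rR; rewrite -(derive_in_derive1 (nbhs_oo rR) (d _ (in_cc rR))).
by apply: (le_trans (hz r _)); [exact: in_cc|rewrite lerDl].
Qed.

Lemma rho_decr (x y : R) : 0 <= x -> x < y -> y <= Rd -> rho y < rho x.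
Proof.
move=> x0 xy yR.
have xI : x \in `[0, Rd]%R by rewrite in_itv/= x0 (ltW (lt_le_trans xy yR)).
have yI : y \in `[0, Rd]%R by rewrite in_itv/= yR (le_trans x0 (ltW xy)).
apply: (@ltr0_derive1_lt_cc _ rho 0 Rd) => //.
- by move=> r; rewrite in_itv/= => rR; have [] := rho_derive rR.
- by move=> r; rewrite in_itv/= => rR; exact: Es_rho_decr HE _ rR.
- exact: rho_within.
Qed.

Lemma rho_gt0 (r : R) : 0 <= r < Rd -> 0 < rho r.
Proof. by move=> /andP[r0 rR]; rewrite -(Es_rho_bdry HE) rho_decr. Qed.

Lemma rho_le (r : R) : 0 <= r <= Rd -> rho r <= rho 0.
Proof.
move=> /andP[]; rewrite le_eqVlt => /orP[/eqP <-//|r0] rR.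
by apply/ltW/rho_decr.
Qed.

Lemma rho_range (r : R) : 0 <= r < Rd -> 0 < rho r < b.
Proof.
move=> rR; rewrite rho_gt0//=; apply: le_lt_trans rho0b; apply: rho_le.
by have /andP[-> /ltW ->] := rR.
Qed.

Lemma rho_range0 (r : R) : 0 <= r < Rd -> 0 < rho r <= rho 0.
Proof.
move=> rR; rewrite rho_gt0//=; apply: rho_le.
by have /andP[-> /ltW ->] := rR.
Qed.

Lemma rho_continuous (r : R) : 0 < r < Rd -> {for r, continuous rho}.
Proof. by move=> /rho_derive/is_derive_continuous. Qed.

Lemma measurable_continuous (g : R -> R) :
  (forall r, 0 < r < Rd -> {for r, continuous g}) -> measurable_fun I g.
Proof.
move=> c; apply: open_continuous_measurable_fun; first exact: interval_open.
by move=> r; rewrite inE/= in_itv/=; exact: c.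
Qed.

Lemma measurable_rho : measurable_fun I rho.
Proof. by apply: measurable_continuous => r; exact: rho_continuous. Qed.

Lemma weight1E (r : R) : 0 <= r < Rd -> weight1 P f rho r = W (rho r).
Proof. by move=> rR; rewrite /weight1 /W dPtildeE// rho_range0. Qed.

Lemma weight1_gt0 (r : R) : 0 <= r < Rd -> 0 < weight1 P f rho r.
Proof.
by move=> rR; rewrite /weight1 divr_gt0 ?(Es_dPtilde HE)//; have /andP[] := rho_range rR.
Qed.

Lemma weight1_continuous (r : R) : 0 < r < Rd -> {for r, continuous (weight1 P f rho)}.
Proof.
move=> rR; apply: (@continuous_near _ (W \o rho)).
  apply: filterS (near_oo rR) => s /andP[s0 sR] /=.
  by rewrite weight1E// ltW.
apply: continuous_comp; first exact: rho_continuous.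
by apply/W_continuous/rho_range; have /andP[/ltW -> ->] := rR.
Qed.

Lemma measurable_weight1 : measurable_fun I (weight1 P f rho).
Proof. by apply: measurable_continuous => r; exact: weight1_continuous. Qed.

(** Near the surface [rho] is small, and there the vacuum behaviour of the
    pressure makes the weight large because [g0 < 2]. *)
Lemma weight1_lower : exists2 kap, 0 < kap &
  forall r, 0 <= r < Rd -> kap <= weight1 P f rho r.
Proof.
have [j0 [j1 [K [_ _ _ L0 cvL]]]] := Es_sound HE.
set L := g0 * K (f 0) in L0 cvL.
have [e /= e0 he] : \forall t \near (0:R)^'+, L / 2 < dPtilde P f rho t / t `^ (g0 - 1).
  by apply: (cvgr_gt _ cvL); lra.
pose d := Num.min e 1.
have d0 : 0 < d by rewrite lt_min e0 ltr01.
have [r1 /andP[r10 r1R] hr1] : exists2 r1 : R, 0 <= r1 < Rd & forall r : R, r1 <= r < Rd -> rho r < d.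
  have /(continuous_within_itvP _ Rd0)[_ _ cR] := rho_within.
  rewrite (Es_rho_bdry HE) in cR.
  have [z /= z0 hz] : \forall r \near Rd^'-, rho r < d by exact: (cvgr_lt _ cR).
  exists (Num.max 0 (Rd - z / 2)).
    by rewrite le_max lexx/= gt_max Rd0/= ltrBlDr ltrDl divr_gt0.
  move=> r /andP[]; rewrite ge_max => /andP[_ r1] r2; apply: hz => //=.
  rewrite gtr0_norm ?subr_gt0//; lra.
have near_bdry (r : R) : r1 <= r < Rd -> L / 2 <= weight1 P f rho r.
  move=> rr; have /andP[r1r rR] := rr.
  have rR' : 0 <= r < Rd by rewrite rR (le_trans r10).
  have /andP[t0 _] := rho_range rR'; have td := hr1 r rr.
  rewrite lt_min in td; have /andP[te t1] := td.
  have := he (rho r) _ t0; rewrite /= sub0r normrN gtr0_norm// => /(_ te).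
  rewrite ltr_pdivlMr ?powR_gt0// => hh.
  rewrite /weight1 ler_pdivlMr//; apply: le_trans (ltW hh).
  rewrite ler_pM2l; last by lra.
  rewrite -[leLHS]powRr1 ?(ltW t0)//; by apply: ger_powR; [rewrite t0 ltW|have /andP[_ ?] := P_gamma HP; lra].
have c1 : {within `[0, r1]%classic, continuous (W \o rho)}.
  rewrite continuous_subspace_in => r; rewrite inE => rI.
  have cr : {within `[0, r1]%classic, continuous rho}.
    apply: continuous_subspaceW rho_within; apply: subset_itvl.
    by rewrite bnd_simp ltW.
  apply: (continuous_comp (cr r)); apply/W_continuous/rho_range.
  move: rI; rewrite /= in_itv/= => /andP[-> rr1]; exact: le_lt_trans rr1 r1R.
have [z zI hz] := EVT_min r10 c1.
have zR : 0 <= z < Rd by move: zI; rewrite in_itv/= => /andP[-> /le_lt_trans ->].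
exists (Num.min (L / 2) (W (rho z))).
  by rewrite lt_min -weight1E// weight1_gt0// andbT; lra.
move=> r rR; have [rr|rr] := leP r1 r.
  by rewrite ge_min near_bdry ?rr//; have /andP[_ ->] := rR.
rewrite ge_min weight1E// [X in _ || X]hz ?orbT// in_itv/= (ltW rr) andbT.
by have /andP[->] := rR.
Qed.

End Star.

(** * The Newtonian energy of radial densities *)
Section ShellPotential.
Context {R : realType}.
Local Notation leb := (@lebesgue_measure R).
Variable Rd : R.
Hypothesis Rd0 : 0 < Rd.
Local Notation I := (`]0, Rd[%classic : set R).
Local Notation U := (shell_potential Rd).
Let sq (s : R) : R := s ^+ 2.

Let mI : measurable (I : set (measurableTypeR R)). Proof. by []. Qed.

Let in_I s : I s -> 0 < s < Rd. Proof. by rewrite /= in_itv. Qed.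

Let msq : measurable_fun I sq.
Proof. by apply: measurable_funX; exact: measurable_id. Qed.

Let sq_gt0 s : I s -> 0 < sq s.
Proof. by move=> /in_I/andP[s0 _]; rewrite exprn_gt0. Qed.

Definition L2ball (eta : R -> R) : Prop := WL2 I (fun s => s ^+ 2) eta.

Lemma L2ball_measurable eta : L2ball eta -> measurable_fun I eta.
Proof. exact: WL2_measurable. Qed.

Lemma integrable_cst_I (c : R) : leb.-integrable I (EFin \o cst c).
Proof.
apply: measurable_bounded_integrable => //; last exact: bounded_cst.
by rewrite /= lebesgue_measure_itv/= lte_fin Rd0 -EFinB ltry.
Qed.

Lemma integrable_bounded_I (g : R -> R) (C : R) : measurable_fun I g ->
  (forall s, I s -> `|g s| <= C) -> leb.-integrable I (EFin \o g).
Proof.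
move=> mg gC; apply: (le_integrable mI _ _ (integrable_cst_I C)).
  exact/measurable_EFinP.
move=> s Is /=; rewrite lee_fin; apply: (le_trans (gC s Is)).
exact: ler_norm.
Qed.

Let half_bound (x : R) : `|x| <= 1 + x ^+ 2.
Proof. by rewrite ler_norml; apply/andP; split; nra. Qed.

Lemma L2ball_integrable eta : L2ball eta ->
  leb.-integrable I (fun s => (s * `|eta s|)%:E).
Proof.
move=> [me ie].
apply: (le_integrable mI _ _ (integrableD mI (integrable_cst_I 1) ie)).
  apply/measurable_EFinP; apply: measurable_funM; first exact: measurable_id.
  exact: measurableT_comp.
move=> s /in_I/andP[s0 _] /=; rewrite lee_fin normrM normr_id -normrM.
have h : 0 <= 1 + s ^+ 2 * eta s ^+ 2 by rewrite addr_ge0// mulr_ge0 ?sqr_ge0.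
by rewrite [leRHS]ger0_norm// -exprMn; exact: half_bound.
Qed.

Lemma L2ball_integrable2 eta : L2ball eta ->
  leb.-integrable I (fun s => (s ^+ 2 * eta s)%:E).
Proof.
move=> Fe; have := integrableZl mI Rd (L2ball_integrable Fe).
apply: le_integrable => //.
  by apply/measurable_EFinP; apply: measurable_funM => //; case: Fe.
move=> s /in_I/andP[s0 sR]; rewrite -EFinM !abse_EFin lee_fin.
have -> : `|s ^+ 2 * eta s| = s * (s * `|eta s|).
  by rewrite normrM normrX gtr0_norm// expr2 mulrA.
rewrite ger0_norm; last by rewrite !mulr_ge0// ltW.
by rewrite ler_wpM2r ?mulr_ge0// ltW.
Qed.

Let max_gt0 (s r : R) : 0 < s -> 0 < Num.max s r.
Proof. by move=> s0; rewrite lt_max s0. Qed.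

Lemma measurable_shell (r : R) : measurable_fun I (fun s => s ^+ 2 / Num.max s r).
Proof.
apply: measurable_funTS.
by apply: measurable_funM; [apply: measurable_funX|]; meas.
Qed.

Lemma shell_le (s r : R) : 0 < s -> 0 <= s ^+ 2 / Num.max s r <= s.
Proof.
move=> s0; rewrite divr_ge0 ?sqr_ge0 ?(ltW (max_gt0 r s0))//=.
rewrite ler_pdivrMr ?max_gt0// expr2.
by apply: ler_wpM2l; [exact: ltW|rewrite le_max lexx].
Qed.

Lemma shell_integrable eta r : L2ball eta ->
  leb.-integrable I (fun s => (s ^+ 2 / Num.max s r * eta s)%:E).
Proof.
move=> Fe; apply: (le_integrable mI _ _ (L2ball_integrable Fe)).
  apply/measurable_EFinP; apply: measurable_funM; first exact: measurable_shell.
  exact: L2ball_measurable.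
move=> s /in_I/andP[s0 _]; rewrite !abse_EFin lee_fin.
have /andP[k0 k1] := shell_le r s0.
rewrite normrM (ger0_norm k0) [leRHS]ger0_norm; last by rewrite mulr_ge0// ltW.
by apply: ler_wpM2r.
Qed.

Definition shell_bound (eta : R -> R) : R := \int[leb]_(s in I) (s * `|eta s|).

Lemma shell_potential_bounded eta r : L2ball eta -> `|U eta r| <= shell_bound eta.
Proof.
move=> Fe; rewrite /U /shell_bound.
apply: (le_trans (le_normr_Rintegral mI (shell_integrable r Fe))).
apply: le_Rintegral => //.
- exact: (integrable_norm (shell_integrable r Fe)).
- exact: L2ball_integrable.
- move=> s /in_I/andP[s0 _]; have /andP[k0 k1] := shell_le r s0.
  by rewrite normrM ger0_norm// ler_wpM2r.
Qed.

Let kern (xi eta : R -> R) (q : R * R) : R :=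
  (fun r => sq r * xi r) \_ I q.1 * (((fun s => sq s * eta s) \_ I) q.2 / Num.max q.2 q.1).

Let mext (eta : R -> R) : L2ball eta ->
  measurable_fun [set: R] ((fun s => sq s * eta s) \_ I).
Proof.
move=> Fe; apply: (measurable_restrictT _ _).1 => //.
by apply: measurable_funM => //; exact: L2ball_measurable.
Qed.

Let mkern xi eta : L2ball xi -> L2ball eta ->
  measurable_fun [set: R * R] (fun q => (kern xi eta q)%:E).
Proof.
move=> Fx Fe; have mx := mext Fx; have me := mext Fe.
by rewrite /kern; meas.
Qed.

Let inner xi eta r : (\int[leb]_s (kern xi eta (r, s))%:E =
   \int[leb]_(s in I) (((fun r => sq r * xi r) \_ I) r * (s ^+ 2 / Num.max s r * eta s))%:E)%E.
Proof.
rewrite [RHS]integral_mkcond; apply: eq_integral => s _.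
rewrite /kern/= [in RHS]patchE [X in _ * (X / _)]patchE; case: ifP => _.
  by congr EFin; rewrite /sq; ring.
by rewrite mul0r mulr0.
Qed.

Let kern_norm xi eta q : `|kern xi eta q| = kern (fun s => `|xi s|) (fun s => `|eta s|) q.
Proof.
rewrite /kern !patchE; case: ifP => h1; last by rewrite !mul0r normr0.
case: ifP => h2; last by rewrite !mul0r !mulr0 normr0.
have /in_I/andP[s0 _] := set_mem h2.
have gen (A x B y m : R) : 0 <= A -> 0 <= B -> 0 < m ->
    `|A * x * (B * y / m)| = A * `|x| * (B * `|y| / m).
  by move=> A0 B0 m0; rewrite !normrM normfV (ger0_norm A0) (ger0_norm B0) (gtr0_norm m0).
by apply: gen; [exact: sqr_ge0|exact: sqr_ge0|exact: max_gt0].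
Qed.

Let L2ball_norm eta : L2ball eta -> L2ball (fun s => `|eta s|).
Proof.
move=> [me ie]; split; first exact: measurableT_comp.
by move: ie; apply: eq_integrable => // s _; rewrite real_normK ?num_real.
Qed.

Let kern_integrable xi eta : L2ball xi -> L2ball eta ->
  (leb \x leb)%E.-integrable [set: R * R] (fun q => (kern xi eta q)%:E).
Proof.
move=> Fx Fe; apply/(@integrable12ltyP _ _ _ _ R leb leb) => //; first exact: mkern.
have Fx' := L2ball_norm Fx; have Fe' := L2ball_norm Fe.
pose B := shell_bound (fun s => `|eta s|).
have ix := L2ball_integrable2 Fx'.
apply: (@le_lt_trans _ _ (\int[leb]_r ((fun r => sq r * `|xi r| * B) \_ I r)%:E)%E); last first.
  rewrite (_ : integral _ _ _ = \int[leb]_(r in I) (sq r * `|xi r| * B)%:E)%E; last first.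
    by rewrite [RHS]integral_mkcond; apply: eq_integral => r _; rewrite !patchE; case: ifP.
  have := integrable_lty mI (integrableZl mI B ix); apply: le_lt_trans.
  rewrite le_eqVlt; apply/orP; left; apply/eqP; apply: eq_integral => r _.
  by rewrite -EFinM /sq mulrC.
have mB : measurable_fun I (fun r => sq r * `|xi r| * B).
  apply: measurable_funM; last exact: measurable_cst.
  by apply: measurable_funM; [exact: msq|exact: L2ball_measurable Fx'].
apply: ge0_le_integral => //.
- by move=> r _; apply: integral_ge0.
- apply: (@measurable_fun_fubini_tonelli_F _ _ _ _ _ leb
    (fun q => `|(kern xi eta q)%:E|)%E) => //.
  by apply: measurableT_comp => //; exact: mkern.
- by apply/measurable_EFinP; exact: (measurable_restrictT _ mI).1.
move=> r _.
have -> : (\int[leb]_s `|(kern xi eta (r, s))%:E| =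
    \int[leb]_s (kern (fun s => `|xi s|) (fun s => `|eta s|) (r, s))%:E)%E.
  by apply: eq_integral => s _; rewrite abse_EFin kern_norm.
rewrite inner patchE [X in (_ <= X%:E)%E]patchE; case: ifP => hI; last first.
  by rewrite integral0_eq// => s _; rewrite mul0r.
have i1 := shell_integrable r Fe'.
under eq_integral do rewrite EFinM.
rewrite integralZl//.
rewrite -(@fineK _ (integral _ _ _)); last exact: integrable_fin_num.
rewrite -EFinM lee_fin; apply: ler_wpM2l; first by apply: mulr_ge0; [exact: sqr_ge0|].
exact: le_trans (ler_norm _) (shell_potential_bounded r Fe').
Qed.

Let kern_F xi eta : L2ball xi -> L2ball eta -> forall r,
  (\int[leb]_s (kern xi eta (r, s))%:E =
   ((fun r => r ^+ 2 * (U eta r * xi r)) \_ I r)%:E)%E.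
Proof.
move=> Fx Fe r; rewrite inner patchE [X in _ = X%:E]patchE; case: ifP => hI; last first.
  by rewrite integral0_eq// => s _; rewrite mul0r.
have i1 := shell_integrable r Fe.
under eq_integral do rewrite EFinM.
rewrite integralZl// -(@fineK _ (integral _ _ _)); last exact: integrable_fin_num.
by rewrite -EFinM; congr EFin; rewrite /U /Rintegral /sq; ring.
Qed.

Lemma newton_pairing_integrable xi eta : L2ball xi -> L2ball eta ->
  leb.-integrable I (fun r => (r ^+ 2 * (U eta r * xi r))%:E).
Proof.
move=> Fx Fe; have := @integrable_fubini_F _ _ _ _ R leb leb _ (kern_integrable Fx Fe).
rewrite /fubini_F => h; apply/(integrable_mkcond _ mI); move: h.
apply: eq_integrable => // r _; rewrite kern_F//.
by rewrite !patchE; case: ifP.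
Qed.

(** Fubini's theorem, for a kernel that is symmetric in the two radii. *)
Lemma newton_pairing_sym xi eta : L2ball xi -> L2ball eta ->
  \int[leb]_(r in I) (r ^+ 2 * (U eta r * xi r)) =
  \int[leb]_(r in I) (r ^+ 2 * (U xi r * eta r)).
Proof.
move=> Fx Fe; rewrite /Rintegral; congr fine.
have E x y : L2ball x -> L2ball y ->
    (\int[leb]_(r in I) (r ^+ 2 * (U y r * x r))%:E =
     \int[leb]_r \int[leb]_s (kern x y (r, s))%:E)%E.
  move=> Fa Fb; rewrite integral_mkcond; apply: eq_integral => r _.
  by rewrite kern_F// !patchE; case: ifP.
apply: (etrans (E xi eta Fx Fe)); apply: (etrans _ (esym (E eta xi Fe Fx))).
apply: (etrans (@Fubini _ _ _ _ R leb leb _ (kern_integrable Fx Fe))).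
apply: eq_integral => r _; apply: eq_integral => s _; congr EFin.
by rewrite /kern/= maxC; ring.
Qed.

Lemma measurable_shell_pairing xi eta : L2ball xi -> L2ball eta ->
  measurable_fun I (fun r => U eta r * xi r).
Proof.
move=> Fx Fe; have /integrableP[/measurable_EFinP m _] := newton_pairing_integrable Fx Fe.
have m2 : measurable_fun I (fun r : R => (r ^+ 2)^-1) by apply: measurable_funTS; meas.
have := measurable_funM m2 m; apply: eq_measurable_fun => r.
by rewrite inE => /sq_gt0 h; rewrite /= mulKf// gt_eqF.
Qed.

Lemma shell_potentialB eta r0 r : L2ball eta ->
  U eta r - U eta r0 =
  \int[leb]_(s in I) (s ^+ 2 * ((Num.max s r)^-1 - (Num.max s r0)^-1) * eta s).
Proof.
move=> Fe; rewrite /U -RintegralB//; try exact: shell_integrable.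
by apply: eq_Rintegral => s _; ring.
Qed.

End ShellPotential.

(** * The second variation at a single equilibrium *)
Section StarForms.
Context {R : realType}.
Local Notation E3 := (R * R * R)%type.
Local Notation leb := (@lebesgue_measure R).
Variables (P : R -> R -> R) (f : R -> R) (g0 al0 : R) (rho : R -> R) (Rd b : R).
Hypothesis HP : hypP P g0 al0.
Hypothesis HE : hypEs P f rho Rd g0 al0.
Hypothesis rho0b : rho 0 < b.
Hypothesis Hf : Ck_on `[0, b]%classic 1 f.
Local Notation I := (`]0, Rd[%classic : set R).
Local Notation w := (weight1 P f rho).
Local Notation X := (X1rad P f rho Rd).
Local Notation U := (shell_potential Rd).
Local Notation L := (Lform P f rho Rd).

Let Rd0 : 0 < Rd. Proof. exact: Es_radius HE. Qed.
Let pi4 : 0 < 4 * pi :> R. Proof. by rewrite mulr_gt0 ?pi_gt0. Qed.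
Let mI : measurable (I : set (measurableTypeR R)). Proof. by []. Qed.
Let in_I s : I s -> 0 < s < Rd. Proof. by rewrite /= in_itv. Qed.
Let in_I' s : I s -> 0 <= s < Rd. Proof. by move=> /in_I/andP[/ltW -> ->]. Qed.
Let mw : measurable_fun I w. Proof. exact: measurable_weight1 HP HE rho0b Hf. Qed.
Let w0 s : I s -> 0 < w s.
Proof. by move=> /in_I' sR; apply: (weight1_gt0 HE) => //; exact: rho0b. Qed.

Lemma X_WL2 eta : X eta <-> WL2 I (radial_weight w) eta.
Proof. exact: L2radP. Qed.

Lemma X_measurable eta : X eta -> measurable_fun I eta.
Proof. by move=> /X_WL2/WL2_measurable. Qed.

Lemma X_L2ball eta : X eta -> L2ball Rd eta.
Proof.
move=> /X_WL2[me ie]; split => //.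
have [kap kap0 hk] := weight1_lower HP HE rho0b Hf.
have := integrableZl mI kap^-1 ie; apply: le_integrable => //.
  apply/measurable_EFinP; apply: measurable_funM; apply: measurable_funX => //.
move=> s Is; rewrite -EFinM !abse_EFin lee_fin.
have ws := hk s (in_I' Is).
have h1 : 0 <= s ^+ 2 * eta s ^+ 2 by rewrite mulr_ge0 ?sqr_ge0.
have e : kap^-1 * (radial_weight w s * eta s ^+ 2) =
    (w s / kap) * (s ^+ 2 * eta s ^+ 2) by rewrite /radial_weight; ring.
have h2 : 1 <= w s / kap by rewrite ler_pdivlMr// mul1r.
rewrite ger0_norm// e ger0_norm; last by rewrite mulr_ge0// (le_trans ler01).
by rewrite ler_peMl.
Qed.

Lemma X_lin c x y : X x -> X y -> X (c *: x + y).
Proof. exact: L2rad_lin. Qed.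

Lemma LformE eta xi : X eta -> X xi -> L eta xi = 4 * pi *
  (wip I (radial_weight w) eta xi -
   4 * pi * \int[leb]_(r in I) (r ^+ 2 * (U eta r * xi r))).
Proof.
move=> Xe Xx; have me := X_measurable Xe; have mx := X_measurable Xx.
have Fe := X_L2ball Xe; have Fx := X_L2ball Xx.
rewrite /Lform.
transitivity (\int[leb3]_(x in eball Rd) radial (fun s => w s * eta s * xi s) x
  - 4 * pi * \int[leb3]_(x in eball Rd) radial (fun s => U eta s * xi s) x).
  congr (_ - _ * _); apply: eq_Rintegral => x _.
  by rewrite newton_radial_ball.
rewrite !Rintegral_radial_ball//; last 2 first.
- exact: (measurable_shell_pairing Rd0 Fx Fe).
- by do 2 apply: measurable_funM => //.
rewrite mulrBr; congr (_ - _).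
  by congr (_ * _); apply: eq_Rintegral => s _; rewrite /radial_weight/=; ring.
Qed.

Lemma Lform_sym : symmetric_on X L.
Proof.
move=> eta xi Xe Xx; rewrite !LformE// wipC newton_pairing_sym//; exact: X_L2ball.
Qed.

(** A solution of the linearized equilibrium equation is orthogonal for [L] to the
    perturbations of zero mass. *)
Lemma Lform_euler v C xi : X v -> X xi ->
  (forall r, 0 < r < Rd -> w r * v r - 4 * pi * U v r = C) ->
  L v xi = C * (4 * pi * \int[leb]_(s in I) (s ^+ 2 * xi s)).
Proof.
move=> Xv Xx hC; rewrite LformE// mulrCA; congr (_ * _).
have Fv := X_L2ball Xv; have Fx := X_L2ball Xx.
have i1 := newton_pairing_integrable Rd0 Fx Fv.
have i2 : leb.-integrable I (fun s => (radial_weight w s * (v s * xi s))%:E).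
  apply: wip_integrable => //; [exact: measurable_radial_weight|exact: radial_weight_gt0|exact/X_WL2|exact/X_WL2].
have i3 := L2ball_integrable2 Rd0 Fx.
rewrite -RintegralZl// /wip -RintegralB//; last first.
  by have := integrableZl mI (4 * pi) i1; apply: eq_integrable => // s _; rewrite /= EFinM.
rewrite -RintegralZl//; apply: eq_Rintegral => s; rewrite inE => /in_I sR.
by rewrite -(hC s sR) /radial_weight; ring.
Qed.

(** ** The equilibrium equation in the radial variable *)

Lemma rho_L2ball : L2ball Rd rho.
Proof.
have mr := measurable_rho HE; split => //.
apply: (@integrable_bounded_I _ _ Rd0 _ (Rd ^+ 2 * rho 0 ^+ 2)) => //.
  by apply: measurable_funM; apply: measurable_funX.
move=> s Is; have /andP[s0 sR] := in_I Is; have /andP[r0 r1] := rho_range0 HE (in_I' Is).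
rewrite ger0_norm; last by apply: mulr_ge0; exact: sqr_ge0.
have r00 : 0 <= rho 0 by apply: le_trans r1; exact: ltW.
by apply: ler_pM; rewrite ?sqr_ge0//; apply: lerXn2r; rewrite ?nnegrE//; exact: ltW.
Qed.

Let rho_out (x : E3) : Rd <= enorm x -> radial rho x = 0.
Proof.
rewrite le_eqVlt => /orP[/eqP e|xR]; first by rewrite /radial -e (Es_rho_bdry HE).
apply/eqP; apply: contraT => h.
have : closure [set x : E3 | radial rho x != 0] x by exact: subset_closure.
by rewrite (Es_supp HE)/= leNgt xR.
Qed.

Let rho_restrict : radial rho = radial rho \_ (eball Rd).
Proof.
apply/funext => x; rewrite patchE; case: ifPn => //.
by rewrite notin_setE /eball/= => /negP; rewrite -leNgt => /rho_out.
Qed.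

(** The gradient of the equilibrium equation in the direction of an axis, where
    the Newtonian potential of a radial density is a radial integral. *)
Lemma equilibrium_derive (r : R) : 0 < r < Rd ->
  exists2 d : R, is_derive r 1 (U rho) d & 4 * pi * d = w r * derive1 rho r.
Proof.
move=> rR; have /andP[r0 rR'] := rR.
have en : enorm (r, 0, 0) = r by rewrite enorm_axis// ltW.
have [|dA dV] := Es_equilibrium HE (x := (r, 0, 0)); first by rewrite /eball/= en.
move=> /(congr1 (fun z => z.1.1)) /=; set a1 := 'D_((1, 0, 0) : E3) _ _; set p1 := 'D_((1, 0, 0) : E3) _ _.
rewrite [radial rho _]/radial en => eq1.
have eqn : a1 + rho r * p1 = 0 by exact: eq1.
have near_r : \forall s \near r, 0 < s by exact: lt_nbhsr.
have dA1 := is_derive_axis (@diff_derivable _ _ _ _ _ ((1, 0, 0) : E3) dA).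
have dV1 := is_derive_axis (@diff_derivable _ _ _ _ _ ((1, 0, 0) : E3) dV).
have a1E : a1 = dPt P f (rho r) * derive1 rho r.
  have rr : 0 < rho r < b by apply: (rho_range HE rho0b); rewrite ltW.
  have h1 := @is_derive1_comp _ (Ptilde P f) rho r _ _
    (Ptilde_derive HP Hf rr) (rho_derive HE rR).
  have h2 : is_derive r 1 (Ptilde P f \o rho) a1.
    apply: near_eq_is_derive dA1; apply: filterS near_r => s s0.
    by rewrite /radial enorm_axis ?ltW.
  by have [_ <-] := h2; have [_ ->] := h1.
have dU : is_derive r 1 (fun s => - (4 * pi) * U rho s) p1.
  apply: near_eq_is_derive dV1; apply: filterS near_r => s s0.
  rewrite /potential {1}rho_restrict newton_radial_ball ?enorm_axis ?ltW//.
  exact: measurable_rho HE.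
exists (- (4 * pi)^-1 * p1).
  have := @is_deriveZ _ _ _ _ (- (4 * pi)^-1) r 1 _ dU.
  rewrite (_ : _ \*: _ = U rho)//; apply/funext => s.
  by rewrite /= /GRing.scale/= mulrA mulrNN mulVf ?mul1r// gt_eqF.
have rn0 : rho r != 0.
  by rewrite gt_eqF//; apply: (rho_gt0 HE); rewrite ltW.
rewrite (weight1E HP HE rho0b Hf) ?ltW// /W.
have -> : dPt P f (rho r) / rho r * derive1 rho r = a1 / rho r.
  by rewrite a1E; ring.
have -> : (a1 : R) = - (rho r * p1) by apply/eqP; rewrite -addr_eq0 eqn.
have key (x y q : R) : y != 0 -> q != 0 -> q * (- q^-1 * x) = - (y * x) / y.
  by move=> *; field; apply/andP.
by apply: key; rewrite // gt_eqF.
Qed.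

(** The shell between the radii [Rd / 4] and [Rd / 2] alone contributes a definite
    amount to the decrease of the potential outside. *)
Lemma field_lower : exists2 c : R, 0 < c &
  forall r : R, Rd / 2 <= r < Rd -> w r * derive1 rho r <= - c.
Proof.
pose J := `[Rd / 4, Rd / 2]%classic : set R.
pose K := (Rd / 4) ^+ 2 * rho (Rd / 2) / Rd ^+ 2.
have R0 : (0 : R) < Rd := Rd0.
have h2R : 0 <= Rd / 2 < Rd by apply/andP; split; lra.
have rh0 : 0 < rho (Rd / 2) by exact: rho_gt0 HE _ h2R.
have K0 : 0 < K by rewrite divr_gt0 ?exprn_gt0// mulr_gt0// exprn_gt0// divr_gt0.
have JI : J `<=` I by move=> s; rewrite /J /= !in_itv/= => /andP[? ?]; apply/andP; split; lra.
have mJ : measurable (J : set (measurableTypeR R)) by exact: measurable_itv.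
have iJ : leb.-integrable I (fun s => (\1_J s : R)%:E).
  have m1 : measurable_fun I (\1_J : measurableTypeR R -> R).
    exact: measurable_indic.
  apply: (@integrable_bounded_I _ _ Rd0 _ 1 m1).
  by move=> s _; rewrite indicE; case: (_ \in _); rewrite ?normr1 ?normr0.
have J1 : \int[leb]_(s in I) (\1_J s : R) = Rd / 4.
  have e : fine (leb `[Rd / 4, Rd / 2]%classic) = Rd / 4.
    by rewrite lebesgue_measure_itv/= lte_fin ifT; [rewrite /=; field|lra].
  by rewrite /Rintegral integral_indic// setIidl.
have Fr := rho_L2ball.
have incr r r' : Rd / 2 <= r -> r < r' -> r' < Rd ->
    U rho r' - U rho r <= - (r' - r) * K * (Rd / 4).
  move=> r2 rr' r'R; have r0 : 0 < r by lra.
  have r'0 : 0 < r' by lra.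
  rewrite shell_potentialB// -J1 -RintegralZl//; apply: le_Rintegral => //.
  - have := integrableB mI (shell_integrable Rd0 r' Fr) (shell_integrable Rd0 r Fr).
    by apply: eq_integrable => // s _; rewrite /= -EFinB; congr EFin; ring.
  - by have := integrableZl mI (- (r' - r) * K) iJ; apply: eq_integrable.
  suff key (s : R) : 0 < s < Rd -> s ^+ 2 * ((Num.max s r')^-1 - (Num.max s r)^-1) * rho s
      <= - (r' - r) * K * \1_J s by move=> s /in_I; exact: key.
  move=> sR; have /andP[s0 sR'] := sR.
  have sR0 : 0 <= s < Rd by rewrite ltW.
  have rs : 0 < rho s by exact: rho_gt0 HE _ sR0.
  rewrite indicE; case: (boolP (s \in J)) => [/set_mem|] sJ; last first.
    rewrite mulr0 mulr_le0_ge0 ?(ltW rs)// mulr_ge0_le0 ?sqr_ge0// subr_le0.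
    have m1 : 0 < Num.max s r by rewrite lt_max s0.
    have m2 : 0 < Num.max s r' by rewrite lt_max s0.
    rewrite lef_pV2 ?posrE//.
    by rewrite ge_max !le_max lexx/= (ltW rr') orbT.
  move: sJ; rewrite /J /= in_itv/= => /andP[s1 s2].
  rewrite !max_r; [|lra|lra]; rewrite mulr1.
  have -> : r'^-1 - r^-1 = - ((r' - r) / (r * r')) by field; rewrite !gt_eqF.
  rewrite mulrN mulNr !mulNr lerN2 -!mulrA [leRHS](_ : _ = (r' - r) * (s ^+ 2 * rho s / (r * r'))); last first.
    by field; rewrite !gt_eqF.
  rewrite ler_pM2l ?subr_gt0// /K; apply: ler_pM => //.
  - by rewrite mulr_ge0 ?sqr_ge0 ?(ltW rh0).
  - by rewrite invr_ge0 sqr_ge0.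
  - apply: ler_pM; rewrite ?sqr_ge0 ?(ltW rh0)//.
      by apply: lerXn2r; rewrite ?nnegrE//; lra.
    have [->//|s2'] := eqVneq s (Rd / 2).
    by apply/ltW/(rho_decr HE); [lra|rewrite lt_neqAle s2'|lra].
  - by rewrite lef_pV2 ?posrE ?exprn_gt0 ?mulr_gt0// expr2; apply: ler_pM; lra.
exists (4 * pi * (K * (Rd / 4))); first by apply: mulr_gt0 => //; apply: mulr_gt0 => //; lra.
move=> r /andP[r2 rR]; have rR0 : 0 < r < Rd by apply/andP; split; lra.
have [d /is_derive_cvg dU <-] := equilibrium_derive rR0.
rewrite -mulrN ler_pM2l// leNgt; apply/negP => hd.
have [e /= e0 he] : \forall h \near (0:R)^', - (K * (Rd / 4)) < h^-1 * (U rho (h + r) - U rho r).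
  exact: (cvgr_gt _ dU).
pose h := Num.min e (Rd - r) / 2.
have h0 : 0 < Num.min e (Rd - r) by rewrite lt_min e0 subr_gt0.
have hp : 0 < h by rewrite divr_gt0.
have h1 : h < e.
  by apply: (@lt_le_trans _ _ (Num.min e (Rd - r))); [rewrite /h; lra|rewrite ge_min lexx].
have h2 : h < Rd - r.
  by apply: (@lt_le_trans _ _ (Num.min e (Rd - r))); [rewrite /h; lra|rewrite ge_min lexx orbT].
have := he h; rewrite /= sub0r normrN gtr0_norm// => /(_ h1); rewrite gt_eqF// => /(_ isT).
apply/negP; rewrite -leNgt ler_pdivrMl//.
by have := incr r (h + r) r2; rewrite ltrDr addrK => /(_ hp); move=> /(_ _)/le_trans; apply; lra.
Qed.

(** ** The entropy coefficient *)
Definition cG (t : R) : R := - PS P (f t) t * derive1 f t / t.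

Lemma coefGE r : 0 <= r < Rd -> coefG P f rho r = cG (rho r).
Proof. by move=> rR; rewrite /coefG /cG (dfE rho0b Hf)// (rho_range0 HE). Qed.

Lemma cG_continuous (t : R) : 0 < t < b -> {for t, continuous cG}.
Proof.
move=> tb; have /andP[t0 _] := tb.
have c1 := graph_continuous (F := PS P) Hf tb (PS_continuous HP t0).
have c2 : {for t, continuous (fun t : R => t^-1)}.
  by apply: inv_continuous; rewrite gt_eqF.
exact: (cvgM (cvgM (cvgN c1) (df_continuous Hf tb)) c2).
Qed.

Lemma coefG_continuous (r : R) : 0 < r < Rd -> {for r, continuous (coefG P f rho)}.
Proof.
move=> rR; apply: (@continuous_near _ (cG \o rho)).
  near=> s; rewrite /= coefGE//; apply: in_I'; near: s.
  by apply: open_nbhs_nbhs; split; [exact: interval_open|rewrite /= in_itv].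
apply: continuous_comp; first exact: rho_continuous HE _ rR.
by apply/cG_continuous/(rho_range HE rho0b); have /andP[/ltW -> ->] := rR.
Unshelve. all: by end_near. Qed.

Lemma measurable_coefG : measurable_fun I (coefG P f rho).
Proof. by apply: measurable_continuous => r; exact: coefG_continuous. Qed.

(** Near the surface the vacuum bound applies, and elsewhere the coefficient is a
    continuous function on a compact interval. *)
Lemma coefG_bounded : exists C, forall r, 0 < r < Rd -> `|coefG P f rho r| <= C.
Proof.
have [C [e /= e0 he]] := Es_G_bdry HE.
pose r1 := Num.max 0 (Rd - e / 2).
have r10 : 0 <= r1 by rewrite le_max lexx.
have r1R : r1 < Rd by rewrite gt_max Rd0/= ltrBlDr ltrDl divr_gt0.
have c1 : {within `[0, r1]%classic, continuous (fun r => `|(cG \o rho) r|)}.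
  rewrite continuous_subspace_in => r; rewrite inE => rI.
  have cr : {within `[0, r1]%classic, continuous rho}.
    apply: continuous_subspaceW (rho_within HE); apply: subset_itvl.
    by rewrite bnd_simp ltW.
  suff c : cG (rho s) @[s --> (r : subspace `[0, r1])] --> cG (rho r) by exact: (cvg_norm c).
  apply: (continuous_comp (cr r)); apply/cG_continuous/(rho_range HE rho0b).
  move: rI; rewrite /= in_itv/= => /andP[-> rr1]; exact: le_lt_trans rr1 r1R.
have [z zI hz] := EVT_max r10 c1.
pose M := `|C| * (rho 0) `^ (g0 - 1).
exists (`|cG (rho z)| + M) => r rR; have /andP[r0 rR'] := rR.
have M0 : 0 <= M by rewrite mulr_ge0// powR_ge0.
have [rr|rr] := leP r r1.
  have rI : r \in `[0, r1] by rewrite in_itv/= ltW.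
  have rR2 : 0 <= r < Rd by rewrite (ltW r0).
  by rewrite (coefGE rR2); apply: (le_trans (hz r rI)); rewrite lerDl.
have /andP[p0 p1] : 0 < coefG P f rho r <= C * rho r `^ (g0 - 1).
  apply: he => //=; rewrite gtr0_norm ?subr_gt0//.
  by move: rr; rewrite /r1 gt_max => /andP[_]; lra.
rewrite gtr0_norm//; apply: (le_trans p1); apply: (@le_trans _ _ M); last by rewrite lerDr.
have /andP[t0 t1] : 0 < rho r <= rho 0 by apply: (rho_range0 HE); rewrite ltW.
apply: ler_pM => //; rewrite ?powR_ge0//.
- have : 0 < C * rho r `^ (g0 - 1) by exact: lt_le_trans p0 p1.
  by rewrite pmulr_lgt0 ?powR_gt0// => /ltW.
- exact: ler_norm.
- have g01 : 0 <= g0 - 1 by have /andP[h _] := P_gamma HP; lra.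
  apply: (ge0_ler_powR g01 _ _ t1); rewrite nnegrE; first exact: ltW.
  exact: le_trans (ltW t0) t1.
Qed.

Lemma coefG_ae : {ae leb, forall s, I s -> 0 < coefG P f rho s}.
Proof. by apply: ae_imp (Es_G_gt0 HE) => s h /in_I; exact: h. Qed.

End StarForms.

(** * The mass enclosed in a ball *)
Section Enclosed.
Context {R : realType}.
Local Notation leb := (@lebesgue_measure R).
Variables (Rd : R).
Hypothesis Rd0 : 0 < Rd.
Local Notation I := (`]0, Rd[%classic : set R).

Let mI : measurable (I : set (measurableTypeR R)). Proof. by []. Qed.

Lemma ae_dense (Q : R -> Prop) (r u : R) : {ae leb, forall s, I s -> Q s} ->
  0 <= r -> r < u -> u <= Rd -> exists s, r < s < u /\ Q s.
Proof.
move=> aeQ r0 ru uR; apply: contrapT => hn.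
have : leb.-negligible `]r, u[%classic.
  apply: negligibleS aeQ => s /=; rewrite in_itv/= => /andP[rs su] hs.
  apply: hn; exists s; rewrite rs su; split => //; apply: hs.
  by rewrite /= in_itv/= (le_lt_trans r0 rs) (lt_le_trans su uR).
move=> n; have : leb `]r, u[%classic = 0%E by exact: measure_negligible.
move/eqP; rewrite lebesgue_measure_itv/= lte_fin ru.
by rewrite -EFinB eqe subr_eq0 gt_eqF.
Qed.

Lemma norm_Rintegral_le (D : set R) (g : R -> R) (B : R) :
  measurable (D : set (measurableTypeR R)) -> (leb D < +oo)%E ->
  leb.-integrable D (EFin \o g) -> (forall s, D s -> `|g s| <= B) ->
  `|\int[leb]_(s in D) g s| <= B * fine (leb D).
Proof.
move=> mD fD ig gB; apply: (le_trans (le_normr_Rintegral mD ig)).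
rewrite -(Rintegral_cst _ mD); apply: le_Rintegral => //.
  exact: integrable_norm.
by apply: measurable_bounded_integrable => //; exact: bounded_cst.
Qed.

Definition enclosed (eta : R -> R) (r : R) : R :=
  \int[leb]_(s in `[0, r]) (s ^+ 2 * eta s).

Section Fixed.
Variable eta : R -> R.
Hypothesis ie : leb.-integrable I (fun s => (s ^+ 2 * eta s)%:E).
Let h : R -> R := (fun s => s ^+ 2 * eta s) \_ I.

Let hE (s : R) : 0 <= s < Rd -> h s = s ^+ 2 * eta s.
Proof.
move=> /andP[s0 sR]; rewrite /h patchE; case: ifPn => //.
move: s0; rewrite le_eqVlt => /orP[/eqP <-|s0]; first by rewrite expr0n/= mul0r.
by rewrite notin_setE /= in_itv/= s0 sR => /(_ isT).
Qed.

Let ih (D : set R) : measurable (D : set (measurableTypeR R)) ->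
  leb.-integrable D (EFin \o h).
Proof.
move=> mD; apply: (@integrableS _ _ _ leb setT D) => //.
have := (integrable_mkcond _ mI).1 ie; apply: eq_integrable => // s _.
by rewrite /= /h !patchE; case: ifP.
Qed.

Let enc_h (r : R) : r < Rd -> enclosed eta r = \int[leb]_(s in `[0, r]) h s.
Proof.
move=> rR; apply: eq_Rintegral => s; rewrite inE/= in_itv/= => /andP[s0 sr].
by rewrite hE// s0 (le_lt_trans sr rR).
Qed.

Let enc_sub (r u : R) : 0 <= r -> r <= u -> u < Rd ->
  enclosed eta u - enclosed eta r = \int[leb]_(s in `]r, u]) h s.
Proof.
move=> r0 ru uR; rewrite !enc_h ?(le_lt_trans ru uR)//.
apply: (@Rintegral_itvB _ h (BLeft 0) (BRight u) r); first exact: ih.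
  by rewrite bnd_simp.
by rewrite bnd_simp.
Qed.

Lemma enclosed0 : enclosed eta 0 = 0.
Proof. by rewrite /enclosed set_itv1 Rintegral_set1. Qed.

Lemma enclosed_lipschitz (r u B : R) : 0 <= r -> r <= u -> u < Rd ->
  (forall s, r < s <= u -> `|s ^+ 2 * eta s| <= B) ->
  `|enclosed eta u - enclosed eta r| <= B * (u - r).
Proof.
move=> r0 ru uR hB; rewrite enc_sub//.
have l : fine (leb `]r, u]%classic) = u - r.
  rewrite lebesgue_measure_itv/= lte_fin; case: ltP => [//|ur] /=.
  by apply/eqP; rewrite eq_sym subr_eq0 eq_le ru ur.
rewrite -l; apply: norm_Rintegral_le => //; last 2 first.
- exact: ih.
- move=> s; rewrite /= in_itv/= => /andP[rs su]; rewrite hE ?hB ?rs//.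
  by rewrite (le_trans r0 (ltW rs)) (le_lt_trans su uR).
by rewrite lebesgue_measure_itv/= lte_fin; case: ifP => _; rewrite ?ltry// -EFinB ltry.
Qed.

Lemma enclosed_tail (r B : R) : 0 <= r < Rd ->
  \int[leb]_(s in I) (s ^+ 2 * eta s) = 0 ->
  (forall s, r < s < Rd -> `|s ^+ 2 * eta s| <= B) ->
  `|enclosed eta r| <= B * (Rd - r).
Proof.
move=> /andP[r0 rR] z hB.
have l : fine (leb `]r, Rd[%classic) = Rd - r.
  by rewrite lebesgue_measure_itv/= lte_fin rR.
have e : - enclosed eta r = \int[leb]_(s in `]r, Rd[) h s.
  rewrite enc_h// -(@Rintegral_itvB _ h (BLeft 0) (BLeft Rd) r); last 3 first.
  - exact: ih.
  - by rewrite bnd_simp.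
  - by rewrite bnd_simp.
  rewrite -(@Rintegral_itv_obnd_cbnd _ 0 (BLeft Rd)); last exact: ih.
  have -> : \int[leb]_(s in I) h s = 0.
    transitivity (\int[leb]_(s in I) (s ^+ 2 * eta s)) => //.
    by apply: eq_Rintegral => s sI; rewrite /h patchE sI.
  by rewrite sub0r.
rewrite -normrN e -l; apply: norm_Rintegral_le => //; last 2 first.
- exact: ih.
- move=> s; rewrite /= in_itv/= => /andP[rs su]; rewrite hE ?hB ?rs//.
  by rewrite (le_trans r0 (ltW rs)).
by rewrite lebesgue_measure_itv/= lte_fin; case: ifP => _; rewrite ?ltry// -EFinB ltry.
Qed.

Let near_I (r : R) : 0 < r < Rd -> \forall s \near r, 0 < s < Rd.
Proof.
move=> rR; have : nbhs r I.
  by apply: open_nbhs_nbhs; split; [exact: interval_open|rewrite /= in_itv].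
by apply: filterS => s; rewrite /= in_itv.
Qed.

Lemma enclosed_derive (r : R) : 0 < r < Rd -> {for r, continuous eta} ->
  is_derive r 1 (enclosed eta) (r ^+ 2 * eta r).
Proof.
move=> rR ce; have nI := near_I rR; have /andP[r0 rR'] := rR.
have ru : r < (r + Rd) / 2 by lra.
have ch : {for r, continuous h}.
  apply: (@continuous_near _ (fun s => s ^+ 2 * eta s)).
    by apply: filterS nI => s /andP[s0 sR]; rewrite hE// ltW.
  by apply: cvgM => //; exact: exprn_continuous.
have [|//|d e] := @continuous_FTC1 R h (BLeft 0) r _ ru (ih (measurable_itv _)).
  by rewrite lte_fin.
have rI : 0 <= r < Rd by rewrite (ltW r0).
rewrite -(hE rI) -e.
set F := fun x : R => \int[leb]_(t in `[0, x]) h t.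
have dF : is_derive r 1 F (derive1 F r) by rewrite derive1E; exact: DeriveDef.
apply: near_eq_is_derive dF.
by apply: filterS nI => s /andP[_ sR]; rewrite enc_h.
Qed.

Lemma measurable_enclosed : measurable_fun I (enclosed eta).
Proof.
apply: measurable_continuous => r rR; have nI := near_I rR.
apply: (@continuous_near _ (fun x => \int[leb]_(t in `[0, x]) h t)).
  by apply: filterS nI => s /andP[_ sR]; rewrite enc_h.
have := parameterized_integral_continuous (ltW Rd0) (ih (measurable_itv _)).
by move=> /(continuous_within_itvP _ Rd0)[c _ _]; apply: c; rewrite in_itv.
Qed.
End Fixed.

Lemma MVT_interior (g dg : R -> R) (r u : R) : r < u ->
  (forall x : R, r <= x <= u -> is_derive x 1 g (dg x)) ->
  exists2 c, r < c < u & g u - g r = dg c * (u - r).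
Proof.
move=> ru hg; have [||c] := @MVT _ g dg r u ru.
- by move=> x; rewrite in_itv/= => /andP[? ?]; apply: hg; rewrite !ltW.
- apply: derivable_within_continuous => x; rewrite in_itv/= => xI.
  exact: (@ex_derive _ _ _ _ _ _ _ (hg x xI)).
- by rewrite in_itv/= => cI e; exists c.
Qed.
End Enclosed.

(** * The entropy part of the second variation *)
Section Gap.
Context {R : realType}.
Local Notation leb := (@lebesgue_measure R).
Variables (P : R -> R -> R) (f : R -> R) (g0 al0 : R) (rho : R -> R) (Rd b : R).
Hypothesis HP : hypP P g0 al0.
Hypothesis HE : hypEs P f rho Rd g0 al0.
Hypothesis rho0b : rho 0 < b.
Hypothesis Hf : Ck_on `[0, b]%classic 1 f.
Local Notation I := (`]0, Rd[%classic : set R).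
Local Notation w := (weight1 P f rho).
Local Notation X := (X1rad P f rho Rd).
Local Notation U := (shell_potential Rd).
Local Notation L := (Lform P f rho Rd).
Local Notation T := (Top rho).
Local Notation G := (coefG P f rho).

Let Rd0 : 0 < Rd. Proof. exact: Es_radius HE. Qed.
Let mI : measurable (I : set (measurableTypeR R)). Proof. by []. Qed.
Let in_I s : I s -> 0 < s < Rd. Proof. by rewrite /= in_itv. Qed.
Let near_I (r : R) : 0 < r < Rd -> \forall s \near r, 0 < s < Rd.
Proof.
move=> rR; have : nbhs r I.
  by apply: open_nbhs_nbhs; split; [exact: interval_open|rewrite /= in_itv].
by apply: filterS => s; rewrite /= in_itv.
Qed.

Lemma X_integrable eta : X eta -> leb.-integrable I (fun s => (s ^+ 2 * eta s)%:E).
Proof. by move=> /(X_L2ball HP HE rho0b Hf)/(L2ball_integrable2 Rd0). Qed.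

Lemma TopE eta (r : R) : 0 < r < Rd ->
  T eta r = derive1 rho r / (r ^+ 2 * rho r) * enclosed eta r.
Proof.
move=> /andP[r0 rR]; rewrite /Top /Imass -/(enclosed eta r).
have p : rho r != 0 by rewrite gt_eqF//; apply: (rho_gt0 HE); rewrite ltW.
have q : pi != 0 :> R by rewrite gt_eqF// pi_gt0.
have key (x y z t : R) : t != 0 -> y != 0 -> x / (t * y) * (t * z) = x / y * z.
  by move=> *; field; apply/andP.
have q4 : 4 * pi != 0 :> R by rewrite mulf_neq0.
have yn : r ^+ 2 * rho r != 0 by rewrite mulf_neq0// expf_neq0// gt_eqF.
by rewrite -(key (derive1 rho r) _ (enclosed eta r) _ q4 yn) (mulrA (4 * pi)).
Qed.

Lemma Top_factor_continuous (r : R) : 0 < r < Rd ->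
  {for r, continuous (fun r : R => derive1 rho r / (r ^+ 2 * rho r))}.
Proof.
move=> rR; have /andP[r0 rR'] := rR.
have p : 0 < rho r by apply: (rho_gt0 HE); rewrite ltW.
have c1 := drho_continuous HE rR; have c2 := rho_continuous HE rR.
have c3 := @exprn_continuous R 2 r.
have c4 : {for r, continuous (fun r : R => (r ^+ 2 * rho r)^-1)}.
  by apply: cvgV; [rewrite mulf_neq0 ?expf_neq0 ?gt_eqF|exact: cvgM c3 c2].
exact: cvgM c1 c4.
Qed.

Lemma measurable_Top eta : leb.-integrable I (fun s => (s ^+ 2 * eta s)%:E) ->
  measurable_fun I (T eta).
Proof.
move=> ie; apply: (@eq_measurable_fun _ _ _ _ _ (fun r => derive1 rho r / (r ^+ 2 * rho r) * enclosed eta r)).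
  by move=> s; rewrite inE => /in_I sI; rewrite TopE.
apply: measurable_funM; last exact: measurable_enclosed.
by apply: measurable_continuous => r; exact: Top_factor_continuous.
Qed.

Lemma QformE eta xi : X eta -> X xi -> Qform P f rho Rd eta xi = L eta xi +
  4 * pi * \int[leb]_(s in I) (s ^+ 2 * (G s * (eta - T eta) s * (xi - T xi) s)).
Proof.
move=> Xe Xx; rewrite /Qform; congr (_ + _).
have m e : X e -> measurable_fun I (e - T e).
  move=> Xe'; apply: measurable_funB; first exact: (X_measurable HP HE rho0b Hf).
  by apply: measurable_Top; exact: X_integrable.
apply: (@Rintegral_radial_ball _ _ Rd0 (fun s => G s * (eta - T eta) s * (xi - T xi) s)).
apply: measurable_funM; [apply: measurable_funM|]; try exact: m.
exact: measurable_coefG HP HE rho0b Hf.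
Qed.

(** A negative value would persist on an interval, by continuity, against
    positivity almost everywhere. *)
Lemma coefG_ge0 (r : R) : 0 <= r < Rd -> 0 <= G r.
Proof.
move=> rR; have /andP[r0 rR'] := rR; rewrite leNgt; apply/negP => Gr.
have rI : `[0, Rd]%classic r by rewrite /= in_itv/= r0 ltW.
have cr : rho @ within `[0, Rd]%classic (nbhs r) --> rho r.
  have cw : {within `[0, Rd]%classic, continuous rho} := rho_within HE.
  by have := cw r; rewrite /continuous_at /= nbhs_subspace_in.
have cg : {for rho r, continuous (cG P f)} by apply/(cG_continuous HP Hf)/(rho_range HE rho0b).
have [|e /= e0 he] := cvgr_lt _ (cvg_comp _ _ cr cg) (0 : R).
  by rewrite -(coefGE HE rho0b Hf).
have ru : r < Num.min (r + e) Rd by rewrite lt_min ltrDl e0.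
have uR : Num.min (r + e) Rd <= Rd by rewrite ge_min lexx orbT.
have [s [/andP[rs su] hs]] := ae_dense (coefG_ae HE) r0 ru uR.
move: su; rewrite lt_min => /andP[su sR].
have := he s; rewrite /= ltr0_norm ?subr_lt0// opprB ltrBlDl => /(_ su).
have s0 : 0 <= s by rewrite (le_trans r0 (ltW rs)).
rewrite in_itv/= s0 (ltW sR) => /(_ isT).
by rewrite -(coefGE HE rho0b Hf) ?s0// ltNge (ltW hs).
Qed.

Lemma Qform_ge_Lform eta : Lform P f rho Rd eta eta <= Qform P f rho Rd eta eta.
Proof.
rewrite /Qform lerDl; apply: Rintegral_ge0 => x xR.
rewrite -mulrA; apply: mulr_ge0; last by rewrite -expr2 sqr_ge0.
by apply: coefG_ge0; rewrite enorm_ge0.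
Qed.

(** A solution of the linearized equilibrium equation with zero total mass. *)
Variables (v : R -> R) (C : R).
Hypothesis Xv : X v.
Hypothesis hC : forall r : R, 0 < r < Rd -> w r * v r - 4 * pi * U v r = C.
Hypothesis vz : \int[leb]_(s in I) (s ^+ 2 * v s) = 0.
Hypothesis cv : forall u : R, 0 < u < Rd -> {within `[0, u]%classic, continuous v}.
Hypothesis v0 : v 0 != 0.
Local Notation J := (enclosed v).
Local Notation drho := (derive1 rho).
Let iv := X_integrable Xv.

Let cvr (r : R) : 0 < r < Rd -> {for r, continuous v}.
Proof.
move=> /andP[r0 rR]; have uR : 0 < (r + Rd) / 2 < Rd by apply/andP; split; lra.
apply: continuous_of_within (cv uR).
apply: (@filterS _ _ _ `]0, (r + Rd) / 2[%classic).
  by move=> s /=; rewrite !in_itv/= => /andP[? ?]; rewrite !ltW.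
by apply: open_nbhs_nbhs; split; [exact: interval_open|rewrite /= in_itv/= r0/=; lra].
Qed.

Let J_derive (r : R) : 0 < r < Rd -> is_derive r 1 J (r ^+ 2 * v r).
Proof. by move=> rR; exact: (@enclosed_derive _ Rd v iv r rR (cvr rR)). Qed.

(** Near the surface [v] is controlled by the density gradient, because the
    gravitational field does not vanish there. *)
Let v_surface : exists2 A : R, 0 < A & forall r : R, Rd / 2 <= r < Rd -> `|v r| <= A * - drho r.
Proof.
have [c c0 hc] := field_lower HP HE rho0b Hf.
have Fv := X_L2ball HP HE rho0b Hf Xv.
pose M := `|C| + 4 * pi * `|shell_bound Rd v|.
have p4 : 0 <= 4 * pi :> R by rewrite mulr_ge0// pi_ge0.
have M0 : 0 <= M by rewrite addr_ge0// mulr_ge0.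
exists ((M + 1) / c); first by rewrite divr_gt0// ltr_wpDl.
move=> r rR; have R0 := Rd0; have rR' : 0 < r < Rd by case/andP: rR => ? ?; apply/andP; split; lra.
have rR0 : 0 <= r < Rd by case/andP: rR' => /ltW -> ->.
have w0 := weight1_gt0 HE rho0b rR0.
have h1 : w r * `|v r| <= M.
  have -> : w r * `|v r| = `|C + 4 * pi * U v r|.
    by rewrite -(hC rR') subrK normrM gtr0_norm.
  apply: (le_trans (ler_normD _ _)); rewrite lerD2l normrM (ger0_norm p4) ler_wpM2l//.
  by apply: (le_trans (shell_potential_bounded Rd0 r Fv)); exact: ler_norm.
have h2 := hc r rR.
rewrite -(ler_pM2l w0) [leRHS](_ : _ = (M + 1) * - (w r * drho r) / c); last by ring.
rewrite ler_pdivlMr//.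
apply: ler_pM; [by rewrite mulr_ge0// ltW|exact: ltW|by lra|].
by lra.
Qed.

Let v_center : exists2 M : R, 0 < M & forall r : R, 0 <= r <= Rd / 2 -> `|v r| <= M.
Proof.
have R0 := Rd0; have R2 : 0 < Rd / 2 < Rd by apply/andP; split; lra.
have c1 : {within `[0, Rd / 2]%classic, continuous (fun r => `|v r|)}.
  move=> x; suff h : v s @[s --> (x : subspace `[0, Rd / 2]%classic)] --> v x.
    exact: (cvg_norm h).
  exact: (cv R2).
have [|z zI hz] := EVT_max _ c1; first by lra.
exists (`|v z| + 1) => [|r rR]; first by rewrite ltr_wpDl.
by apply: (le_trans (hz r _)); [rewrite in_itv|rewrite lerDl].
Qed.

Let J_center : exists2 M : R, 0 < M & forall r : R, 0 < r <= Rd / 2 -> `|J r| <= M * r ^+ 3.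
Proof.
have [M M0 hM] := v_center; exists M => // r /andP[r0 rR]; have R0 := Rd0.
have rR' : r < Rd by lra.
have := @enclosed_lipschitz _ Rd v iv 0 r (r ^+ 2 * M) (lexx _) (ltW r0) rR'.
rewrite enclosed0 !subr0 (_ : r ^+ 2 * M * r = M * r ^+ 3); last by ring.
apply=> s /andP[s0 sr]; rewrite normrM ger0_norm ?sqr_ge0//.
apply: ler_pM => //; first exact: sqr_ge0.
  by apply: lerXn2r; rewrite ?nnegrE// ltW// (lt_le_trans s0).
by apply: hM; rewrite (ltW s0) (le_trans sr).
Qed.

(** [K * rho + J] and [K * rho - J] decrease near the surface and tend to zero
    there, because the total mass of [v] is zero. *)
Let J_surface : exists2 K : R, 0 < K & forall r : R, Rd / 2 <= r < Rd -> `|J r| <= K * rho r.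
Proof.
have [A A0 hA] := v_surface; have [D D0 hD] := drho_bounded HE; have R0 := Rd0.
pose K := Rd ^+ 2 * A; have K0 : 0 < K by rewrite mulr_gt0// exprn_gt0.
have hv (r : R) : Rd / 2 <= r < Rd -> `|r ^+ 2 * v r| <= K * - drho r.
  move=> rR; have /andP[r1 r2] := rR; rewrite normrM ger0_norm ?sqr_ge0// /K -mulrA.
  apply: ler_pM => //; [exact: sqr_ge0| |exact: hA].
  by apply: lerXn2r; rewrite ?nnegrE; lra.
have hB (r : R) : Rd / 2 <= r < Rd -> `|r ^+ 2 * v r| <= K * D.
  move=> rR; apply: (le_trans (hv r rR)); rewrite ler_pM2l//.
  have rR' : 0 < r < Rd by case/andP: rR => ? ?; apply/andP; split; lra.
  by apply: le_trans (hD r rR'); rewrite -normrN; exact: ler_norm.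
have KD : 0 < K * D by rewrite mulr_gt0.
suff key (sg : R) : (sg = 1) \/ (sg = -1) -> forall r : R, Rd / 2 <= r < Rd -> 0 <= K * rho r + sg * J r.
  exists K => // r rR; rewrite ler_norml.
  have h1 := key 1 (or_introl erefl) r rR; have h2 := key (-1) (or_intror erefl) r rR.
  by apply/andP; split; lra.
move=> hsg r rR; have /andP[r1 r2] := rR; have r0 : 0 <= r by lra.
have nsg x : `|sg * x| = `|x| by case: hsg => ->; rewrite ?mul1r// mulN1r normrN.
rewrite leNgt; apply/negP; set g := fun r => K * rho r + sg * J r; rewrite -/(g r) => gr.
pose e := - g r; have e0 : 0 < e by rewrite oppr_gt0.
pose d := Num.min ((Rd - r) / 2) (e / (2 * (K * D))).
have d0 : 0 < d by rewrite lt_min !divr_gt0 ?mulr_gt0// subr_gt0.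
have d1 : d <= (Rd - r) / 2 by rewrite ge_min lexx.
have d2 : K * D * d <= e / 2.
  have : d <= e / (2 * (K * D)) by rewrite ge_min lexx orbT.
  rewrite ler_pdivlMr ?mulr_gt0//; lra.
pose u := Rd - d; have ru : r < u by rewrite /u; lra.
have uR : u < Rd by rewrite /u; lra.
have uR' : 0 <= u < Rd by apply/andP; split; lra.
have gu : - (e / 2) <= g u.
  have t : `|J u| <= K * D * (Rd - u).
    apply: (@enclosed_tail _ Rd v iv u _ uR' vz) => s /andP[us sR].
    by apply: hB; apply/andP; split; lra.
  have : `|sg * J u| <= e / 2 by rewrite nsg; apply: (le_trans t); rewrite /u; lra.
  rewrite ler_norml => /andP[t1 _].
  have : 0 < K * rho u by rewrite mulr_gt0//; exact: rho_gt0 HE _ uR'.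
  by rewrite /g; lra.
have dg x : r <= x <= u -> is_derive x 1 g (K * drho x + sg * (x ^+ 2 * v x)).
  move=> /andP[rx xu]; have xR : 0 < x < Rd by apply/andP; split; lra.
  have dr := rho_derive HE xR; have dJ := J_derive xR.
  exact: is_deriveD.
have [c /andP[rc cu] eq] := MVT_interior ru dg.
have cR : Rd / 2 <= c < Rd by apply/andP; split; lra.
have : K * drho c + sg * (c ^+ 2 * v c) <= 0.
  have := hv c cR; rewrite -(nsg (c ^+ 2 * v c)) ler_norml => /andP[_]; lra.
rewrite -(ler_pM2r (_ : 0 < u - r)) ?subr_gt0// -eq mul0r.
by rewrite /e in gu; lra.
Qed.

Let d r := (v - T v) r.

Let dE (r : R) : 0 < r < Rd -> d r = v r - drho r / (r ^+ 2 * rho r) * J r.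
Proof. by move=> rR; rewrite /d -TopE. Qed.

Let d_bounded : exists2 B : R, 0 < B & forall r : R, 0 < r < Rd -> `|d r| <= B.
Proof.
have [A A0 hA] := v_surface; have [D D0 hD] := drho_bounded HE; have R0 := Rd0.
have [M M0 hM] := v_center; have [M' M'0 hJ] := J_center; have [K K0 hK] := J_surface.
have rh0 : 0 < rho (Rd / 2) by apply: (rho_gt0 HE); apply/andP; split; lra.
pose B1 := M + D * (M' * Rd / rho (Rd / 2)).
pose B2 := A * D + D * (K * (4 / Rd ^+ 2)).
have B10 : 0 < B1 by rewrite addr_gt0// !mulr_gt0// invr_gt0.
have B20 : 0 < B2 by rewrite addr_gt0 ?mulr_gt0 ?invr_gt0 ?exprn_gt0.
exists (B1 + B2) => [|r rR]; first exact: addr_gt0.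
have /andP[r0 rR'] := rR.
have rh : 0 < rho r by apply: (rho_gt0 HE); rewrite ltW.
have D1 := hD r rR.
have dr0 : 0 < r ^+ 2 * rho r by rewrite mulr_gt0// exprn_gt0.
have split (B B' : R) : `|v r| <= B -> `|J r| <= B' * (r ^+ 2 * rho r) -> 
    `|d r| <= B + D * B'.
  move=> h1 h2; rewrite dE//; apply: (le_trans (ler_normB _ _)); apply: lerD => //.
  rewrite -mulrA normrM; apply: ler_pM => //.
  by rewrite normrM normfV (gtr0_norm dr0) mulrC ler_pdivrMr.
have [r2|r2] := leP r (Rd / 2).
  apply: (@le_trans _ _ B1); last by rewrite lerDl ltW.
  apply: split; first by apply: hM; rewrite ltW.
  apply: (le_trans (hJ r _)); first by rewrite r0.
  have -> : M' * Rd / rho (Rd / 2) * (r ^+ 2 * rho r) =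
            M' * r ^+ 2 * (Rd * (rho r / rho (Rd / 2))) by ring.
  have -> : M' * r ^+ 3 = M' * r ^+ 2 * r by ring.
  rewrite ler_pM2l ?mulr_gt0 ?exprn_gt0//.
  have : 1 <= rho r / rho (Rd / 2).
    rewrite ler_pdivlMr// mul1r; move: r2; rewrite le_eqVlt => /orP[/eqP->//|r2].
    by apply/ltW/(rho_decr HE) => //; lra.
  move=> q; apply: (@le_trans _ _ Rd); first exact: ltW.
  by rewrite ler_peMr// ltW.
have rR2 : Rd / 2 <= r < Rd by rewrite (ltW r2).
apply: (@le_trans _ _ B2); last by rewrite lerDr ltW.
apply: split.
  apply: (le_trans (hA r rR2)); rewrite ler_pM2l//.
  by apply: le_trans D1; rewrite -normrN; exact: ler_norm.
apply: (le_trans (hK r rR2)); rewrite -mulrA ler_pM2l// mulrA ler_pMl//.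
by rewrite mulrAC ler_pdivlMr ?exprn_gt0// mul1r; nra.
Qed.

Let d_continuous (r : R) : 0 < r < Rd -> {for r, continuous d}.
Proof.
move=> rR; apply: (@continuous_near _ (fun r => v r - drho r / (r ^+ 2 * rho r) * J r)).
  by apply: filterS (near_I rR) => s sR; rewrite dE.
have c1 := cvr rR; have c2 := Top_factor_continuous rR.
have c3 := is_derive_continuous (J_derive rR).
exact: (cvgB c1 (cvgM c2 c3)).
Qed.

(** [v = T v] would force the enclosed mass to be proportional to the density,
    whereas the enclosed mass vanishes at the center. *)
Let d_nonzero : ~ forall r : R, 0 < r < Rd -> d r = 0.
Proof.
move=> hd; have R0 := Rd0; have [M M0 hJ] := J_center.
have rh0 : 0 < rho (Rd / 2) by apply: (rho_gt0 HE); apply/andP; split; lra.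
have rhp (r : R) : 0 < r < Rd -> 0 < rho r.
  by move=> /andP[r0 rR]; apply: (rho_gt0 HE); rewrite ltW.
have vE (r : R) : 0 < r < Rd -> v r = drho r / (r ^+ 2 * rho r) * J r.
  by move=> rR; apply/eqP; rewrite -subr_eq0 -dE// hd.
pose q r := J r * (rho r)^-1.
have dq (x : R) : 0 < x < Rd -> is_derive x 1 q 0.
  move=> xR; have dr := rho_derive HE xR; have dJ := J_derive xR.
  have px := rhp x xR; have rn : rho x != 0 by rewrite gt_eqF.
  have /andP[x0 _] := xR; have xn : x != 0 by rewrite gt_eqF.
  have dV := is_deriveV rn dr.
  have dM := is_deriveM dJ dV.
suff e0 : J x *: (- (rho x) ^- 2 *: drho x) + (rho x)^-1 *: (x ^+ 2 * v x) = 0 :> R.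
  by rewrite -e0; exact: dM.
rewrite /GRing.scale/= (vE x xR).
  by field; rewrite rn xn.
have qc (r : R) : 0 < r < Rd / 2 -> q r = q (Rd / 2).
  move=> /andP[r0 r2]; have [|c _] := @MVT_interior _ q (fun _ => 0) r (Rd / 2) r2.
    by move=> x /andP[rx xR]; apply: dq; apply/andP; split; lra.
  by rewrite mul0r => /eqP; rewrite subr_eq0 => /eqP.
have k0 : q (Rd / 2) = 0.
  apply/eqP; apply: contraT => kn; set k := q (Rd / 2) in qc kn.
  have kp : 0 < `|k| by rewrite normr_gt0.
  pose r := Num.min (Rd / 4) (`|k| * rho (Rd / 2) / (2 * (M * Rd ^+ 2))).
  have den : 0 < 2 * (M * Rd ^+ 2) by rewrite !mulr_gt0// exprn_gt0.
  have r0 : 0 < r by rewrite lt_min !divr_gt0// mulr_gt0.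
  have r1 : r <= Rd / 4 by rewrite ge_min lexx.
  have r2 : r * (2 * (M * Rd ^+ 2)) <= `|k| * rho (Rd / 2).
    by rewrite -ler_pdivlMr// ge_min lexx orbT.
  have rR : 0 < r < Rd by apply/andP; split; lra.
  have rp := rhp r rR.
  have Jr : `|J r| = `|k| * rho r.
    have <- : q r = k by apply: qc; apply/andP; split; lra.
    by rewrite /q normrM normfV (gtr0_norm rp) mulfVK ?gt_eqF.
  have h1 : `|J r| <= M * r ^+ 3 by apply: hJ; apply/andP; split; lra.
  have h2 : rho (Rd / 2) <= rho r by apply/ltW/(rho_decr HE); lra.
  have h3 : `|k| * rho (Rd / 2) <= M * r ^+ 3.
    by apply: le_trans h1; rewrite Jr ler_pM2l.
  have h4 : M * r ^+ 3 <= r * (M * Rd ^+ 2).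
    have -> : M * r ^+ 3 = r * (M * r ^+ 2) by ring.
    by rewrite !ler_pM2l//; apply: lerXn2r; rewrite ?nnegrE; lra.
  have h5 : 0 < r * (M * Rd ^+ 2) by rewrite !mulr_gt0// exprn_gt0.
  have : r * (2 * (M * Rd ^+ 2)) = 2 * (r * (M * Rd ^+ 2)) by ring.
  by move=> h6; rewrite h6 in r2; lra.
have vr0 (r : R) : 0 < r < Rd / 2 -> v r = 0.
  move=> rR; have rR' : 0 < r < Rd by case/andP: rR => ? ?; apply/andP; split; lra.
  rewrite vE//; have := qc r rR; rewrite k0 /q => /eqP.
  by rewrite mulf_eq0 invr_eq0 (gt_eqF (rhp r rR')) orbF => /eqP ->; rewrite mulr0.
have R2 : 0 < Rd / 2 < Rd by apply/andP; split; lra.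
have /andP[R20 _] := R2.
have /(continuous_within_itvP _ R20)[_ + _] := cv R2 => cv0.
have cz : v x @[x --> 0^'+] --> (0 : R).
  apply: (@cvg_trans _ ((fun=> 0 : R) x @[x --> (0:R)^'+])); last exact: cvg_cst.
  have p1 : \forall x \near (0 : R)^'+, 0 < x by exact: nbhs_right_gt.
  have p2 : \forall x \near (0 : R)^'+, x < Rd / 2 by exact: nbhs_right_lt.
  by apply: near_eq_cvg; apply: filterS2 p1 p2 => x h1 h2; rewrite vr0// h1.
by move/eqP: v0; apply; exact: (cvg_unique _ cv0 cz).
Qed.

(** The bounds on [v], on the enclosed mass and on [G] make the integral finite,
    so that if it vanished [v - T v] would vanish almost everywhere, hence
    everywhere by continuity. *)
Lemma entropy_gap : 0 < \int[leb]_(s in I) (s ^+ 2 * (G s * d s * d s)).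
Proof.
have [B B0 hB] := d_bounded; have [CG hCG] := coefG_bounded HP HE rho0b Hf.
have R0 := Rd0.
pose F s := s ^+ 2 * (G s * d s * d s).
have F0 (s : R) : 0 < s < Rd -> 0 <= F s.
  move=> /andP[s0 sR]; apply: mulr_ge0; first exact: sqr_ge0.
  rewrite -mulrA; apply: mulr_ge0; last by rewrite -expr2 sqr_ge0.
  by apply: coefG_ge0; rewrite ltW.
have md : measurable_fun I d by apply: measurable_continuous => r; exact: d_continuous.
have mF : measurable_fun I F.
  apply: measurable_funM; first by apply: measurable_funX.
  apply: measurable_funM => //; apply: measurable_funM => //.
  exact: measurable_coefG HP HE rho0b Hf.
have iF : leb.-integrable I (EFin \o F).
  apply: (@integrable_bounded_I _ _ Rd0 _ (Rd ^+ 2 * (`|CG| * B * B)) mF) => s /in_I sI.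
  have /andP[s0 sR] := sI; rewrite /F normrM (normrM _ (d s)) (normrM (G s)) ger0_norm ?sqr_ge0//.
  have q1 : 0 <= `|G s| * `|d s| by exact: mulr_ge0.
  have q2 : 0 <= `|G s| * `|d s| * `|d s| by exact: mulr_ge0.
  have q3 : `|G s| <= `|CG| by exact: le_trans (hCG s sI) (ler_norm _).
  apply: (ler_pM (sqr_ge0 s) q2); first by apply: lerXn2r; rewrite ?nnegrE ltW.
  by apply: (ler_pM q1) => //; [apply: ler_pM => //|]; exact: hB.
rewrite lt_neqAle Rintegral_ge0 ?andbT; last by move=> s /in_I; exact: F0.
apply/eqP => /esym F00; apply: d_nonzero => r rR.
have : (\int[leb]_(s in I) `|(F s)%:E| = 0)%E.
  have : (\int[leb]_(s in I) (F s)%:E = 0)%E.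
    by rewrite -(fineK (integrable_fin_num mI iF)); congr EFin.
  by move=> <-; apply: eq_integral => s; rewrite inE => /in_I sI; rewrite abse_EFin ger0_norm// F0.
have mF' : measurable_fun I (EFin \o F) by exact/measurable_EFinP.
move=> /(ae_eq_integral_abs leb mI mF') aeF.
have aed : {ae leb, forall s, I s -> d s = 0}.
  apply: ae_imp (ae_and aeF (coefG_ae HE)) => s [/= h1 h2] Is.
  have := h1 Is; case; have /andP[s0 _] := in_I Is.
  move=> e; apply/eqP; apply: contraT => dn.
  suff : 0 < F s by rewrite e ltxx.
  rewrite /F; apply: mulr_gt0; first by rewrite exprn_gt0.
  rewrite -mulrA; apply: mulr_gt0; first exact: h2 Is.
  by rewrite -expr2 lt0r sqrf_eq0 dn sqr_ge0.
have /andP[r0 rR'] := rR.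
apply/eqP; apply: contraT => dn.
have np : 0 < `|d r| by rewrite normr_gt0.
have cn : `|d s| @[s --> r] --> `|d r| by apply: cvg_norm; exact: d_continuous rR.
have [e /= e0 he] := cvgr_gt _ cn (0 : R) np.
have ru : r < Num.min (r + e) Rd by rewrite lt_min ltrDl e0.
have uR : Num.min (r + e) Rd <= Rd by rewrite ge_min lexx orbT.
have [s [/andP[rs su] hs]] := ae_dense aed (ltW r0) ru uR.
move: su; rewrite lt_min => /andP[su sR].
have := he s; rewrite /= ltr0_norm ?subr_lt0// opprB ltrBlDl => /(_ su).
by rewrite hs normr0 ltxx.
Qed.

End Gap.

(** * The equation of the branch *)
Section ShellDifference.
Context {R : realType}.
Local Notation leb := (@lebesgue_measure R).

Definition shell_kernel (r0 r s : R) : R := s ^+ 2 / Num.max s r - s ^+ 2 / Num.max s r0.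

Lemma measurable_shell_kernel (r0 r u : R) :
  measurable_fun (`]0, u[%classic : set R) (shell_kernel r0 r).
Proof. by apply: measurable_funB; exact: measurable_shell. Qed.

Lemma shell_kernel_bound (r0 r s : R) : 0 < s -> `|shell_kernel r0 r s| <= s.
Proof.
move=> s0; have /andP[h1 h2] := shell_le r s0; have /andP[h3 h4] := shell_le r0 s0.
by rewrite ler_norml /shell_kernel; apply/andP; split; lra.
Qed.

(** Differences of the potential do not see the mass outside the larger radius. *)
Lemma shell_potential_difference (Rd : R) g (r0 r : R) : 0 < Rd -> L2ball Rd g ->
  0 < r0 -> r0 < r -> r < Rd ->
  shell_potential Rd g r - shell_potential Rd g r0 =
  \int[leb]_(s in `]0, r[) (shell_kernel r0 r s * g s).
Proof.
move=> Rd0 Fg r00 r0r rR; rewrite shell_potentialB// Rintegral_mkcond [RHS]Rintegral_mkcond.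
apply: eq_Rintegral => s _; rewrite !patchE.
have e : s ^+ 2 * ((Num.max s r)^-1 - (Num.max s r0)^-1) * g s = shell_kernel r0 r s * g s.
  by rewrite /shell_kernel mulrBr.
rewrite e; case: ifPn => [|]; case: ifPn => //; rewrite ?notin_setE ?inE /= !in_itv/=.
- move=> /negP h /andP[s0 sR]; have rs : r <= s by move: h; rewrite s0/= -leNgt.
  by rewrite /shell_kernel !max_l ?subrr ?mul0r// (le_trans (ltW r0r)).
- by move=> /andP[s0 sr] /negP; rewrite s0 (lt_trans sr rR).
Qed.
End ShellDifference.

Section BranchEquation.
Context {R : realType}.
Local Notation leb := (@lebesgue_measure R).
Variables (P : R -> R -> R) (gamma0 alpha0 : R) (f : R -> R).
Variables (a b : R) (rho : R -> R -> R) (radius : R -> R) (mu : R).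
Hypothesis hP : hypP P gamma0 alpha0.
Hypothesis hcenter : forall mu : R, a <= mu <= b -> rho mu 0 = mu.
Hypothesis hEs : forall mu : R, a <= mu <= b -> hypEs P f (rho mu) (radius mu) gamma0 alpha0.
Hypothesis hF : hypF P f a b rho radius.
Hypothesis hmu : a < mu < b.
Local Notation S := (`[a, b]%classic : set R).
Local Notation dr := (drho a b rho).
Local Notation v := (v_ a b rho radius mu).

Let wk m : a < m < b -> a <= m <= b.
Proof. by move=> /andP[h1 h2]; rewrite !ltW. Qed.

Let nS m : a < m < b -> nbhs m S.
Proof.
move=> mI; apply: (@filterS _ _ _ `]a, b[%classic).
  by move=> s /=; rewrite !in_itv/=; exact: wk.
by apply: open_nbhs_nbhs; split; [exact: interval_open|rewrite /= in_itv].
Qed.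

Lemma branch_entropy : Ck_on `[0, b]%classic 1 f.
Proof.
have bI : a <= b <= b by case/andP: hmu => h1 h2; rewrite lexx (ltW (lt_trans h1 h2)).
by have := Es_f_C1 (hEs bI); rewrite hcenter.
Qed.
Let Hf := branch_entropy.

Lemma branch_center m : a < m < b -> rho m 0 < b.
Proof. by move=> mI; rewrite hcenter ?wk//; case/andP: mI. Qed.

Lemma branch_derive m (r : R) : a < m < b -> 0 <= r < radius m ->
  is_derive m 1 (rho^~ r) (dr m r).
Proof.
move=> mI rR; have [] := F_rho_derivable hF (mu := m) (r := r).
  by split => //=; rewrite in_itv/= wk.
by move=> d _; apply: derivable_in_interior => //; exact: nS.
Qed.

Lemma radius_continuous m : a < m < b -> {for m, continuous radius}.
Proof. by move=> mI; have [c _] := F_radius hF; exact: continuous_of_within (nS mI) c. Qed.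

Let window (r : R) : 0 < r < radius mu -> exists2 e : R, 0 < e &
  forall m, `|mu - m| <= e -> [/\ a < m < b, r < radius m & rho mu r / 2 < rho m r].
Proof.
move=> /andP[r0 rR]; have HE := hEs (wk hmu).
have rp : 0 < rho mu r by apply: (rho_gt0 HE); rewrite ltW.
have cr := is_derive_continuous (@branch_derive mu r hmu _); rewrite (ltW r0) rR in cr.
have n1 : \forall m \near mu, a < m < b.
  have : nbhs mu `]a, b[%classic.
    by apply: open_nbhs_nbhs; split; [exact: interval_open|rewrite /= in_itv].
  by apply: filterS => s; rewrite /= in_itv.
have n2 : \forall m \near mu, r < radius m by exact: (cvgr_gt _ (radius_continuous hmu)).
have n3 : \forall m \near mu, rho mu r / 2 < rho m r.
  by apply: (cvgr_gt _ (cr isT)); lra.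
have [e /= e0 he] := filterI n1 (filterI n2 n3).
exists (e / 2); first by rewrite divr_gt0.
move=> m hm; have [|h1 [h2 h3]] := he m; first by rewrite /= (le_lt_trans hm)//; lra.
by split.
Qed.

(** A primitive of [W]: the enthalpy as a function of the density. *)
Lemma enthalpy (t0 : R) : 0 < t0 -> exists h : R -> R,
  forall t : R, t0 < t < b -> is_derive t 1 h (W P f t).
Proof.
move=> t00; exists (fun t => \int[leb]_(s in `[t0, t]) W P f s) => t /andP[tt tb].
have tu : t < (t + b) / 2 by lra.
have cW (s : R) : t0 <= s <= (t + b) / 2 -> {for s, continuous (W P f)}.
  by move=> /andP[h1 h2]; apply: (W_continuous hP Hf); apply/andP; split; lra.
have iW : leb.-integrable `[t0, (t + b) / 2]%classic (EFin \o W P f).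
  apply: continuous_compact_integrable; first exact: segment_compact.
  apply: continuous_in_subspaceT => s; rewrite inE/= in_itv/=; exact: cW.
have [||d e] := @continuous_FTC1 R (W P f) (BLeft t0) t _ tu iW.
- by rewrite lte_fin.
- by apply: cW; rewrite !ltW.
by rewrite -e derive1E; exact: DeriveDef.
Qed.

(** Hydrostatic equilibrium, integrated between two radii. *)
Lemma enthalpy_potential (h : R -> R) (m t0 r0 r : R) : a < m < b ->
  (forall t : R, t0 < t < b -> is_derive t 1 h (W P f t)) ->
  0 < r0 -> r0 < r -> r < radius m -> t0 < rho m r ->
  h (rho m r) - h (rho m r0) = 4 * pi * (shell_potential (radius m) (rho m) r
                                       - shell_potential (radius m) (rho m) r0).
Proof.
move=> mI hh r00 r0r rR t0r; have HE := hEs (wk mI).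
pose g s := h (rho m s) - 4 * pi * shell_potential (radius m) (rho m) s.
have dg (x : R) : r0 <= x <= r -> is_derive x 1 g 0.
  move=> /andP[h1 h2]; have xR : 0 < x < radius m by apply/andP; split; lra.
  have xR0 : 0 <= x < radius m by apply/andP; split; lra.
  have [d dU e] := equilibrium_derive hP HE (branch_center mI) Hf xR.
  have dx : t0 < rho m x < b.
    have /andP[_ ->] := rho_range HE (branch_center mI) xR0; rewrite andbT.
    move: h2; rewrite le_eqVlt => /orP[/eqP->//|h2].
    by apply: (lt_trans t0r); apply: (rho_decr HE); lra.
  have h3 := @is_derive1_comp _ h (rho m) x _ _ (hh _ dx) (rho_derive HE xR).
  have := is_deriveB h3 (is_deriveZ (4 * pi) dU).
  suff -> : W P f (rho m x) * derive1 (rho m) x - (4 * pi) *: d = 0 :> R by [].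
  by rewrite /GRing.scale/= e (weight1E hP HE (branch_center mI) Hf)// subrr.
have [c _] := MVT_interior r0r dg.
by rewrite mul0r /g => hg; lra.
Qed.

Let v_dr (r : R) : r < radius mu -> v r = dr mu r.
Proof. by rewrite /v_ => ->. Qed.

(** The derivative of the profiles is bounded on a compact rectangle of the
    positive-density interior, which dominates the difference quotients. *)
Let potential_derive (r0 r : R) : 0 < r0 -> r0 < r -> r < radius mu ->
  is_derive mu 1 (fun m => \int[leb]_(s in `]0, r[) (shell_kernel r0 r s * rho m s))
    (\int[leb]_(s in `]0, r[) (shell_kernel r0 r s * v s)).
Proof.
move=> r00 r0r rR; have r1 : 0 < r < radius mu by rewrite (lt_trans r00).
have r_gt0 : 0 < r by lra.
have [e e0 he] := window r1.
have in_box m s : `|mu - m| <= e -> 0 <= s <= r -> a < m < b /\ 0 <= s < radius m.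
  by move=> /he[h1 h2 _] /andP[-> sr]; split; rewrite ?(le_lt_trans sr).
pose A := `[mu - e, mu + e]%classic `*` `[0, r]%classic : set (R * R).
have bxA m : (`[mu - e, mu + e]%classic : set R) m -> `|mu - m| <= e.
  by rewrite /= in_itv/= => /andP[? ?]; rewrite ler_norml; apply/andP; split; lra.
have [K hK] : exists K : R, forall m s, `|mu - m| <= e -> 0 <= s <= r -> `|dr m s| <= K.
  have cA : {within A, continuous (fun p : R * R => `|dr p.1 p.2|)}.
    have c : {within A, continuous (fun p : R * R => dr p.1 p.2)}.
      apply: continuous_subspaceW (F_drho_cont hF) => -[m s] [/= /bxA hm].
      rewrite in_itv/= => hs; have [h1 h2] := in_box m s hm hs.
      by split => //=; rewrite in_itv/= wk.
    move=> x; suff h : dr y.1 y.2 @[y --> (x : subspace A)] --> dr x.1 x.2 by exact: (cvg_norm h).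
    exact: c.
  have [||c _ hc] := compact_EVT_max _ _ cA.
  - exists (mu, 0); split => /=; rewrite in_itv/=; apply/andP; split; lra.
  - by apply: compact_setX; exact: segment_compact.
  exists (`|dr c.1 c.2|) => m s hm hs; apply: (hc (m, s)); rewrite inE; split => /=; last by rewrite in_itv.
  by rewrite in_itv/=; move: hm; rewrite ler_norml => /andP[? ?]; apply/andP; split; lra.
have K0 : 0 <= K by apply: le_trans (hK mu 0 _ _); rewrite ?subrr ?normr0 ?lexx//= ltW.
pose F (m s : R) := shell_kernel r0 r s * rho m s.
have Ia : (`]mu - e, mu + e[%classic : set R) mu by rewrite /= in_itv/=; apply/andP; split; lra.
have Ie m : (`]mu - e, mu + e[%classic : set R) m -> `|mu - m| <= e.
  by rewrite /= in_itv/= => /andP[? ?]; rewrite ler_norml; apply/andP; split; lra.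
have mI : measurable (`]0, r[%classic : set (measurableTypeR R)) by exact: measurable_itv.
have inI s : (`]0, r[%classic : set R) s -> 0 <= s <= r.
  by rewrite /= in_itv/= => /andP[? ?]; rewrite !ltW.
have dF m s : (`]mu - e, mu + e[%classic : set R) m -> (`]0, r[%classic : set R) s ->
    is_derive m 1 (F^~ s) (shell_kernel r0 r s * dr m s).
  move=> /Ie hm /inI hs; have [h1 h2] := in_box m s hm hs.
  have h3 := branch_derive h1 h2.
  exact: (@is_deriveZ _ _ _ _ (shell_kernel r0 r s) m 1 _ h3).
have intF m : (`]mu - e, mu + e[%classic : set R) m ->
    leb.-integrable `]0, r[%classic (EFin \o F m).
  move=> /Ie hm; have [mI' hR _] := he m hm; have HE := hEs (wk mI').
  apply: (@integrable_bounded_I _ _ r_gt0 _ (r * rho m 0)).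
    apply: measurable_funM; first exact: measurable_shell_kernel.
    apply: measurable_funS (measurable_rho HE) => //.
    by apply: subset_itvl; rewrite bnd_simp ltW.
  move=> s; rewrite /= in_itv/= => /andP[s0 sr]; rewrite /F normrM.
  have /andP[h1 h2] : 0 < rho m s <= rho m 0.
    by apply: (rho_range0 HE); rewrite (ltW s0) (lt_trans sr).
  apply: ler_pM => //; last by rewrite gtr0_norm.
  exact: le_trans (shell_kernel_bound _ _ s0) (ltW sr).
have derF m s : (`]mu - e, mu + e[%classic : set R) m -> (`]0, r[%classic : set R) s ->
    derivable (F^~ s) m 1 by move=> h1 h2; have [] := dF m s h1 h2.
have dE m s : (`]mu - e, mu + e[%classic : set R) m -> (`]0, r[%classic : set R) s ->
    partial1of2 F m s = shell_kernel r0 r s * dr m s.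
  by move=> h1 h2; have [_ <-] := dF m s h1 h2; rewrite /partial1of2 derive1E.
have Gub m s : (`]mu - e, mu + e[%classic : set R) m -> (`]0, r[%classic : set R) s ->
    `|partial1of2 F m s| <= r * K.
  move=> h1 h2; rewrite dE// normrM; apply: ler_pM => //.
    move: h2; rewrite /= in_itv/= => /andP[s0 sr].
    exact: le_trans (shell_kernel_bound _ _ s0) (ltW sr).
  by apply: hK; [exact: Ie|exact: inI].
have intG : leb.-integrable `]0, r[%classic (EFin \o (fun=> r * K)).
  exact: (integrable_cst_I r_gt0 (r * K)).
have G0 (s : measurableTypeR R) : 0 <= r * K by rewrite mulr_ge0// ltW.
have e1 := @differentiation_under_integral R _ _ leb F _ mI mu _ _ Ia intF derF _ G0 intG Gub.
have d1 := @derivable_under_integral R _ _ leb F _ mI mu _ _ Ia intF derF _ G0 intG Gub.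
have -> : \int[leb]_(s in `]0, r[) (shell_kernel r0 r s * v s) =
    \int[leb]_(s in `]0, r[) partial1of2 F mu s.
  apply: eq_Rintegral => s; rewrite inE => sI; rewrite dE// v_dr//.
  by move: sI; rewrite /= in_itv/= => /andP[_ /lt_trans]; apply.
by rewrite -e1 derive1E; exact: DeriveDef.
Qed.

(** Differentiate [enthalpy_potential] along the branch. The difference of
    potentials is an integral over the fixed interval up to the larger radius, so
    that the motion of the surface does not enter. *)
Lemma branch_equation : exists C : R, forall r : R, 0 < r < radius mu ->
  weight1 P f (rho mu) r * v r - 4 * pi * shell_potential (radius mu) v r = C.
Proof.
have HE := hEs (wk hmu); have R0 := Es_radius HE.
have Xv : L2ball (radius mu) v.
  exact: (X_L2ball hP HE (branch_center hmu) Hf (F_v hF (wk hmu))).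
pose G r := weight1 P f (rho mu) r * v r - 4 * pi * shell_potential (radius mu) v r.
suff key (r0 r : R) : 0 < r0 -> r0 < r -> r < radius mu -> G r = G r0.
  exists (G (radius mu / 2)) => r /andP[r0 rR]; rewrite -/(G r).
  have [h|h|->//] := ltgtP r (radius mu / 2).
    by symmetry; apply: key => //; lra.
  by apply: key => //; lra.
move=> r00 r0r rR; have r1 : 0 < r < radius mu by rewrite (lt_trans r00).
have [e e0 he] := window r1.
have rp : 0 < rho mu r by apply: (rho_gt0 HE); case/andP: r1 => /ltW -> ->.
have t00 : 0 < rho mu r / 2 by lra.
have [h hh] := enthalpy t00.
have dh (x : R) : r0 <= x <= r ->
    is_derive mu 1 (fun m => h (rho m x)) (W P f (rho mu x) * v x).
  move=> /andP[h1 h2]; have xR : 0 <= x < radius mu by apply/andP; split; lra.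
  have dx : rho mu r / 2 < rho mu x < b.
    have /andP[_ ->] := rho_range HE (branch_center hmu) xR; rewrite andbT.
    move: h2; rewrite le_eqVlt => /orP[/eqP->|h2]; first by lra.
    have : rho mu r < rho mu x by apply: (rho_decr HE); lra.
    by lra.
  rewrite v_dr; last by case/andP: xR.
  exact: (@is_derive1_comp _ h (rho^~ x) mu _ _ (hh _ dx) (branch_derive hmu xR)).
have d1 := is_deriveB (dh r _) (dh r0 _).
have {}d1 : is_derive mu 1 (fun m => h (rho m r) - h (rho m r0))
   (W P f (rho mu r) * v r - W P f (rho mu r0) * v r0).
  by apply: d1; rewrite lexx (ltW r0r).
have d2 := is_deriveZ (4 * pi) (potential_derive r00 r0r rR).
have d3 : is_derive mu 1 (fun m => h (rho m r) - h (rho m r0))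
    (4 * pi * \int[leb]_(s in `]0, r[) (shell_kernel r0 r s * v s)).
  apply: near_eq_is_derive d2; exists e => // m /= hm.
  have [mI rm tm] := he m (ltW hm); have HEm := hEs (wk mI).
  rewrite (enthalpy_potential mI hh)// shell_potential_difference//.
    exact: Es_radius HEm.
  exact: (rho_L2ball HEm).
have : W P f (rho mu r) * v r - W P f (rho mu r0) * v r0 =
    4 * pi * \int[leb]_(s in `]0, r[) (shell_kernel r0 r s * v s).
  by have [_ <-] := d1; have [_ <-] := d3.
rewrite -(shell_potential_difference R0 Xv)// /G.
rewrite !(weight1E hP HE (branch_center hmu) Hf); first by lra.
  by apply/andP; split; lra.
by apply/andP; split; lra.
Qed.

Lemma branch_v_continuous (u : R) : 0 < u < radius mu -> {within `[0, u]%classic, continuous v}.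
Proof.
move=> /andP[u0 uR]; apply/subspace_continuousP => x /=; rewrite in_itv/= => /andP[x0 xu].
have c : {within interior_region a b radius, continuous (fun p : R * R => dr p.1 p.2)} := F_drho_cont hF.
have reg s : 0 <= s <= u -> interior_region a b radius (mu, s).
  by move=> /andP[s0 su]; split => /=; rewrite ?in_itv/= ?wk// s0 (le_lt_trans su).
have /subspace_continuousP/(_ (mu, x)) cx := c.
have {}cx := cx (reg x _); rewrite x0 xu in cx; have {}cx := cx isT.
have cp : (fun s : R => (mu, s)) s @[s --> x] --> (mu, x).
  move=> V [[A B] /= [nA nB] sub]; apply: filterS nB => s Bs; apply: sub.
  by split => //=; exact: nbhs_singleton nA.
have vx : v x = dr mu x by rewrite v_dr ?(le_lt_trans xu).
change (v s @[s --> within `[0, u]%classic (nbhs x)] --> v x).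
rewrite vx => V /cx /= hV.
have n : nbhs x (fun s => interior_region a b radius (mu, s) -> V (dr mu s)) := cp _ hV.
suff : nbhs x (fun s => (`[0, u]%classic : set R) s -> V (v s)) by [].
apply: filterS n => s hs; rewrite /= in_itv/= => sI.
rewrite v_dr; first exact: (hs (reg s sI)).
by case/andP: sI => _ /le_lt_trans; apply.
Qed.

Lemma branch_v_center : v 0 = 1.
Proof.
have HE := hEs (wk hmu); have R0 := Es_radius HE; rewrite v_dr//.
have d1 := @branch_derive mu 0 hmu; rewrite lexx R0 in d1; have {}d1 := d1 isT.
have d2 : is_derive mu 1 (rho^~ 0) 1.
  apply: near_eq_is_derive (is_derive_id mu 1).
  by apply: filterS (nS hmu) => m; rewrite /= in_itv/= => mI; rewrite hcenter.
by have [_ e1] := d1; have [_ e2] := d2; rewrite -e1 e2.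
Qed.

End BranchEquation.

(** * Transport to the unit ball *)
Section Pullback.
Context {R : realType}.
Local Notation leb := (@lebesgue_measure R).
Local Notation form := ((R -> R) -> (R -> R) -> R).

Lemma pullbackK (Rd : R) : Rd != 0 -> cancel (pullback Rd) (pullback_inv Rd).
Proof.
move=> Rd0 eta; apply/funext => r; rewrite /pullback_inv /pullback.
rewrite (_ : Rd * (r / Rd) = r); last by field.
by rewrite mulKf// expf_neq0.
Qed.

Lemma pullback_invK (Rd : R) : Rd != 0 -> cancel (pullback_inv Rd) (pullback Rd).
Proof.
move=> Rd0 xi; apply/funext => s; rewrite /pullback_inv /pullback.
rewrite (_ : Rd * s / Rd = s); last by field.
by rewrite mulVKf// expf_neq0.
Qed.

Lemma pullback_lin (Rd c : R) x y : pullback Rd (c *: x + y) = c *: pullback Rd x + pullback Rd y.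
Proof. by apply/funext => s; rewrite /pullback /= mulrDr; congr (_ + _); exact: mulrCA. Qed.

Lemma pull_formE (Rd : R) (q : form) eta xi : Rd != 0 ->
  pull_form Rd q (pullback Rd eta) (pullback Rd xi) = q eta xi.
Proof. by move=> Rd0; rewrite /pull_form !pullbackK. Qed.

Lemma pull_bilinear (Rd : R) (V V1 : set (R -> R)) (q : form) : Rd != 0 ->
  (forall eta, V eta <-> V1 (pullback Rd eta)) ->
  (forall c x y, V1 x -> V1 y -> V1 (c *: x + y)) ->
  bilinear_on V1 (pull_form Rd q) -> bilinear_on V q.
Proof.
move=> Rd0 VV1 lin1 bq c x y z /VV1 Vx /VV1 Vy /VV1 Vz.
have [h1 h2] := bq c _ _ _ Vx Vy Vz.
by move: h1 h2; rewrite -pullback_lin !pull_formE.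
Qed.

Lemma sum_bilinear (V : set (R -> R)) (q k l : form) :
  (forall c x y, V x -> V y -> V (c *: x + y)) ->
  bilinear_on V k -> bilinear_on V l ->
  (forall x y, V x -> V y -> q x y = k x y + l x y) -> bilinear_on V q.
Proof.
move=> lin bk bl qE c x y z Vx Vy Vz.
have [k1 k2] := bk c x y z Vx Vy Vz; have [l1 l2] := bl c x y z Vx Vy Vz.
have Vxy := lin c x y Vx Vy.
by rewrite !qE// k1 k2 l1 l2; split; ring.
Qed.

Lemma sum_bounded (V : set (R -> R)) N (q k l : form) :
  bounded_form V N k -> bounded_form V N l ->
  (forall x y, V x -> V y -> q x y = k x y + l x y) -> bounded_form V N q.
Proof.
move=> [A hA] [B hB] qE; exists (A + B) => x y Vx Vy; rewrite qE//.
by apply: (le_trans (ler_normD _ _)); rewrite !mulrDl; apply: lerD; [exact: hA|exact: hB].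
Qed.

Lemma integral_scale (c : R) (f : R -> \bar R) : 0 < c ->
  leb.-integrable [set: R] f -> (\int[leb]_x f x = c%:E * \int[leb]_x f (c * x)%R)%E.
Proof.
move=> c0 intf; have mf := measurable_int _ intf.
have fA := integrable_pos_fin_num measurableT intf.
have fB := integrable_neg_fin_num measurableT intf.
rewrite integralE [in RHS]integralE.
have eA := ge0_integral_scale c0 (measurable_funepos mf) (funepos_ge0 f).
have eB := ge0_integral_scale c0 (measurable_funeneg mf) (funeneg_ge0 f).
rewrite eA in fA *; rewrite eB in fB *.
have key (x y : \bar R) : (c%:E * x)%E \is a fin_num -> (c%:E * y)%E \is a fin_num ->
    (c%:E * x - c%:E * y = c%:E * (x - y))%E.
  case: x => [x| |]; rewrite ?gt0_muley ?gt0_muleNy ?lte_fin//.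
  case: y => [y| |]; rewrite ?gt0_muley ?gt0_muleNy ?lte_fin//.
  move=> _ _; exact: (congr1 EFin (esym (mulrBr c x y))).
rewrite (key _ _ fA fB); congr (_ * (_ - _))%E;
  by apply: eq_integral => x _; rewrite ?funeposE ?funenegE.
Qed.

Lemma integrable_scale (c : R) (f : R -> \bar R) : 0 < c ->
  leb.-integrable [set: R] f -> leb.-integrable [set: R] (fun x => f (c * x)).
Proof.
move=> c0 /integrableP[mf hf]; apply/integrableP.
have ms : measurable_fun [set: R] (fun x : R => c * x) by meas.
split; first exact: (measurableT_comp mf ms).
have e := ge0_integral_scale c0 (measurableT_comp (@abse_measurable R setT) mf) (fun x => abse_ge0 (f x)).
have {}hf : (c%:E * \int[leb]_x `|f (c * x)%R| < +oo)%E by rewrite -e.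
rewrite ltNge leye_eq; apply: contraTN hf => /eqP ->.
by rewrite gt0_muley ?lte_fin.
Qed.

Lemma zero_mean_pullback (Rd : R) eta : 0 < Rd ->
  measurable_fun (`]0, Rd[%classic : set R) eta ->
  measurable_fun (`]0, 1[%classic : set R) (pullback Rd eta) ->
  leb.-integrable `]0, Rd[%classic (fun s => (s ^+ 2 * eta s)%:E) ->
  zero_mean 1 (pullback Rd eta) <-> zero_mean Rd eta.
Proof.
move=> Rd0 me mp ie; rewrite !zero_meanE//.
suff -> : \int[leb]_(s in `]0, 1[) (s ^+ 2 * pullback Rd eta s) =
          \int[leb]_(s in `]0, Rd[) (s ^+ 2 * eta s) by [].
rewrite Rintegral_mkcond [RHS]Rintegral_mkcond; congr fine.
set F := (fun s : R => s ^+ 2 * eta s) \_ `]0, Rd[.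
have mI : measurable (`]0, Rd[%classic : set (measurableTypeR R)) by exact: measurable_itv.
have iF : leb.-integrable [set: R] (EFin \o F).
  have := (integrable_mkcond _ mI).1 ie; apply: eq_integrable => // s _.
  by rewrite /= /F !patchE; case: ifP.
transitivity (\int[leb]_x (Rd%:E * (EFin \o F) (Rd * x)%R))%E.
  apply: eq_integral => x _; rewrite /= -EFinM; congr EFin; rewrite /F !patchE.
  have e : (x \in `]0, 1[%classic) = (Rd * x \in `]0, Rd[%classic).
    apply/idP/idP; rewrite !inE/= !in_itv/= pmulr_rgt0// gtr_pMr//.
  rewrite -e; case: ifP => _; last by rewrite mulr0.
  by rewrite /pullback; ring.
rewrite [RHS](integral_scale Rd0 iF); apply: integralZl => //.
exact: (integrable_scale Rd0 iF).
Qed.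
End Pullback.

Section UnitBall.
Context {R : realType}.
Local Notation leb := (@lebesgue_measure R).
Local Notation form := ((R -> R) -> (R -> R) -> R).
Variables (P : R -> R -> R) (f : R -> R) (g0 al0 : R) (rho : R -> R) (Rd b : R).
Hypothesis HP : hypP P g0 al0.
Hypothesis HE : hypEs P f rho Rd g0 al0.
Hypothesis rho0b : rho 0 < b.
Hypothesis Hf : Ck_on `[0, b]%classic 1 f.
Local Notation I := (`]0, Rd[%classic : set R).
Local Notation X := (X1rad P f rho Rd).
Local Notation NX := (X1sqnorm P f rho Rd).
Local Notation H := (Hrad P f rho Rd).
Variable (omega : R -> R).
Hypothesis momega : measurable_fun (`]0, 1[%classic : set R) omega.
Hypothesis omega0 : forall s : R, 0 < s < 1 -> 0 < omega s.
Local Notation V1 := (L2rad 1 omega).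
Local Notation N1 := (sqnorm 1 omega).
Variables (c C : R).
Hypothesis X_V1 : forall eta, X eta <-> V1 (pullback Rd eta).
Hypotheses (c0 : 0 < c) (C0 : 0 < C).
Hypothesis NX_N1 : forall eta, X eta -> c * NX eta <= N1 (pullback Rd eta) <= C * NX eta.
Local Notation V0 := (V1 `&` zero_mean 1).

Let Rd0 : 0 < Rd. Proof. exact: Es_radius HE. Qed.
Let Rdn : Rd != 0. Proof. by rewrite gt_eqF. Qed.
Let o0 s : (`]0, 1[%classic : set R) s -> 0 < omega s.
Proof. by rewrite /= in_itv; exact: omega0. Qed.
Let mI : measurable (I : set (measurableTypeR R)). Proof. by []. Qed.
Let in_I s : I s -> 0 < s < Rd. Proof. by rewrite /= in_itv. Qed.
Let w0 s : I s -> 0 < weight1 P f rho s.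
Proof. by move=> /in_I/andP[s0 sR]; apply: (weight1_gt0 HE rho0b); rewrite ltW. Qed.
Let mw : measurable_fun I (weight1 P f rho).
Proof. exact: measurable_weight1 HP HE rho0b Hf. Qed.

Let V1_measurable y : V1 y -> measurable_fun (`]0, 1[%classic : set R) y.
Proof. by move=> /(L2radP ltr01 momega o0)/WL2_measurable. Qed.

Lemma V1_lin k x y : V1 x -> V1 y -> V1 (k *: x + y).
Proof. exact: (L2rad_lin ltr01 momega o0). Qed.

Lemma pull_X y : V1 y -> X (pullback_inv Rd y).
Proof. by move=> Vy; apply/X_V1; rewrite pullback_invK. Qed.

Lemma pull_H eta : H eta <-> V0 (pullback Rd eta).
Proof.
suff key : X eta -> zero_mean 1 (pullback Rd eta) <-> zero_mean Rd eta.
  split=> -[h1 h2].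
    by split; [exact/X_V1|exact/(key h1)].
  by have Xe := (X_V1 eta).2 h1; split => //; exact/(key Xe).
move=> Xe; apply: zero_mean_pullback => //.
- exact: X_measurable HP HE rho0b Hf _ Xe.
- exact: V1_measurable ((X_V1 _).1 Xe).
- exact: X_integrable HP HE rho0b Hf _ Xe.
Qed.

Lemma pull_inv_H y : V0 y -> H (pullback_inv Rd y).
Proof. by move=> Vy; apply/pull_H; rewrite pullback_invK. Qed.

Lemma pull_coercive (q : form) : coercive V0 N1 (pull_form Rd q) -> coercive H NX q.
Proof.
move=> [k k0 hk]; exists (k * c); first exact: mulr_gt0.
move=> eta He; have Xe : X eta by case: He.
have := hk _ ((pull_H eta).1 He); rewrite pull_formE//; apply: le_trans.
by rewrite -mulrA ler_pM2l//; have /andP[] := NX_N1 Xe.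
Qed.

Lemma V0_lin k x y : V0 x -> V0 y -> V0 (k *: x + y).
Proof.
move=> Vx Vy; have Hx := pull_inv_H Vx; have Hy := pull_inv_H Vy.
have Vxy : V1 (k *: x + y) by apply: V1_lin; [case: Vx|case: Vy].
rewrite -(pullback_invK Rdn x) -(pullback_invK Rdn y) -pullback_lin; apply/pull_H.
have [Xx zx] := Hx; have [Xy zy] := Hy.
have Xxy := X_lin HP HE rho0b Hf k Xx Xy; split => //.
have m := X_measurable HP HE rho0b Hf.
apply/(zero_meanE Rd0 (m _ Xxy)).
move/(zero_meanE Rd0 (m _ Xx)): zx => zx; move/(zero_meanE Rd0 (m _ Xy)): zy => zy.
have ix := X_integrable HP HE rho0b Hf Xx; have iy := X_integrable HP HE rho0b Hf Xy.
transitivity (\int[leb]_(s in I) (k * (s ^+ 2 * pullback_inv Rd x s) + s ^+ 2 * pullback_inv Rd y s)).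
  by apply: eq_Rintegral => s _; rewrite mulrDr; congr (_ + _); exact: mulrCA.
rewrite RintegralD//; last by have := integrableZl mI k ix; apply: eq_integrable.
by rewrite RintegralZl// zx zy mulr0 addr0.
Qed.

(** [`|eta| <= eps + eta ^ 2 / eps] bounds the mean by the weighted norm, whose
    weight is bounded below; it follows that zero mean is a closed condition. *)
Lemma mean_bound : exists2 K : R, 0 < K & forall eta (eps : R), X eta -> 0 < eps ->
  `|\int[leb]_(s in I) (s ^+ 2 * eta s)| <= eps * Rd ^+ 3 + K / eps * NX eta.
Proof.
have [kap kap0 hk] := weight1_lower HP HE rho0b Hf.
have p4 : 0 < 4 * pi :> R by rewrite mulr_gt0// pi_gt0.
exists ((4 * pi * kap)^-1); first by rewrite invr_gt0 mulr_gt0.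
move=> eta eps Xe e0; have me := X_measurable HP HE rho0b Hf Xe.
have ie := X_integrable HP HE rho0b Hf Xe.
have /(L2radP Rd0 mw w0)[_ iw] := Xe.
rewrite /X1sqnorm (sqnormE Rd0 mw me).
have -> : (4 * pi * kap)^-1 / eps * (4 * pi * wip I (radial_weight (weight1 P f rho)) eta eta) =
    (kap * eps)^-1 * wip I (radial_weight (weight1 P f rho)) eta eta.
  move: (wip _ _ _ _) => W; move: p4; move: (4 * pi) => p p4.
  by field; apply/and3P; split; rewrite gt_eqF.
have lI : fine (leb I) = Rd by rewrite lebesgue_measure_itv/= lte_fin Rd0/= subr0.
have -> : eps * Rd ^+ 3 = \int[leb]_(s in I) (eps * Rd ^+ 2).
  by rewrite Rintegral_cst// lI; ring.
have iw' : leb.-integrable I (EFin \o (fun s => radial_weight (weight1 P f rho) s * (eta s * eta s))).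
  by move: iw; apply: eq_integrable => // s _; rewrite /= expr2.
have i2 : leb.-integrable I (EFin \o (fun s => (kap * eps)^-1 * (radial_weight (weight1 P f rho) s * (eta s * eta s)))).
  by have := integrableZl mI (kap * eps)^-1 iw'; apply: eq_integrable.
have i1 : leb.-integrable I (EFin \o (fun=> eps * Rd ^+ 2)) by exact: integrable_cst_I.
rewrite /wip -RintegralZl// -RintegralD//.
apply: (le_trans (le_normr_Rintegral mI ie)); apply: le_Rintegral => //.
- exact: integrable_norm ie.
- by have := integrableD mI i1 i2; apply: eq_integrable.
move=> s sI; have /andP[s0 sR] := in_I sI; rewrite normrM ger0_norm ?sqr_ge0//.
have ks : kap <= weight1 P f rho s by apply: hk; rewrite ltW.
have h : `|eta s| <= eps + eps^-1 * eta s ^+ 2.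
  rewrite -(ler_pM2l e0) mulrDr mulrA divff ?gt_eqF// mul1r -(real_normK (num_real (eta s))).
  by have := sqr_ge0 (`|eta s| - eps); have := normr_ge0 (eta s); nra.
have s2 : 0 < s ^+ 2 by rewrite exprn_gt0.
apply: (@le_trans _ _ (s ^+ 2 * (eps + eps^-1 * eta s ^+ 2))); first by rewrite ler_pM2l.
rewrite mulrDr; apply: lerD.
  by rewrite mulrC ler_pM2l//; apply: lerXn2r; rewrite ?nnegrE ltW.
rewrite /radial_weight invfM.
have -> : kap^-1 / eps * (s ^+ 2 * weight1 P f rho s * (eta s * eta s)) =
  (weight1 P f rho s / kap) * (s ^+ 2 * (eps^-1 * eta s ^+ 2)) by ring.
apply: ler_peMl; last by rewrite ler_pdivlMr// mul1r.
by apply: mulr_ge0; [exact: ltW|apply: mulr_ge0; [rewrite invr_ge0 ltW|exact: sqr_ge0]].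
Qed.

Lemma V0_complete (x : nat -> R -> R) : (forall n, V0 (x n)) ->
  (forall eps, 0 < eps -> exists n0 : nat, forall m n,
    (n0 <= m)%N -> (n0 <= n)%N -> N1 (x m - x n) <= eps) ->
  exists2 g, V0 g & forall eps, 0 < eps -> exists n0 : nat,
    forall n, (n0 <= n)%N -> N1 (g - x n) <= eps.
Proof.
move=> Vx cx; have Vx1 n : V1 (x n) by case: (Vx n).
have [g Vg hg] := L2rad_complete ltr01 momega o0 Vx1 cx; exists g => //; split => //.
have Xg := pull_X Vg; rewrite -(pullback_invK Rdn g).
suff Hg : H (pullback_inv Rd g) by have [] := (pull_H _).1 Hg.
split => //; have mg := X_measurable HP HE rho0b Hf Xg; apply/(zero_meanE Rd0 mg).
have [K K0 hK] := mean_bound; set A := \int[leb]_(s in I) _.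
suff key (e : R) : 0 < e -> `|A| <= e * (Rd ^+ 3 + 1).
  have R3 : 0 < Rd ^+ 3 + 1 by rewrite addr_gt0// exprn_gt0.
  apply/eqP; rewrite -normr_eq0; apply: contraT => An.
  have An0 : 0 < `|A| by rewrite lt0r An normr_ge0.
  have := key (`|A| / (2 * (Rd ^+ 3 + 1))); rewrite divr_gt0 ?mulr_gt0// => /(_ isT).
  rewrite (_ : _ / _ * _ = `|A| / 2); last by field; rewrite gt_eqF.
  by lra.
move=> e0; have d0 : 0 < c * (e * e / K) by rewrite mulr_gt0// divr_gt0// mulr_gt0.
have [n0 hn] := hg _ d0; have hN := hn n0 (leqnn _).
have [Xn zn] := pull_inv_H (Vx n0).
have Vd : V1 (g - x n0) by rewrite -[g - _]addrC -scaleN1r; exact: V1_lin.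
have Xd := pull_X Vd; have := hK _ _ Xd e0.
have dE : pullback_inv Rd (g - x n0) = pullback_inv Rd g - pullback_inv Rd (x n0).
  by apply/funext => s; rewrite /pullback_inv /= mulrBr.
have in0 := X_integrable HP HE rho0b Hf Xn; have ig := X_integrable HP HE rho0b Hf Xg.
have -> : \int[leb]_(s in I) (s ^+ 2 * pullback_inv Rd (g - x n0) s) = A.
  transitivity (\int[leb]_(s in I) (s ^+ 2 * pullback_inv Rd g s - s ^+ 2 * pullback_inv Rd (x n0) s)).
    by apply: eq_Rintegral => s _; rewrite -mulrBr; congr (_ * _); exact: (congr1 (fun h => h s) dE).
  rewrite RintegralB//; move/(zero_meanE Rd0 (X_measurable HP HE rho0b Hf Xn)): zn => ->.
  by rewrite subr0.
move=> h; apply: (le_trans h); rewrite mulrDr mulr1 lerD2l.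
have /andP[h1 _] := NX_N1 Xd; rewrite pullback_invK// in h1.
have h2 : NX (pullback_inv Rd (g - x n0)) <= e * e / K.
  by rewrite -(ler_pM2l c0); exact: le_trans h1 hN.
have Ke : 0 < K / e by rewrite divr_gt0.
apply: (@le_trans _ _ (K / e * (e * e / K))); first by rewrite ler_pM2l.
by rewrite (_ : K / e * _ = e)//; field; rewrite !gt_eqF.
Qed.

End UnitBall.

(** * Coercivity at the mass extremum *)
Section BranchCoercivity.
Context {R : realType}.
Local Notation leb := (@lebesgue_measure R).
Variables (P : R -> R -> R) (gamma0 alpha0 : R) (f : R -> R).
Variables (a b : R) (rho : R -> R -> R) (radius : R -> R).
Hypothesis hP : hypP P gamma0 alpha0.
Hypothesis hcenter : forall mu : R, a <= mu <= b -> rho mu 0 = mu.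
Hypothesis hEs : forall mu : R, a <= mu <= b -> hypEs P f (rho mu) (radius mu) gamma0 alpha0.
Hypothesis hF : hypF P f a b rho radius.
Local Notation S := (`[a, b]%classic : set R).
Variable omega : R -> R.
Hypothesis momega : measurable_fun (`]0, 1[%classic : set R) omega.
Hypothesis omega0 : forall s : R, 0 < s < 1 -> 0 < omega s.
Local Notation V1 := (L2rad 1 omega).
Local Notation V0 := (V1 `&` zero_mean 1).
Local Notation N1 := (sqnorm 1 omega).
Hypothesis hequiv : forall mu, S mu ->
  (forall eta, X_ P f rho radius mu eta <-> V1 (pullback (radius mu) eta)) /\
  exists c C : R, [/\ 0 < c, 0 < C & forall eta, X_ P f rho radius mu eta ->
    c * X_sqnorm P f rho radius mu eta <= N1 (pullback (radius mu) eta)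
      <= C * X_sqnorm P f rho radius mu eta].

Let wk m : a < m < b -> a <= m <= b.
Proof. by move=> /andP[h1 h2]; rewrite !ltW. Qed.
Let wS m : a < m < b -> S m.
Proof. by move=> /wk; rewrite /= in_itv. Qed.

Lemma branch_pull_coercive mu : a < mu < b ->
  coercive V0 N1 (pull_form (radius mu) (Q_ P f rho radius mu)) ->
  coercive (H_ P f rho radius mu) (X_sqnorm P f rho radius mu) (Q_ P f rho radius mu).
Proof.
move=> hmu; have [h1 [c [C [c0 C0 h2]]]] := hequiv (wS hmu).
have HE := hEs (wk hmu); have rb := branch_center hcenter hmu.
have Hf := branch_entropy hcenter hEs hmu.
exact: (pull_coercive hP HE rb Hf momega omega0 h1 c0 h2).
Qed.

Lemma coercive_perturb (q q' : (R -> R) -> (R -> R) -> R) (k : R) : 0 < k ->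
  (forall xi, V0 xi -> k * N1 xi <= q xi xi) ->
  (forall xi, V0 xi -> `|q' xi xi - q xi xi| <= k / 2 * N1 xi) ->
  coercive V0 N1 q'.
Proof.
move=> k0 hq hq'; exists (k / 2); first by rewrite divr_gt0.
by move=> xi Vx; have := hq xi Vx; have := hq' xi Vx; rewrite ler_norml => /andP[? ?]; lra.
Qed.

Variable mu : R.
Hypothesis hmu : a < mu < b.
Hypothesis hL : coercive_plus_compact S V1 N1 (fun mu => pull_form (radius mu) (L_ P f rho radius mu)).
Hypothesis hQ : coercive_plus_compact S V0 N1 (fun mu => pull_form (radius mu) (Q_ P f rho radius mu)).
Hypothesis hM : dMass a b rho radius mu = 0.
Hypothesis hmorse : morse_index (X_ P f rho radius mu) (L_ P f rho radius mu) 1%N.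
Hypothesis hker : trivial_ker (radius mu) (X_ P f rho radius mu) (L_ P f rho radius mu).

Local Notation Rd := (radius mu).
Local Notation I := (`]0, Rd[%classic : set R).
Local Notation X := (X1rad P f (rho mu) Rd).
Local Notation H := (Hrad P f (rho mu) Rd).
Local Notation L := (Lform P f (rho mu) Rd).
Local Notation Q := (Qform P f (rho mu) Rd).
Local Notation NX := (X1sqnorm P f (rho mu) Rd).
Local Notation v := (v_ a b rho radius mu).

Let HE := hEs (wk hmu).
Let rb := branch_center hcenter hmu.
Let Hf := branch_entropy hcenter hEs hmu.
Let Rd0 : 0 < Rd. Proof. exact: (Es_radius HE). Qed.
Let Rdn : Rd != 0. Proof. by rewrite gt_eqF. Qed.
Let X_V1 eta : X eta <-> V1 (pullback Rd eta).
Proof. by have [h _] := hequiv (wS hmu); exact: h. Qed.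
Let mX eta : X eta -> measurable_fun I eta.
Proof. exact: (X_measurable hP HE rb Hf). Qed.
Let Xlin c x y : X x -> X y -> X (c *: x + y).
Proof. exact: (X_lin hP HE rb Hf). Qed.
Let V1lin c x y : V1 x -> V1 y -> V1 (c *: x + y).
Proof. exact: (V1_lin momega omega0). Qed.
Let HV0 eta : H eta <-> V0 (pullback Rd eta).
Proof. exact: (pull_H hP HE rb Hf momega omega0 X_V1). Qed.
Let V0lin c x y : V0 x -> V0 y -> V0 (c *: x + y).
Proof. exact: (V0_lin hP HE rb Hf momega omega0 X_V1). Qed.
Let Hlin c x y : H x -> H y -> H (c *: x + y).
Proof.
by move=> /HV0 hx /HV0 hy; apply/HV0; rewrite pullback_lin; exact: V0lin.
Qed.
Let Hsub c x y : H x -> H y -> H (x - c *: y).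
Proof. by move=> hx hy; rewrite addrC -scaleNr; exact: Hlin. Qed.

Lemma branch_Lform_bilinear : bilinear_on X L.
Proof.
have [al [k [kap [k0 h]]]] := hL; have [ba _ _ _ [[bk _ _] e]] := h mu (wS hmu).
by apply: (pull_bilinear Rdn X_V1 V1lin); exact: (sum_bilinear V1lin ba bk e).
Qed.

Let Qbil : bilinear_on H Q.
Proof.
have [al [k [kap [k0 h]]]] := hQ; have [ba _ _ _ [[bk _ _] e]] := h mu (wS hmu).
by apply: (pull_bilinear Rdn HV0 V0lin); exact: (sum_bilinear V0lin ba bk e).
Qed.

Let Qnull x y : H x -> H y -> N1 (pullback Rd x) = 0 -> Q x y = 0 /\ Q y x = 0.
Proof.
have [al [k [kap [k0 h]]]] := hQ; have [_ _ ba _ [[_ bk _] e]] := h mu (wS hmu).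
have [A hA] := sum_bounded ba bk e.
move=> /HV0 Vx /HV0 Vy z; have := hA _ _ Vx Vy; have := hA _ _ Vy Vx.
rewrite (pull_formE _ x y Rdn) (pull_formE _ y x Rdn) z sqrtr0 !mulr0 mul0r.
have le0 (t : R) : `|t| <= 0 -> t = 0 by rewrite normr_le0 => /eqP.
by move=> h1 h2; split; [exact: (le0 _ h2)|exact: (le0 _ h1)].
Qed.

Let Xv : X v. Proof. exact: (F_v hF (wS hmu)). Qed.

Let zv : zero_mean Rd v.
Proof. by rewrite /zero_mean/= (F_v_mass hF (wS hmu)). Qed.

Let Hv : H v. Proof. by []. Qed.

Let vz : \int[leb]_(s in I) (s ^+ 2 * v s) = 0.
Proof. by move/(zero_meanE Rd0 (mX Xv)): zv. Qed.

Let Lv0 xi : H xi -> L v xi = 0.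
Proof.
move=> [Xx zx]; have [C hC] := branch_equation hP hcenter hEs hF hmu.
rewrite (Lform_euler hP HE rb Hf Xv Xx hC).
by move/(zero_meanE Rd0 (mX Xx)): zx => ->; rewrite !mulr0.
Qed.

Let Qvv : 0 < Q v v.
Proof.
have [C hC] := branch_equation hP hcenter hEs hF hmu.
have v0 : v 0 != 0 by rewrite (branch_v_center hcenter hEs hF hmu) oner_neq0.
have gap := entropy_gap hP HE rb Hf Xv hC vz (branch_v_continuous hF hmu) v0.
rewrite (QformE hP HE rb Hf Xv Xv) (Lv0 Hv) add0r.
by apply: mulr_gt0; [apply: mulr_gt0 => //; exact: pi_gt0|exact: gap].
Qed.

Let v_not_null : ~ ae_zero Rd v.
Proof.
move=> /(radial_ae_zero Rd0 (mX Xv)) aev.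
have R0 : 0 < Rd := Rd0.
have R2 : 0 < Rd / 2 < Rd by apply/andP; split; lra.
have /andP[R20 _] := R2.
have /(continuous_within_itvP _ R20)[_ + _] := branch_v_continuous hF hmu R2 => cv0.
have v1 := branch_v_center hcenter hEs hF hmu; rewrite v1 in cv0.
have [e /= e0 he] : \forall x \near (0 : R)^'+, 0 < v x by exact: (cvgr_gt _ cv0 (0 : R) ltr01).
have ru : 0 < Num.min e Rd by rewrite lt_min e0.
have uR : Num.min e Rd <= Rd by rewrite ge_min lexx orbT.
have [s [/andP[s0 su] hs]] := ae_dense aev (lexx _) ru uR.
move: su; rewrite lt_min => /andP[su sR].
by have := he s; rewrite /= sub0r normrN gtr0_norm// => /(_ su s0); rewrite hs ltxx.
Qed.

Let pairing : exists2 w, X w & L v w != 0.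
Proof.
apply: contrapT => h; apply: v_not_null; apply: hker; split => // xi Xx.
by apply/eqP; apply: contraT => n; exfalso; apply: h; exists xi.
Qed.

Let no2 : ~ has_negative_subspace X L 2.
Proof. by move=> h; have [_ /(_ _ h)] := hmorse. Qed.

Let Lsym : symmetric_on X L. Proof. exact: (Lform_sym hP HE rb Hf). Qed.

(** The vector [v] is isotropic and orthogonal to the perturbations of zero mass:
    the single negative direction is used up by a hyperbolic plane through [v]. *)
Let L_ge0 xi : H xi -> 0 <= L xi xi.
Proof.
move=> Hx; have [w Xw vw] := pairing; have [Xx _] := Hx.
exact: (isotropic_orthogonal_ge0 Xlin branch_Lform_bilinear Lsym no2 Xv Xw (Lv0 Hv) vw Xx (Lv0 Hx)).
Qed.

(** A null vector of [Q] is a null vector of [L], hence a multiple of [v], on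
    which [Q] is positive by the entropy gap. *)
Lemma Q_definite xi : H xi -> Q xi xi = 0 -> N1 (pullback Rd xi) = 0.
Proof.
move=> Hx Qx; have [w Xw vw] := pairing; have [Xx _] := Hx.
have Lx : L xi xi = 0.
  apply/eqP; rewrite eq_le L_ge0// andbT -Qx.
  exact: (Qform_ge_Lform hP HE rb Hf).
have [c kc] := isotropic_orthogonal_null Xlin branch_Lform_bilinear Lsym no2 Xv Xw (Lv0 Hv) vw Xx (Lv0 Hx) Lx.
have ze := hker kc; set eta := xi - c *: v in kc ze.
have He : H eta by exact: Hsub.
have Xe : X eta by case: He.
have w0 s : I s -> 0 < weight1 P f (rho mu) s.
  by rewrite /= in_itv/= => /andP[s0 sR]; apply: (weight1_gt0 HE rb); rewrite ltW.
have NXe : NX eta = 0 by apply/(sqnorm_eq0 Rd0 (measurable_weight1 hP HE rb Hf) w0 Xe).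
have Ne : N1 (pullback Rd eta) = 0.
  have [_ [c' [C' [_ _ h2]]]] := hequiv (wS hmu).
  have /andP[h3 h4] := h2 eta Xe.
  have NXe' : X_sqnorm P f rho radius mu eta = 0 := NXe.
  move: h3 h4; rewrite NXe' !mulr0 => h3 h4.
  by apply/eqP; rewrite eq_le h3 h4.
have xiE : xi = c *: v + eta by rewrite /eta addrC subrK.
have [q1 q2] := Qnull He Hx Ne; have [q3 q4] := Qnull He Hv Ne.
have : Q xi xi = c ^+ 2 * Q v v.
  rewrite {1}xiE (bilinear_linl Qbil c Hv He Hx) q1 addr0.
  by rewrite {1}xiE (bilinear_linr Qbil c Hv He Hv) q4; ring.
rewrite Qx => /esym/eqP; rewrite mulf_eq0 (gt_eqF Qvv) orbF sqrf_eq0 => /eqP c0.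
by rewrite xiE c0 scale0r add0r.
Qed.

Lemma branch_coercive_unit : coercive V0 N1 (pull_form Rd Q).
Proof.
have o0 s : (`]0, 1[%classic : set R) s -> 0 < omega s by rewrite /= in_itv; exact: omega0.
have [al [k [kap [k0 h]]]] := hQ; have [ba sa bda ka [ck e]] := h mu (wS hmu).
have inv y : V0 y -> H (pullback_inv Rd y) by move=> Vy; apply/HV0; rewrite pullback_invK.
have [h1 [c [C [c0 C0 h2]]]] := hequiv (wS hmu).
apply: (coercive_of_positive V0lin _ _ _ _ k0 ba bda ka ck e).
- by move=> x [Vx _]; exact: (sqnorm_ge0 ltr01 momega o0).
- by move=> t x [Vx _]; exact: (sqnormZ ltr01 momega o0).
- by move=> x y [Vx _] [Vy _]; exact: (sqnormB ltr01 momega o0).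
- exact: (V0_complete hP HE rb Hf momega omega0 h1 c0 h2).
- move=> y /inv Hy; rewrite /pull_form; apply: (le_trans (L_ge0 Hy)).
  exact: (Qform_ge_Lform hP HE rb Hf).
- by move=> y /inv Hy /(Q_definite Hy); rewrite pullback_invK.
Qed.

End BranchCoercivity.

(** * The radial continuity equation *)
Section Moments.
Context {R : realType}.
Local Notation leb := (@lebesgue_measure R).
Variables (Rd : R).
Hypothesis Rd0 : 0 < Rd.
Local Notation I := (`]0, Rd[%classic : set R).

Let mI : measurable (I : set (measurableTypeR R)). Proof. by []. Qed.
Let in_I s : I s -> 0 < s < Rd. Proof. by rewrite /= in_itv. Qed.
Let near_I (r : R) : 0 < r < Rd -> \forall s \near r, 0 < s < Rd.
Proof.
move=> rR; have : nbhs r I.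
  by apply: open_nbhs_nbhs; split; [exact: interval_open|rewrite /= in_itv].
by apply: filterS => s; rewrite /= in_itv.
Qed.

Definition primitive (F : R -> R) (t : R) : R := \int[leb]_(s in `[0, t]) (F \_ I) s.

Let ext F (D : set R) : leb.-integrable I (EFin \o F) ->
  measurable (D : set (measurableTypeR R)) -> leb.-integrable D (EFin \o (F \_ I)).
Proof.
move=> iF mD; apply: (@integrableS _ _ _ leb setT D) => //.
have := (integrable_mkcond _ mI).1 iF; apply: eq_integrable => // s _.
by rewrite /= !patchE; case: ifP.
Qed.

Lemma primitiveD F G t : leb.-integrable I (EFin \o F) -> leb.-integrable I (EFin \o G) ->
  primitive (fun s => F s + G s) t = primitive F t + primitive G t.
Proof.
move=> iF iG; rewrite /primitive -RintegralD//; try exact: ext.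
by apply: eq_Rintegral => s _; rewrite !patchE; case: ifP => _; rewrite ?addr0.
Qed.

Lemma primitiveZ c F t : leb.-integrable I (EFin \o F) ->
  primitive (fun s => c * F s) t = c * primitive F t.
Proof.
move=> iF; rewrite /primitive -RintegralZl//; last exact: ext.
by apply: eq_Rintegral => s _; rewrite !patchE; case: ifP => _; rewrite ?mulr0.
Qed.

Lemma primitive_derive F : leb.-integrable I (EFin \o F) ->
  {ae leb, forall t, I t -> is_derive t 1 (primitive F) (F t)}.
Proof.
move=> iF; have lF : locally_integrable [set: R] (F \_ I).
  exact: (integrable_locally mI iF).
have := @FTC1 R (F \_ I) (BLeft 0) (fun y => ext iF (measurable_itv _)) lF.
apply: ae_imp => t ht It; have /andP[t0 tR] := in_I It.
have [|d e] := ht; first by rewrite lte_fin.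
have eF : F t = (F \_ I) t by rewrite patchE mem_set.
by rewrite eF -e derive1E; exact: DeriveDef.
Qed.

Lemma primitive_within F : leb.-integrable I (EFin \o F) ->
  {within `[0, Rd]%classic, continuous (primitive F)}.
Proof. by move=> iF; apply: parameterized_integral_continuous (ltW Rd0) _; exact: ext. Qed.

Lemma primitive_continuous F (t : R) : leb.-integrable I (EFin \o F) -> 0 < t < Rd ->
  {for t, continuous (primitive F)}.
Proof.
move=> iF tI; have := primitive_within iF.
by move=> /(continuous_within_itvP _ Rd0)[c _ _]; apply: c; rewrite in_itv.
Qed.

Lemma primitive_total F : leb.-integrable I (EFin \o F) ->
  primitive F Rd = \int[leb]_(s in I) F s.
Proof.
move=> iF; rewrite /primitive -(@Rintegral_itv_bndo_bndc _ (BLeft 0) Rd); last exact: ext.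
rewrite -(@Rintegral_itv_obnd_cbnd _ 0 (BLeft Rd)); last exact: ext.
by apply: eq_Rintegral => s sI; rewrite patchE sI.
Qed.

Lemma enclosed_primitive eta (r : R) : r < Rd ->
  enclosed eta r = primitive (fun s => s ^+ 2 * eta s) r.
Proof.
move=> rR; apply: eq_Rintegral => s; rewrite inE/= in_itv/= => /andP[s0 sr].
rewrite patchE; case: ifPn => //.
move: s0; rewrite le_eqVlt => /orP[/eqP <-|s0]; first by rewrite expr0n/= mul0r.
by rewrite notin_setE /= in_itv/= s0 (le_lt_trans sr rR) => /(_ isT).
Qed.

Let monomial_integrable F n : leb.-integrable I (EFin \o F) ->
  leb.-integrable I (EFin \o (fun s => s ^+ n * F s)).
Proof.
move=> iF; have /integrableP[/measurable_EFinP mF _] := iF.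
have := integrableZl mI (Rd ^+ n) (integrable_norm iF); apply: le_integrable => //.
  by apply/measurable_EFinP; apply: measurable_funM => //; apply: measurable_funX.
move=> s /in_I/andP[s0 sR]; rewrite /= lee_fin !normrM normr_id normrX normrX.
apply: ler_wpM2r => //; apply: lerXn2r; rewrite ?nnegrE//.
by rewrite !gtr0_norm// ltW.
Qed.

Let derive_monomial n Phi (t d : R) : is_derive t 1 Phi d ->
  is_derive t 1 (fun x : R => x ^+ n.+1 * Phi x) (n.+1%:R * t ^+ n * Phi t + t ^+ n.+1 * d).
Proof.
move=> dP; have dX : is_derive t 1 (fun x : R => x ^+ n.+1) (n.+1%:R * t ^+ n).
  elim: n => [|n IH].
    by rewrite expr0 mulr1; exact: (is_derive_id t 1).
  have := is_deriveM (is_derive_id t 1) IH.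
  rewrite (_ : _ *: _ + _ = n.+2%:R * t ^+ n.+1)//.
  by rewrite /GRing.scale/= mulr1 -[n.+2%:R]natr1 exprS; ring.
have := is_deriveM dX dP.
by rewrite (_ : _ *: d + _ = n.+1%:R * t ^+ n * Phi t + t ^+ n.+1 * d)// /GRing.scale/= addrC (mulrC (Phi t)).
Qed.

(** Testing the continuity equation with the truncated paraboloids squared
    determines the flux: two differentiations in the size of the support remove
    the test function. *)
Lemma flux_of_moments (p k : R -> R) :
  leb.-integrable I (EFin \o p) -> leb.-integrable I (EFin \o k) ->
  (forall t : R, 0 < t < Rd -> \int[leb]_(s in I)
     (4 * Num.max 0 (t ^+ 2 - s ^+ 2) * (s * p s) + Num.max 0 (t ^+ 2 - s ^+ 2) ^+ 2 * k s) = 0) ->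
  {ae leb, forall s, I s -> p s = - primitive k s}.
Proof.
move=> ip ik h.
pose p1 s : R := s ^+ 1 * p s; pose p3 s : R := s ^+ 3 * p s.
pose k2 s : R := s ^+ 2 * k s; pose k4 s : R := s ^+ 4 * k s.
have i1 : leb.-integrable I (EFin \o p1) by exact: monomial_integrable.
have i3 : leb.-integrable I (EFin \o p3) by exact: monomial_integrable.
have j2 : leb.-integrable I (EFin \o k2) by exact: monomial_integrable.
have j4 : leb.-integrable I (EFin \o k4) by exact: monomial_integrable.
have iZ c F : leb.-integrable I (EFin \o F) -> leb.-integrable I (EFin \o (fun s => c * F s)).
  by move=> iF; have := integrableZl mI c iF; apply: eq_integrable.
have iD F G : leb.-integrable I (EFin \o F) -> leb.-integrable I (EFin \o G) ->
    leb.-integrable I (EFin \o (fun s => F s + G s)).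
  by move=> iF iG; have := integrableD mI iF iG; apply: eq_integrable.
pose A (t : R) := 4 * (t ^+ 2 * primitive p1 t) + (-4 * primitive p3 t +
   (t ^+ 4 * primitive k t + (-2 * (t ^+ 2 * primitive k2 t) + primitive k4 t))).
have A0 (t : R) : 0 < t < Rd -> A t = 0.
  move=> tI; have /andP[t0 tR] := tI; rewrite -(h t tI).
  transitivity (primitive (fun s => 4 * t ^+ 2 * p1 s + (-4 * p3 s + (t ^+ 4 * k s +
     (-2 * t ^+ 2 * k2 s + k4 s)))) t).
    have a4 := iZ (4 * t ^+ 2) _ i1; have a3 := iZ (-4) _ i3; have a0 := iZ (t ^+ 4) _ ik.
    have a2 := iZ (-2 * t ^+ 2) _ j2; have b1 := iD _ _ a2 j4; have b2 := iD _ _ a0 b1.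
    have b3 := iD _ _ a3 b2.
    rewrite (primitiveD t a4 b3) (primitiveD t a3 b2) (primitiveD t a0 b1) (primitiveD t a2 j4).
    by rewrite !primitiveZ// /A; ring.
  rewrite /primitive Rintegral_mkcond [RHS]Rintegral_mkcond; apply: eq_Rintegral => s _.
  rewrite !patchE; case: ifPn => [|]; rewrite ?notin_setE ?inE /= in_itv/=.
    move=> /andP[s0 st]; case: ifPn => // sI.
    rewrite max_r; last by rewrite subr_ge0; apply: lerXn2r; rewrite ?nnegrE// ltW.
    by rewrite /p1 /p3 /k2 /k4; ring.
  move=> /negP n; case: ifPn => // /set_mem/in_I/andP[s0 sR].
  have ts : t <= s by rewrite leNgt; apply: contra n => st; rewrite !ltW.
  rewrite max_l; first by rewrite expr0n/= !(mulr0, mul0r) addr0.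
  by rewrite subr_le0; apply: lerXn2r; rewrite ?nnegrE// ltW.
pose B (t : R) := 2 * primitive p1 t + (t ^+ 2 * primitive k t - primitive k2 t).
have B0ae : {ae leb, forall t, I t -> B t = 0}.
  have h1 := ae_and (primitive_derive i1) (primitive_derive i3).
  have h2 := ae_and (primitive_derive j2) (primitive_derive j4).
  apply: ae_imp (ae_and (ae_and h1 h2) (primitive_derive ik)) => t [[[e1 e3] [e2 e4]] e0] It.
  have tI := in_I It; have /andP[t0 tR] := tI.
  have {}e1 := e1 It; have {}e2 := e2 It; have {}e3 := e3 It; have {}e4 := e4 It; have {}e0 := e0 It.
  have dA := is_deriveD (is_deriveZ (4 : R) (derive_monomial 1 e1)) (is_deriveD (is_deriveZ (-4 : R) e3)
    (is_deriveD (derive_monomial 3 e0) (is_deriveD (is_deriveZ (-2 : R) (derive_monomial 1 e2)) e4))).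
  have dA0 : is_derive t 1 A 0.
    apply: near_eq_is_derive (is_derive_cst (0 : R) t 1).
    by apply: filterS (near_I tI) => x xI; rewrite A0.
  have [_ eA] := dA; have [_ eA0] := dA0.
  have : 4 * t * B t = 0; last first.
    by move=> /eqP; rewrite !mulf_eq0 (gt_eqF t0) orbF pnatr_eq0/= => /eqP.
  transitivity ('D_1 A t); last exact: eA0.
  symmetry; etransitivity; first exact: eA.
  by rewrite /GRing.scale/= /B /p1 /p3 /k2 /k4; ring.
have B0 (t : R) : 0 < t < Rd -> B t = 0.
  move=> tI; have /andP[t0 tR] := tI; apply/eqP; apply: contraT => Bn.
  have c1 := primitive_continuous i1 tI; have c0 := primitive_continuous ik tI.
  have c2 := primitive_continuous j2 tI; have cX := @exprn_continuous R 2 t.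
  have cB : {for t, continuous B}.
    have c3 : (fun x : R => 2 * primitive p1 x) x @[x --> t] --> 2 * primitive p1 t.
      exact: (cvgM (cvg_cst (2 : R)) c1).
    exact: (cvgD c3 (cvgB (cvgM cX c0) c2)).
  have np : 0 < `|B t| by rewrite normr_gt0.
  have cn : `|B s| @[s --> t] --> `|B t| by apply: cvg_norm; exact: cB.
  have [e /= e0 he] := cvgr_gt _ cn (0 : R) np.
  have ru : t < Num.min (t + e) Rd by rewrite lt_min ltrDl e0.
  have uR : Num.min (t + e) Rd <= Rd by rewrite ge_min lexx orbT.
  have [s [/andP[rs su] hs]] := ae_dense B0ae (ltW t0) ru uR.
  move: su; rewrite lt_min => /andP[su sR].
  have := he s; rewrite /= ltr0_norm ?subr_lt0// opprB ltrBlDl => /(_ su).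
  by rewrite hs normr0 ltxx.
apply: ae_imp (ae_and (ae_and (primitive_derive i1) (primitive_derive j2)) (primitive_derive ik))
  => t [[e1 e2] e0] It.
have tI := in_I It; have /andP[t0 tR] := tI.
have {}e1 := e1 It; have {}e2 := e2 It; have {}e0 := e0 It.
have dB := is_deriveD (is_deriveZ (2 : R) e1) (is_deriveB (derive_monomial 1 e0) e2).
have dB0 : is_derive t 1 B 0.
  apply: near_eq_is_derive (is_derive_cst (0 : R) t 1).
  by apply: filterS (near_I tI) => x xI; rewrite B0.
have [_ eB] := dB; have [_ eB0] := dB0.
have : 2 * t * (p t + primitive k t) = 0.
  transitivity ('D_1 B t); last exact: eB0.
  symmetry; etransitivity; first exact: eB.
  by rewrite /GRing.scale/= /p1 /k2; ring.
move=> /eqP; rewrite !mulf_eq0 (gt_eqF t0) orbF pnatr_eq0/= => /eqP e.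
by apply/eqP; rewrite -addr_eq0; apply/eqP.
Qed.

(** A momentum of finite kinetic energy carries no mass through the surface,
    since the density vanishes there at least linearly. *)
Lemma no_flux_at_surface (k z : R -> R) (D : R) : 0 < D ->
  leb.-integrable I (EFin \o k) -> leb.-integrable I (EFin \o z) ->
  (forall s : R, 0 < s < Rd -> 0 <= z s) ->
  {ae leb, forall s, I s -> primitive k s ^+ 2 <= D * (Rd - s) * z s} ->
  \int[leb]_(s in I) k s = 0.
Proof.
move=> D0 ik iz z0 hz; rewrite -primitive_total//; apply/eqP; apply: contraT => kn.
have /(continuous_within_itvP _ Rd0)[_ _ ck] := primitive_within ik.
have /(continuous_within_itvP _ Rd0)[_ _ cz] := primitive_within iz.
set c := primitive k Rd in kn ck; set Z := primitive z Rd in cz.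
have c2 : 0 < c ^+ 2 by rewrite lt0r sqrf_eq0 kn sqr_ge0.
have csq : (primitive k s) ^+ 2 @[s --> Rd^'-] --> c ^+ 2.
  exact: (cvgM ck ck).
pose m := c ^+ 2 / (4 * D); have m0 : 0 < m by rewrite divr_gt0// mulr_gt0.
have n1 : \forall s \near Rd^'-, c ^+ 2 / 2 < primitive k s ^+ 2.
  by apply: (cvgr_gt _ csq); lra.
have n2 : \forall s \near Rd^'-, Z - m / 2 < primitive z s by apply: (cvgr_gt _ cz); lra.
have n3 : \forall s \near Rd^'-, primitive z s < Z + m / 2 by apply: (cvgr_lt _ cz); lra.
have [e /= e0 he] := filterI n1 (filterI n2 n3).
pose d := Num.min e Rd / 4.
have mn : 0 < Num.min e Rd by rewrite lt_min e0.
have d0 : 0 < d by rewrite divr_gt0.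
have de : 4 * d <= e by rewrite /d mulrC divfK// ge_min lexx.
have dR : 4 * d <= Rd by rewrite /d mulrC divfK// ge_min lexx orbT.
have hs (s : R) : Rd - 3 * d < s -> s < Rd ->
    [/\ c ^+ 2 / 2 < primitive k s ^+ 2, Z - m / 2 < primitive z s & primitive z s < Z + m / 2].
  move=> s1 s2; have := he s; rewrite /= gtr0_norm ?subr_gt0//.
  have e1 : Rd - s < e by lra.
  by move=> /(_ e1 s2)[q1 [q2 q3]]; split.
have [_ _ z1] := hs (Rd - d) ltac:(lra) ltac:(lra).
have [_ z2 _] := hs (Rd - 2 * d) ltac:(lra) ltac:(lra).
suff : m <= primitive z (Rd - d) - primitive z (Rd - 2 * d) by lra.
have ez : primitive z (Rd - d) - primitive z (Rd - 2 * d) =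
    \int[leb]_(s in `]Rd - 2 * d, Rd - d]) z s.
  rewrite /primitive (@Rintegral_itvB _ (z \_ I) (BLeft 0) (BRight (Rd - d)) (Rd - 2 * d)).
  - apply: eq_Rintegral => s; rewrite inE/= in_itv/= => /andP[s1 s2].
    by rewrite patchE mem_set//= in_itv/=; apply/andP; split; lra.
  - exact: ext.
  - by rewrite bnd_simp; lra.
  - by rewrite bnd_simp; lra.
have sub : `]Rd - 2 * d, Rd - d]%classic `<=` I.
  by move=> s /=; rewrite !in_itv/= => /andP[? ?]; apply/andP; split; lra.
have mJ : measurable (`]Rd - 2 * d, Rd - d]%classic : set (measurableTypeR R)) by exact: measurable_itv.
have izJ : leb.-integrable `]Rd - 2 * d, Rd - d]%classic (EFin \o z) by exact: (integrableS mI mJ sub iz).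
have icst : leb.-integrable `]Rd - 2 * d, Rd - d]%classic (EFin \o (fun=> m / d)).
  apply: measurable_bounded_integrable => //; last exact: bounded_cst.
  by rewrite /= lebesgue_measure_itv/= lte_fin; case: ifP => _; rewrite ?ltry// -EFinB ltry.
have -> : m = \int[leb]_(s in `]Rd - 2 * d, Rd - d]) (m / d).
  have lJ' : fine (leb `]Rd - 2 * d, Rd - d]%classic) = d.
    by rewrite lebesgue_measure_itv/= lte_fin ifT; [rewrite /=; lra|lra].
  by rewrite Rintegral_cst// lJ' divfK// gt_eqF.
rewrite ez -lee_fin !fineK; try exact: (integrable_fin_num mJ).
have md0 : 0 <= m / d by rewrite divr_ge0// ltW.
apply: ae_ge0_le_integral => //.
- by move=> s /sub/in_I sI; rewrite lee_fin z0.
- by have /integrableP[] := izJ.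
apply: ae_imp hz => s hz sJ; have sI := sub s sJ; have {}hz := hz sI.
move: sJ; rewrite /= in_itv/= => /andP[s1 s2].
have [q _ _] := hs s ltac:(lra) ltac:(lra); have zs := z0 s (in_I sI).
rewrite lee_fin ler_pdivrMr// /m ler_pdivrMr ?mulr_gt0//.
have q1 : (Rd - s) * z s <= 2 * d * z s by apply: ler_wpM2r => //; lra.
have q2 : D * ((Rd - s) * z s) <= D * (2 * d * z s) by rewrite ler_pM2l.
by lra.
Qed.
End Moments.

(** * Radial functions and fields in space *)
Section RadialCalculus.
Context {R : realType}.
Local Notation E3 := (R * R * R)%type.
Local Notation leb := (@lebesgue_measure R).

Lemma dot3_line (x v : E3) (t : R) : dot3 (t *: v + x) (t *: v + x) =
  dot3 x x + (2 * dot3 x v) * t + dot3 v v * t ^+ 2.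
Proof. by rewrite /dot3 /= /GRing.scale/=; ring. Qed.

(** Along a line the squared norm is a quadratic polynomial of the parameter. *)
Lemma derive_sqnorm (psi : R -> R) (x v : E3) (d : R) :
  is_derive (dot3 x x) 1 psi d ->
  'D_v (fun y : E3 => psi (dot3 y y)) x = d * (2 * dot3 x v).
Proof.
move=> dpsi; pose g (t : R) := dot3 x x + (2 * dot3 x v) * t + dot3 v v * t ^+ 2.
have g0 : g 0 = dot3 x x by rewrite /g expr0n/= !mulr0 !addr0.
have dg : is_derive (0 : R) 1 g (2 * dot3 x v).
  have d1 := is_deriveZ (2 * dot3 x v) (is_derive_id (0 : R) 1).
  have d2 := is_deriveZ (dot3 v v) (is_deriveM (is_derive_id (0 : R) 1) (is_derive_id (0 : R) 1)).
  have := is_deriveD (is_deriveD (is_derive_cst (dot3 x x) (0 : R) 1) d1) d2.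
  rewrite (_ : _ + _ + _ = 2 * dot3 x v)//.
  by rewrite /GRing.scale/=; ring.
have dc : is_derive (0 : R) 1 (psi \o g) (d * (2 * dot3 x v)).
  by apply: (@is_derive1_comp _ psi g 0); rewrite ?g0.
have /is_derive_cvg cv := dc.
rewrite /derive; apply/cvg_lim => //.
apply: cvg_trans cv; apply: near_eq_cvg; apply: nearW => h /=.
by rewrite addr0 g0 /g -dot3_line.
Qed.

Lemma differentiable_sqnorm (x : E3) : differentiable (fun y : E3 => dot3 y y) x.
Proof.
have dfst (A B : normedModType R) (y : A * B) : differentiable (@fst A B) y.
  by apply: (@linear_differentiable _ _ _ fst) => z; exact: cvg_fst.
have dsnd (A B : normedModType R) (y : A * B) : differentiable (@snd A B) y.
  by apply: (@linear_differentiable _ _ _ snd) => z; exact: cvg_snd.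
have c0 : differentiable (fun y : E3 => y.1) x by exact: dfst.
have c1 : differentiable (fun y : E3 => y.1.1) x.
  exact: (@differentiable_comp _ _ _ _ (fun y : E3 => y.1) fst x c0 (dfst _ _ _)).
have c2 : differentiable (fun y : E3 => y.1.2) x.
  exact: (@differentiable_comp _ _ _ _ (fun y : E3 => y.1) snd x c0 (dsnd _ _ _)).
have c3 : differentiable (fun y : E3 => y.2) x by exact: dsnd.
exact: (differentiableD (differentiableD (differentiableM c1 c1) (differentiableM c2 c2)) (differentiableM c3 c3)).
Qed.

Lemma grad_sqnorm (psi : R -> R) (x : E3) (d : R) :
  is_derive (dot3 x x) 1 psi d -> grad (fun y : E3 => psi (dot3 y y)) x = (2 * d) *: x.
Proof.
move=> dpsi; rewrite /grad !(derive_sqnorm _ dpsi).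
case: x {dpsi} => [[x1 x2] x3]; rewrite /dot3/= !(mulr0, mulr1, add0r, addr0).
by congr (_, _, _); rewrite /GRing.scale/=; ring.
Qed.

Lemma grad_radial (rho : R -> R) (x : E3) (d : R) : 0 < enorm x ->
  is_derive (enorm x) 1 rho d -> grad (radial rho) x = (d / enorm x) *: x.
Proof.
move=> x0 drho.
have dx : 0 < dot3 x x by rewrite -sqrtr_gt0.
have := @is_derive1_comp _ rho Num.sqrt (dot3 x x) _ _ drho (is_derive1_sqrt dx).
move=> /grad_sqnorm; rewrite -/(enorm x) => e.
rewrite (_ : radial rho = fun y : E3 => (rho \o Num.sqrt) (dot3 y y))// e; congr (_ *: _).
by rewrite /GRing.scale/=; field; rewrite gt_eqF.
Qed.

(** The square makes the gradient continuous across the boundary of the support. *)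
Definition bump (al : R) (x : E3) : R := Num.max 0 (al - dot3 x x) ^+ 2.

Let trunc_derive (al t : R) :
  is_derive t 1 (fun s : R => Num.max 0 (al - s) ^+ 2) (-2 * Num.max 0 (al - t)).
Proof.
have [h|h|h] := ltgtP t al.
- rewrite max_r ?subr_ge0 ?ltW//.
  have d1 : is_derive t 1 (fun s : R => al - s) (-1).
    have := is_deriveB (is_derive_cst al t 1) (is_derive_id t 1); rewrite sub0r; exact.
  have d2 : is_derive t 1 (fun s : R => (al - s) ^+ 2) (-2 * (al - t)).
    have := is_deriveM d1 d1; rewrite (_ : _ *: _ + _ = -2 * (al - t))//.
    by rewrite /GRing.scale/=; ring.
  apply: near_eq_is_derive d2; apply: filterS (lt_nbhsl h) => s sa.
  by rewrite max_r// subr_ge0 ltW.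
- rewrite max_l ?subr_le0 ?ltW// mulr0.
  apply: near_eq_is_derive (is_derive_cst (0 : R) t 1); apply: filterS (lt_nbhsr h) => s sa.
  by rewrite max_l ?expr0n// subr_le0 ltW.
- rewrite h subrr maxxx mulr0; apply/is_derive_cvg.
  apply/cvgrPdist_lt => e e0; near=> k.
  rewrite subrr maxxx expr0n/= subr0 sub0r normrN normrM normfV ger0_norm ?sqr_ge0//.
  have kn : 0 < `|k| by rewrite normr_gt0; near: k; exact: nbhs_dnbhs_neq.
  rewrite -(ltr_pM2l kn) mulrA divff ?gt_eqF// mul1r opprD addrCA subrr addr0.
  have ke : `|k| < e by near: k; apply: dnbhs0_lt.
  have m1 : 0 <= Num.max 0 (- k) <= `|k|.
    by rewrite le_max lexx/= ge_max normr_ge0/= -normrN ler_norm.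
  have /andP[m2 m3] := m1.
  apply: (@le_lt_trans _ _ (`|k| ^+ 2)); first by apply: lerXn2r; rewrite ?nnegrE.
  by rewrite expr2 ltr_pM2l.
Unshelve. all: by end_near. Qed.

Lemma grad_bump al x : grad (bump al) x = (-4 * Num.max 0 (al - dot3 x x)) *: x.
Proof.
by rewrite (grad_sqnorm (trunc_derive al (dot3 x x))); congr (_ *: _); ring.
Qed.

Let dot_continuous : continuous (fun y : E3 => dot3 y y).
Proof. by move=> x; apply: differentiable_continuous; exact: differentiable_sqnorm. Qed.

Lemma bump_test (Rd t : R) : 0 < t < Rd -> test_function (eball Rd) (bump (t ^+ 2)).
Proof.
move=> /andP[t0 tR]; split.
- exists [set x : E3 | dot3 x x <= t ^+ 2]; split.
  + apply: (@subclosed_compact _ _ ((`[- t, t] `*` `[- t, t]) `*` `[- t, t])).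
    * apply: (@closed_comp _ _ (fun y : E3 => dot3 y y) [set s | s <= t ^+ 2]).
        by move=> x _; exact: dot_continuous.
      exact: closed_le.
    * by apply: compact_setX; [apply: compact_setX|]; exact: segment_compact.
    * move=> -[[x1 x2] x3]; rewrite /dot3/= => h.
      have b (s : R) : s ^+ 2 <= t ^+ 2 -> s \in `[- t, t].
        by rewrite in_itv/= -ler_norml => s2; rewrite -(ler_pXn2r (ltn0Sn 1)) ?nnegrE ?(ltW t0)// real_normK ?num_real.
      have := sqr_ge0 x1; have := sqr_ge0 x2; have := sqr_ge0 x3; rewrite !expr2 => p3 p2 p1.
      by repeat split; apply: b; rewrite !expr2 in h *; lra.
  + move=> x /= h; rewrite /eball/=; apply: le_lt_trans tR.
    by rewrite -(ler_pXn2r (ltn0Sn 1)) ?nnegrE ?enorm_ge0 ?(ltW t0)// enorm_sqr.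
  + move=> x /negP; rewrite -ltNge => h; rewrite /bump max_l ?expr0n//.
    by rewrite subr_le0 ltW.
- move=> x; apply: (@differentiable_comp _ _ _ _ (fun y : E3 => dot3 y y) (fun s : R => Num.max 0 (t ^+ 2 - s) ^+ 2)).
    exact: differentiable_sqnorm.
  apply/derivable1_diffP; exact: (@ex_derive _ _ _ _ _ _ _ (trunc_derive (t ^+ 2) (dot3 x x))).
- rewrite (_ : grad _ = fun x : E3 => (-4 * Num.max 0 (t ^+ 2 - dot3 x x)) *: x); last first.
    by apply/funext => x; rewrite grad_bump.
  have cN (x : E3) : {for x, continuous (fun y : E3 => Num.max 0 (t ^+ 2 - dot3 y y))}.
    have cm : {for dot3 x x, continuous (fun s : R => Num.max 0 (t ^+ 2 - s))}.
      by apply: continuous_max; [exact: cvg_cst|apply: cvgB; [exact: cvg_cst|exact: cvg_id]].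
    exact: (continuous_comp (dot_continuous (x := x)) cm).
  move=> x; exact: (cvgZ (cvgM (cvg_cst (-4 : R)) (cN x)) cvg_id).
Qed.

Lemma enorm_eq0 (x : E3) : enorm x = 0 -> x = (0, 0, 0).
Proof.
move=> h; have := enorm_sqr x; rewrite h expr0n/=; case: x {h} => [[x1 x2] x3]; rewrite /dot3/=.
rewrite -!expr2 => h; have p1 := sqr_ge0 x1; have p2 := sqr_ge0 x2; have p3 := sqr_ge0 x3.
have e (s : R) : s ^+ 2 <= 0 -> s = 0.
  by move=> s2; apply/eqP; rewrite -sqrf_eq0 eq_le s2 sqr_ge0.
by congr (_, _, _); apply: e; lra.
Qed.

(** A field with a radial profile away from the center is radial, for the profile
    whose value at zero is that of the field at the center. *)
Lemma radial_ball (Rd : R) (F : E3 -> R) (g : R -> R) : 0 < Rd ->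
  (forall x, eball Rd x -> 0 < enorm x -> F x = g (enorm x)) ->
  exists g' : R -> R, (forall s, 0 < s -> g' s = g s) /\
    (forall x, eball Rd x -> F x = radial g' x).
Proof.
move=> Rd0 h; exists (fun s => if s == 0 then F (0, 0, 0) else g s); split => [s s0|x xR].
  by rewrite gt_eqF.
rewrite /radial; case: eqP => [/enorm_eq0->//|/eqP n].
by apply: h => //; rewrite lt0r n enorm_ge0.
Qed.

Let mI (Rd : R) : measurable (`]0, Rd[%classic : set (measurableTypeR R)).
Proof. exact: measurable_itv. Qed.

Lemma eintegral_ball (Rd : R) (F : E3 -> R) (g : R -> R) : 0 < Rd ->
  measurable_fun (`]0, Rd[%classic : set R) g ->
  (forall x, eball Rd x -> 0 < enorm x -> F x = g (enorm x)) ->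
  (\int[leb3]_(x in eball Rd) (F x)%:E = (4 * pi)%:E * \int[leb]_(s in `]0%R, Rd[) (s ^+ 2 * g s)%:E)%E.
Proof.
move=> Rd0 mg h; have [g' [g'E FE]] := radial_ball Rd0 h.
have e s : (`]0, Rd[%classic : set R) s -> g' s = g s.
  by rewrite /= in_itv/= => /andP[s0 _]; exact: g'E.
transitivity (\int[leb3]_(x in eball Rd) (radial g' x)%:E)%E.
  by apply: eq_integral => x; rewrite inE => xR; rewrite FE.
rewrite integral_radial_ball//.
  by congr (_ * _)%E; apply: eq_integral => s; rewrite inE => sI; rewrite e.
by apply: eq_measurable_fun mg => s; rewrite inE => sI; rewrite e.
Qed.

Lemma Rintegral_ball (Rd : R) (F : E3 -> R) (g : R -> R) : 0 < Rd ->
  measurable_fun (`]0, Rd[%classic : set R) g ->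
  (forall x, eball Rd x -> 0 < enorm x -> F x = g (enorm x)) ->
  \int[leb3]_(x in eball Rd) F x = 4 * pi * \int[leb]_(s in `]0, Rd[) (s ^+ 2 * g s).
Proof.
move=> Rd0 mg h; have [g' [g'E FE]] := radial_ball Rd0 h.
have e s : (`]0, Rd[%classic : set R) s -> g' s = g s.
  by rewrite /= in_itv/= => /andP[s0 _]; exact: g'E.
transitivity (\int[leb3]_(x in eball Rd) radial g' x).
  by apply: eq_Rintegral => x; rewrite inE => xR; rewrite FE.
rewrite Rintegral_radial_ball//.
  by congr (_ * _); apply: eq_Rintegral => s; rewrite inE => sI; rewrite e.
by apply: eq_measurable_fun mg => s; rewrite inE => sI; rewrite e.
Qed.

Lemma finite_ball (Rd : R) (F : E3 -> R) (g : R -> R) : 0 < Rd ->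
  measurable_fun (`]0, Rd[%classic : set R) g ->
  (forall s, 0 < s < Rd -> 0 <= g s) ->
  (forall x, eball Rd x -> 0 < enorm x -> F x = g (enorm x)) ->
  (\int[leb3]_(x in eball Rd) (F x)%:E < +oo)%E ->
  leb.-integrable `]0, Rd[%classic (fun s => (s ^+ 2 * g s)%:E).
Proof.
move=> Rd0 mg g0 h; rewrite (eintegral_ball Rd0 mg h) => hf; apply/integrableP; split.
  by apply/measurable_EFinP; apply: measurable_funM => //; apply: measurable_funX.
have -> : (\int[leb]_(s in `]0%R, Rd[) `|(s ^+ 2 * g s)%:E| = \int[leb]_(s in `]0%R, Rd[) (s ^+ 2 * g s)%:E)%E.
  apply: eq_integral => s; rewrite inE/= in_itv/= => sI.
  by congr EFin; rewrite ger0_norm//; apply: mulr_ge0; [exact: sqr_ge0|exact: g0].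
have p : 0 < 4 * pi :> R by rewrite mulr_gt0 ?pi_gt0.
rewrite ltNge leye_eq; apply: contraTN hf => /eqP ->.
by rewrite gt0_muley ?lte_fin.
Qed.

Lemma ae_ball (Rd : R) (e : R -> R) (Q : E3 -> Prop) : 0 < Rd ->
  measurable_fun (`]0, Rd[%classic : set R) e ->
  (forall x, eball Rd x -> e (enorm x) = 0 -> Q x) ->
  {ae leb, forall s, (`]0, Rd[%classic : set R) s -> e s = 0} ->
  {ae leb3, forall x : E3, eball Rd x -> Q x}.
Proof.
move=> Rd0 me h aee.
have : ae_zero Rd e by apply/radial_ae_zero.
by apply: ae_imp => x hx xR; apply: h => //; exact: hx.
Qed.

End RadialCalculus.

(** * Coercivity excludes growing radial modes *)
Section Growth.
Context {R : realType}.
Local Notation E3 := (R * R * R)%type.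
Local Notation leb := (@lebesgue_measure R).
Variables (P : R -> R -> R) (f : R -> R) (g0 al0 : R) (rho : R -> R) (Rd b : R).
Hypothesis HP : hypP P g0 al0.
Hypothesis HE : hypEs P f rho Rd g0 al0.
Hypothesis rho0b : rho 0 < b.
Hypothesis Hf : Ck_on `[0, b]%classic 1 f.
Local Notation I := (`]0, Rd[%classic : set R).
Local Notation w := (weight1 P f rho).
Local Notation X := (X1rad P f rho Rd).
Local Notation H := (Hrad P f rho Rd).
Local Notation T := (Top rho).
Local Notation G := (coefG P f rho).
Local Notation drho := (derive1 rho).

Let Rd0 : 0 < Rd. Proof. exact: (Es_radius HE). Qed.
Let mI : measurable (I : set (measurableTypeR R)). Proof. by []. Qed.
Let in_I s : I s -> 0 < s < Rd. Proof. by rewrite /= in_itv. Qed.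
Let rho0 (s : R) : 0 < s < Rd -> 0 < rho s.
Proof. by move=> /andP[s0 sR]; apply: (rho_gt0 HE); rewrite ltW. Qed.
Let G0 (s : R) : 0 < s < Rd -> 0 <= G s.
Proof. by move=> /andP[s0 sR]; apply: (coefG_ge0 HP HE rho0b Hf); rewrite ltW. Qed.
Let mrho : measurable_fun I rho. Proof. exact: (measurable_rho HE). Qed.
Let mG : measurable_fun I G. Proof. exact: (measurable_coefG HP HE rho0b Hf). Qed.
Let mw : measurable_fun I w. Proof. exact: (measurable_weight1 HP HE rho0b Hf). Qed.
Let w0 s : I s -> 0 < w s.
Proof. by move=> /in_I/andP[s0 sR]; apply: (weight1_gt0 HE rho0b); rewrite ltW. Qed.
Let mX eta : X eta -> measurable_fun I eta.
Proof. exact: (X_measurable HP HE rho0b Hf). Qed.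
Let mdrho : measurable_fun I drho.
Proof. by apply: measurable_continuous => r; exact: (drho_continuous HE). Qed.

Lemma integrable_bounded_mul (h F : R -> R) (C : R) : measurable_fun I h ->
  (forall s : R, 0 < s < Rd -> `|h s| <= C) -> leb.-integrable I (EFin \o F) ->
  leb.-integrable I (EFin \o (fun s => h s * F s)).
Proof.
move=> mh hC iF; have /integrableP[/measurable_EFinP mF _] := iF.
have := integrableZl mI C (integrable_norm iF); apply: le_integrable => //.
  by apply/measurable_EFinP; apply: measurable_funM.
move=> s /in_I sI; rewrite /= lee_fin normrM.
apply: le_trans (ler_norm _); exact: (ler_wpM2r (normr_ge0 _) (hC s sI)).
Qed.

(** By [2 `|x y| <= x ^ 2 + y ^ 2], also where the weight vanishes. *)
Lemma integrable_weighted_mul (p x y : R -> R) : measurable_fun I p ->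
  (forall s : R, 0 < s < Rd -> 0 <= p s) -> measurable_fun I x -> measurable_fun I y ->
  leb.-integrable I (fun s => (s ^+ 2 * (p s * x s ^+ 2))%:E) ->
  leb.-integrable I (fun s => (s ^+ 2 * (p s * y s ^+ 2))%:E) ->
  leb.-integrable I (fun s => (s ^+ 2 * (p s * (x s * y s)))%:E).
Proof.
move=> mp p0 mx my ix iy; have := integrableD mI ix iy; apply: le_integrable => //.
  apply/measurable_EFinP; apply: measurable_funM; first by apply: measurable_funX.
  by apply: measurable_funM => //; apply: measurable_funM.
move=> s /in_I sI; rewrite /= lee_fin -mulrDr -mulrDr.
have p1 : 0 <= s ^+ 2 * p s by apply: mulr_ge0; [exact: sqr_ge0|exact: p0].
rewrite !mulrA [leRHS]ger0_norm; last first.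
  by apply: mulr_ge0 => //; apply: addr_ge0; exact: sqr_ge0.
have -> : s ^+ 2 * p s * x s * y s = s ^+ 2 * p s * (x s * y s) by ring.
rewrite normrM (ger0_norm p1); apply: ler_wpM2l => //.
have := sqr_ge0 (x s - y s); have := sqr_ge0 (x s + y s); have := sqr_ge0 (x s); have := sqr_ge0 (y s).
by move=> *; rewrite ler_norml; apply/andP; split; nra.
Qed.

(** The mean value theorem, with a derivative bounded up to the surface. *)
Lemma rho_linear : exists2 D : R, 0 < D & forall s : R, 0 < s < Rd -> rho s <= D * (Rd - s).
Proof.
have [D D0 hD] := drho_bounded HE; exists D => // s /andP[s0 sR].
have cs : {within `[s, Rd]%classic, continuous rho}.
  apply: continuous_subspaceW (rho_within HE) => x /=; rewrite !in_itv/= => /andP[sx ->].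
  by rewrite (le_trans (ltW s0) sx).
have [x|c cI] := @MVT _ rho drho s Rd sR _ cs.
  rewrite in_itv/= => /andP[sx xR]; apply: (rho_derive HE).
  by rewrite (lt_trans s0 sx).
rewrite (Es_rho_bdry HE) sub0r => e; rewrite -[leLHS]opprK e -mulNr ler_pM2r ?subr_gt0//.
move: cI; rewrite in_itv/= => /andP[sc cR].
by apply: le_trans (hD c _); rewrite ?(lt_trans s0 sc)// -normrN ler_norm.
Qed.

Lemma dot3Z (c d : R) (x : E3) : dot3 (c *: x) (d *: x) = c * d * dot3 x x.
Proof. by rewrite /dot3 /= /GRing.scale/=; ring. Qed.

(** [m] is the radial velocity of a perturbation of finite kinetic energy. *)
Definition kinetic (m : R -> R) : Prop :=
  measurable_fun I m /\ leb.-integrable I (fun s => (s ^+ 2 * (rho s * m s ^+ 2))%:E).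

Definition entropic (h : R -> R) : Prop :=
  measurable_fun I h /\ leb.-integrable I (fun s => (s ^+ 2 * (G s * h s ^+ 2))%:E).

Lemma kinetic_integrable m : kinetic m ->
  leb.-integrable I (EFin \o (fun s => s ^+ 2 * (rho s * m s))).
Proof.
move=> [mm im].
have m1 : measurable_fun I (fun=> 1 : R) by exact: measurable_cst.
have i1 : leb.-integrable I (fun s => (s ^+ 2 * (rho s * 1 ^+ 2))%:E).
  apply: (@integrable_bounded_I _ _ Rd0 (fun s => s ^+ 2 * (rho s * 1 ^+ 2)) (Rd ^+ 2 * rho 0)).
    by apply: measurable_funM; [apply: measurable_funX|apply: measurable_funM].
  move=> s /in_I sI; have /andP[s0 sR] := sI; rewrite expr1n mulr1.
  rewrite ger0_norm; last by apply: mulr_ge0; [exact: sqr_ge0|exact: ltW (rho0 sI)].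
  apply: ler_pM; [exact: sqr_ge0|exact: ltW (rho0 sI)| |].
    by apply: lerXn2r; rewrite ?nnegrE ltW.
  by apply: (rho_le HE); rewrite !ltW.
have := integrable_weighted_mul mrho (fun s sI => ltW (rho0 sI)) m1 mm i1 im.
by apply: eq_integrable => // s _; rewrite /= mul1r.
Qed.

(** By [flux_of_moments] the radial momentum is minus the enclosed mass over the
    square of the radius. Finite kinetic energy then closes the mass balance at
    the surface, and inserting the momentum in the second component of the graph
    gives [l = k - T k]. *)
Lemma continuity_equation (q : E3 -> E3) (k1 k2 : E3 -> R) (k l m : R -> R) :
  (forall x, eball Rd x -> q x = (rho (enorm x) * m (enorm x) / enorm x) *: x) ->
  (forall x, eball Rd x -> k1 x = k (enorm x)) ->
  (forall x, eball Rd x -> k2 x = l (enorm x)) ->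
  kinetic m -> X k -> measurable_fun I l -> Bgraph P f rho Rd q k1 k2 ->
  H k /\ {ae leb, forall s, I s -> l s = (k - T k) s}.
Proof.
move=> hq hk1 hk2 Km Xk ml [_ _ wd aek2]; have [mm im] := Km; have mk := mX Xk.
pose p (s : R) := s ^+ 2 * (rho s * m s); pose kk (s : R) := s ^+ 2 * k s.
have ip : leb.-integrable I (EFin \o p) := kinetic_integrable Km.
have ik : leb.-integrable I (EFin \o kk) := X_integrable HP HE rho0b Hf Xk.
have mmax (t : R) : measurable_fun I (fun s : R => Num.max 0 (t ^+ 2 - s ^+ 2)).
  by apply: measurable_funTS; meas.
have bmax (t s : R) : 0 < t < Rd -> 0 < s < Rd -> `|Num.max 0 (t ^+ 2 - s ^+ 2)| <= Rd ^+ 2.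
  move=> /andP[t0 tR] _; rewrite ger0_norm ?le_max ?lexx// ge_max sqr_ge0/=.
  apply: (@le_trans _ _ (t ^+ 2)); first by rewrite gerBl sqr_ge0.
  by apply: lerXn2r; rewrite ?nnegrE ltW.
have moments (t : R) : 0 < t < Rd -> \int[leb]_(s in I)
     (4 * Num.max 0 (t ^+ 2 - s ^+ 2) * (s * p s) + Num.max 0 (t ^+ 2 - s ^+ 2) ^+ 2 * kk s) = 0.
  move=> tI; have := wd _ (bump_test tI).
  rewrite (@Rintegral_ball _ Rd _ (fun s => - 4 * Num.max 0 (t ^+ 2 - s ^+ 2) * (s * (rho s * m s))) Rd0); last 2 first.
  - apply: measurable_funM; first by apply: measurable_funM => //.
    by apply: measurable_funM => //; apply: measurable_funM.
  - move=> x xR x0; rewrite hq// grad_bump dot3Z -enorm_sqr; field.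
    by rewrite gt_eqF.
  rewrite (@Rintegral_ball _ Rd _ (fun s => - (k s * Num.max 0 (t ^+ 2 - s ^+ 2) ^+ 2)) Rd0); last 2 first.
  - by apply: measurableT_comp => //; apply: measurable_funM => //; apply: measurable_funX.
  - by move=> x xR x0; rewrite hk1// /bump -enorm_sqr mulNr.
  have p4 : 4 * pi != 0 :> R by rewrite mulf_neq0// gt_eqF// pi_gt0.
  rewrite -mulrN => /(mulfI p4) e.
  have iA : leb.-integrable I (EFin \o (fun s => 4 * Num.max 0 (t ^+ 2 - s ^+ 2) * (s * p s))).
    have : leb.-integrable I (EFin \o (fun s => 4 * Num.max 0 (t ^+ 2 - s ^+ 2) * s * p s)).
      apply: (@integrable_bounded_mul _ _ (4 * Rd ^+ 2 * Rd)) => //.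
        by apply: measurable_funM => //; apply: measurable_funM.
      move=> s sI; rewrite normrM (normrM 4) (ger0_norm (ler0n _ 4)).
      apply: ler_pM => //; first by apply: ler_pM => //; exact: bmax.
      by case/andP: sI => s0 sR; rewrite gtr0_norm// ltW.
    by apply: eq_integrable => // s _; rewrite /= -!mulrA.
  have iB : leb.-integrable I (EFin \o (fun s => Num.max 0 (t ^+ 2 - s ^+ 2) ^+ 2 * kk s)).
    apply: (@integrable_bounded_mul _ _ ((Rd ^+ 2) ^+ 2)) => //.
      by apply: measurable_funX.
    move=> s sI; rewrite normrX; apply: lerXn2r; rewrite ?nnegrE ?sqr_ge0//; exact: bmax.
  have eA : \int[leb]_(s in I) (s ^+ 2 * (- 4 * Num.max 0 (t ^+ 2 - s ^+ 2) * (s * (rho s * m s)))) =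
      -1 * \int[leb]_(s in I) (4 * Num.max 0 (t ^+ 2 - s ^+ 2) * (s * p s)).
    by rewrite -RintegralZl//; apply: eq_Rintegral => s _; rewrite /p; ring.
  have eB : \int[leb]_(s in I) (s ^+ 2 * - (k s * Num.max 0 (t ^+ 2 - s ^+ 2) ^+ 2)) =
      -1 * \int[leb]_(s in I) (Num.max 0 (t ^+ 2 - s ^+ 2) ^+ 2 * kk s).
    by rewrite -RintegralZl//; apply: eq_Rintegral => s _; rewrite /kk; ring.
  by rewrite RintegralD//; move: e; rewrite eA eB; lra.
have flux := flux_of_moments Rd0 ip ik moments.
have Hk : H k.
  split => //; apply/(zero_meanE Rd0 mk).
  have [D D0 hD] := rho_linear.
  apply: (@no_flux_at_surface _ Rd Rd0 kk (fun s => s ^+ 2 * (rho s * m s ^+ 2)) (Rd ^+ 2 * D)) => //.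
  - by rewrite mulr_gt0// exprn_gt0.
  - move=> s sI; apply: mulr_ge0; first exact: sqr_ge0.
    by apply: mulr_ge0; [exact: ltW (rho0 sI)|exact: sqr_ge0].
  apply: ae_imp flux => s hs Is; have sI := in_I Is; have /andP[s0 sR] := sI.
  rewrite -sqrrN -hs// /p.
  have -> : (s ^+ 2 * (rho s * m s)) ^+ 2 = s ^+ 2 * rho s * (s ^+ 2 * (rho s * m s ^+ 2)) by ring.
  apply: ler_wpM2r.
    apply: mulr_ge0; first exact: sqr_ge0.
    by apply: mulr_ge0; [exact: ltW (rho0 sI)|exact: sqr_ge0].
  rewrite -mulrA; apply: ler_pM; [exact: sqr_ge0|exact: ltW (rho0 sI)| |exact: hD].
  by apply: lerXn2r; rewrite ?nnegrE ltW.
split => //.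
have me : measurable_fun I (fun s => s * (l s - k s - drho s * m s)).
  apply: measurable_funM => //; apply: measurable_funB; last exact: measurable_funM.
  exact: measurable_funB.
have ae0 : ae_zero Rd (fun s => s * (l s - k s - drho s * m s)).
  apply: ae_imp aek2 => x hx xR; rewrite /radial.
  have [->|xn] := eqVneq (enorm x) 0; first by rewrite mul0r.
  have x0 : 0 < enorm x by rewrite lt0r xn enorm_ge0.
  have sI : 0 < enorm x < Rd by rewrite x0.
  have rn : rho (enorm x) != 0 by rewrite gt_eqF// rho0.
  have := hx xR; rewrite hk1// hk2// hq// /a0 (grad_radial x0 (rho_derive HE sI)).
  rewrite scalerA dot3Z -enorm_sqr /radial => ->.
  by field; rewrite rn xn.
have := (radial_ae_zero Rd0 me).1 ae0 => {}ae0.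
apply: ae_imp (ae_and ae0 flux) => s [h1 h2] Is; have sI := in_I Is; have /andP[s0 sR] := sI.
have := h1 Is => /eqP; rewrite mulf_eq0 (gt_eqF s0)/= => /eqP e.
have rn : rho s != 0 by rewrite gt_eqF// rho0.
have lE : l s = k s + drho s * m s by lra.
have := h2 Is; rewrite /p -enclosed_primitive// => e2.
have enE : enclosed k s = - (s ^+ 2 * (rho s * m s)) by rewrite e2 opprK.
change ((k - T k) s) with (k s - T k s).
rewrite (TopE HE)// enE lE.
by field; rewrite rn gt_eqF.
Qed.

End Growth.

Section Energy.
Context {R : realType}.
Local Notation E3 := (R * R * R)%type.
Local Notation leb := (@lebesgue_measure R).
Variables (P : R -> R -> R) (f : R -> R) (g0 al0 : R) (rho : R -> R) (Rd b : R).
Hypothesis HP : hypP P g0 al0.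
Hypothesis HE : hypEs P f rho Rd g0 al0.
Hypothesis rho0b : rho 0 < b.
Hypothesis Hf : Ck_on `[0, b]%classic 1 f.
Local Notation I := (`]0, Rd[%classic : set R).
Local Notation w := (weight1 P f rho).
Local Notation X := (X1rad P f rho Rd).
Local Notation U := (shell_potential Rd).
Local Notation L := (Lform P f rho Rd).
Local Notation G := (coefG P f rho).
Local Notation drho := (derive1 rho).

Let Rd0 : 0 < Rd. Proof. exact: (Es_radius HE). Qed.
Let mI : measurable (I : set (measurableTypeR R)). Proof. by []. Qed.
Let in_I s : I s -> 0 < s < Rd. Proof. by rewrite /= in_itv. Qed.
Let rho0 (s : R) : 0 < s < Rd -> 0 < rho s.
Proof. by move=> /andP[s0 sR]; apply: (rho_gt0 HE); rewrite ltW. Qed.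
Let G0 (s : R) : 0 < s < Rd -> 0 <= G s.
Proof. by move=> /andP[s0 sR]; apply: (coefG_ge0 HP HE rho0b Hf); rewrite ltW. Qed.
Let mrho : measurable_fun I rho. Proof. exact: (measurable_rho HE). Qed.
Let mG : measurable_fun I G. Proof. exact: (measurable_coefG HP HE rho0b Hf). Qed.
Let mw : measurable_fun I w. Proof. exact: (measurable_weight1 HP HE rho0b Hf). Qed.
Let w0 s : I s -> 0 < w s.
Proof. by move=> /in_I/andP[s0 sR]; apply: (weight1_gt0 HE rho0b); rewrite ltW. Qed.
Let mX eta : X eta -> measurable_fun I eta.
Proof. exact: (X_measurable HP HE rho0b Hf). Qed.

Local Notation entropic := (entropic P f rho Rd).
Local Notation kinetic := (kinetic rho Rd).

Lemma inX_profile (k1 k2 : E3 -> R) (k l : R -> R) :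
  (forall x, eball Rd x -> k1 x = k (enorm x)) ->
  (forall x, eball Rd x -> k2 x = l (enorm x)) ->
  inX P f rho Rd k1 k2 -> X k /\ entropic l.
Proof.
move=> h1 h2 [[m1 f1] [m2 f2]].
have mk : measurable_fun (eball Rd) (radial k).
  by apply: eq_measurable_fun m1 => x; rewrite inE => xR; rewrite h1.
have ml : measurable_fun I l.
  apply/(measurable_radial Rd0).
  by apply: eq_measurable_fun m2 => x; rewrite inE => xR; rewrite h2.
split; split => //.
  rewrite (_ : (\int[leb3]_(x in eball Rd) _)%E = (\int[leb3]_(x in eball Rd) (radial w x * k1 x ^+ 2)%:E)%E)//.
  by apply: eq_integral => x; rewrite inE => xR; rewrite h1.
apply: (finite_ball Rd0 _ _ _ f2); first by apply: measurable_funM => //; apply: measurable_funX.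
  by move=> s sI; apply: mulr_ge0; [exact: G0|exact: sqr_ge0].
by move=> x xR x0; rewrite h2.
Qed.

Lemma inY_profile (u : E3 -> E3) (m : R -> R) :
  (forall x, eball Rd x -> u x = (m (enorm x) / enorm x) *: x) ->
  inY rho Rd u -> kinetic m.
Proof.
move=> hu [mu fu].
have mm : measurable_fun I m.
  have := measurable_axis mu => ma.
  have mb : measurable_fun I (fun s => (u (s, 0, 0)).1.1).
    exact: (measurableT_comp measurable_fst (measurableT_comp measurable_fst ma)).
  apply: eq_measurable_fun mb => s; rewrite inE => /in_I/andP[s0 sR].
  have es : enorm (s, 0, 0) = s by rewrite enorm_axis// ltW.
  rewrite hu; last by rewrite /eball/= es.
  by rewrite es /= /GRing.scale/= divfK// gt_eqF.
split => //; apply: (finite_ball Rd0 _ _ _ fu).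
- by apply: measurable_funM => //; apply: measurable_funX.
- by move=> s sI; apply: mulr_ge0; [exact: ltW (rho0 sI)|exact: sqr_ge0].
- by move=> x xR x0; rewrite hu// dot3Z -enorm_sqr /radial; field; rewrite gt_eqF.
Qed.

(** Both sides of the duality between the two halves of the generator are
    integrals of radial functions. *)
Lemma energy_pairing (eta zeta k1 k2 : E3 -> R) (y q : E3 -> E3) (g h k l n m : R -> R) :
  (forall x, eball Rd x -> eta x = g (enorm x)) ->
  (forall x, eball Rd x -> zeta x = h (enorm x)) ->
  (forall x, eball Rd x -> k1 x = k (enorm x)) ->
  (forall x, eball Rd x -> k2 x = l (enorm x)) ->
  (forall x, eball Rd x -> y x = (n (enorm x) / enorm x) *: x) ->
  (forall x, eball Rd x -> q x = (rho (enorm x) * m (enorm x) / enorm x) *: x) ->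
  X g -> entropic h -> X k -> entropic l -> kinetic n -> kinetic m ->
  Bdual_graph P f rho Rd (bigL1 P f rho Rd eta) (bigL2 P f rho zeta) y ->
  Bgraph P f rho Rd q k1 k2 ->
  L g k + 4 * pi * \int[leb]_(s in I) (s ^+ 2 * (G s * (h s * l s))) =
  4 * pi * \int[leb]_(s in I) (s ^+ 2 * (rho s * (n s * m s))).
Proof.
move=> he hz hk1 hk2 hy hq Xg [mh ih] Xk [ml il] [mn _] [mm _] [_ _ dual] hB.
have mg := mX Xg; have mk := mX Xk.
have Fg := X_L2ball HP HE rho0b Hf Xg; have Fk := X_L2ball HP HE rho0b Hf Xk.
have epatch : eta \_ (eball Rd) = radial g \_ (eball Rd).
  by apply/funext => x; rewrite !patchE; case: ifPn => // /set_mem xR; rewrite he.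
have mU : measurable_fun I (fun s => U g s * k s) := measurable_shell_pairing Rd0 Fk Fg.
pose F s := (w s * (g s * k s) - 4 * pi * (U g s * k s)) + G s * (h s * l s).
have := dual q k1 k2 hB.
rewrite (@Rintegral_ball _ Rd _ F Rd0); last 2 first.
- apply: measurable_funD; last by apply: measurable_funM => //; apply: measurable_funM.
  by apply: measurable_funB; [apply: measurable_funM => //|]; apply: measurable_funM.
- move=> x xR x0; rewrite /bigL1 /bigL2 epatch newton_radial_ball// hk1// hk2// hz// he// /F /radial.
  by ring.
rewrite (@Rintegral_ball _ Rd _ (fun s => rho s * (n s * m s)) Rd0); last 2 first.
- by apply: measurable_funM => //; apply: measurable_funM.
- by move=> x xR x0; rewrite hy// hq// dot3Z -enorm_sqr; field; rewrite gt_eqF.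
move=> <-; rewrite (LformE HP HE rho0b Hf Xg Xk) -mulrDr; congr (_ * _).
have i1 : leb.-integrable I (EFin \o (fun s => radial_weight w s * (g s * k s))).
  apply: wip_integrable => //; [exact: measurable_radial_weight|exact: radial_weight_gt0| |];
  exact/(X_WL2 HP HE rho0b Hf).
have i2 : leb.-integrable I (EFin \o (fun s => 4 * pi * (s ^+ 2 * (U g s * k s)))).
  by have := integrableZl mI (4 * pi) (newton_pairing_integrable Rd0 Fk Fg); apply: eq_integrable.
have i3 : leb.-integrable I (EFin \o (fun s => s ^+ 2 * (G s * (h s * l s)))).
  exact: (integrable_weighted_mul mG G0 mh ml ih il).
have i12 : leb.-integrable I (EFin \o (fun s => radial_weight w s * (g s * k s) - 4 * pi * (s ^+ 2 * (U g s * k s)))).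
  by have := integrableB mI i1 i2; apply: eq_integrable.
rewrite /wip -RintegralZl//; last exact: (newton_pairing_integrable Rd0 Fk Fg).
rewrite -RintegralB// -RintegralD//; apply: eq_Rintegral => s _.
by rewrite /F /radial_weight; ring.
Qed.

Lemma weighted_comb (p x y z : R -> R) (a c : R) : measurable_fun I p ->
  (forall s : R, 0 < s < Rd -> 0 <= p s) ->
  measurable_fun I x -> measurable_fun I y -> measurable_fun I z ->
  leb.-integrable I (fun s => (s ^+ 2 * (p s * x s ^+ 2))%:E) ->
  leb.-integrable I (fun s => (s ^+ 2 * (p s * y s ^+ 2))%:E) ->
  leb.-integrable I (fun s => (s ^+ 2 * (p s * z s ^+ 2))%:E) ->
  \int[leb]_(s in I) (s ^+ 2 * (p s * (x s * (a * y s + c * z s)))) =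
  a * (\int[leb]_(s in I) (s ^+ 2 * (p s * (x s * y s)))) +
  c * (\int[leb]_(s in I) (s ^+ 2 * (p s * (x s * z s)))).
Proof.
move=> mp p0 mx my mz ix iy iz.
have i1 := integrable_weighted_mul mp p0 mx my ix iy.
have i2 := integrable_weighted_mul mp p0 mx mz ix iz.
rewrite -!RintegralZl// -RintegralD//; last 2 first.
- by have := integrableZl mI a i1; apply: eq_integrable.
- by have := integrableZl mI c i2; apply: eq_integrable.
by apply: eq_Rintegral => s _; ring.
Qed.

Lemma bilinear_comb (V : set (R -> R)) (q : (R -> R) -> (R -> R) -> R) (a c : R) x y z :
  (forall c x y, V x -> V y -> V (c *: x + y)) -> bilinear_on V q ->
  V x -> V y -> V z -> q z (a *: x + c *: y) = a * q z x + c * q z y.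
Proof.
move=> lin bil Vx Vy Vz.
have e : c *: y = (c - 1) *: y + y by rewrite scalerBl scale1r subrK.
have Vcy : V (c *: y) by rewrite e; exact: lin.
rewrite (bilinear_linr bil a Vx Vcy Vz) e (bilinear_linr bil _ Vy Vy Vz).
by ring.
Qed.

Lemma enclosed_comb (a c : R) x y (r : R) : X x -> X y -> 0 < r < Rd ->
  enclosed (a *: x + c *: y) r = a * enclosed x r + c * enclosed y r.
Proof.
move=> Xx Xy /andP[_ rR].
have ix := X_integrable HP HE rho0b Hf Xx; have iy := X_integrable HP HE rho0b Hf Xy.
have iZ e F : leb.-integrable I (EFin \o F) -> leb.-integrable I (EFin \o (fun s => e * F s)).
  by move=> iF; have := integrableZl mI e iF; apply: eq_integrable.
rewrite !(enclosed_primitive _ rR) -!primitiveZ// -primitiveD//; try exact: iZ.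
rewrite /primitive; apply: eq_Rintegral => s _; rewrite !patchE; case: ifP => // _.
by change ((a *: x + c *: y) s) with (a * x s + c * y s); ring.
Qed.

Lemma enclosed_ae0 (g : R -> R) (r : R) : measurable_fun I g ->
  {ae leb, forall s, I s -> g s = 0} -> r < Rd -> enclosed g r = 0.
Proof.
move=> mg aeg rR; rewrite (enclosed_primitive _ rR) /primitive.
have mF : measurable_fun setT (EFin \o ((fun s : R => s ^+ 2 * g s) \_ I)).
  apply/measurable_EFinP; apply: (measurable_restrictT _ _).1 => //.
  by apply: measurable_funM => //; apply: measurable_funX.
have mJ : measurable (`[0, r]%classic : set (measurableTypeR R)) by exact: measurable_itv.
transitivity (fine (\int[leb]_(s in `[0%R, r]) (cst 0 s))%E); last by rewrite integral0.
congr fine; apply: ae_eq_integral => //; first exact: measurable_funTS.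
apply: ae_imp aeg => s hs _; rewrite /= patchE; case: ifPn => // /set_mem sI.
by rewrite hs// mulr0.
Qed.

Lemma weighted_eq0 (p m : R -> R) : measurable_fun I p ->
  (forall s : R, 0 < s < Rd -> 0 < p s) -> measurable_fun I m ->
  leb.-integrable I (fun s => (s ^+ 2 * (p s * m s ^+ 2))%:E) ->
  \int[leb]_(s in I) (s ^+ 2 * (p s * (m s * m s))) = 0 ->
  {ae leb, forall s, I s -> m s = 0}.
Proof.
move=> mp p0 mm im z.
pose F s := s ^+ 2 * (p s * (m s * m s)).
have F0 (s : R) : 0 < s < Rd -> 0 <= F s.
  move=> sI; apply: mulr_ge0; first exact: sqr_ge0.
  by apply: mulr_ge0; [exact: ltW (p0 s sI)|rewrite -expr2 sqr_ge0].
have iF : leb.-integrable I (EFin \o F).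
  by move: im; apply: eq_integrable => // s _; rewrite /F /= expr2.
have mF : measurable_fun I (EFin \o F) by have /integrableP[] := iF.
have : (\int[leb]_(s in I) `|(F s)%:E| = 0)%E.
  have : (\int[leb]_(s in I) (F s)%:E = 0)%E.
    by rewrite -(fineK (integrable_fin_num mI iF)); congr EFin.
  by move=> <-; apply: eq_integral => s; rewrite inE => /in_I sI; rewrite abse_EFin ger0_norm// F0.
move=> /(ae_eq_integral_abs leb mI mF) aeF.
apply: ae_imp aeF => s h1 Is; have sI := in_I Is; have /andP[s0 _] := sI.
have := h1 Is; case => e; apply/eqP; apply: contraT => mn.
suff : 0 < F s by rewrite e ltxx.
rewrite /F; apply: mulr_gt0; first by rewrite exprn_gt0.
by apply: mulr_gt0; [exact: p0|rewrite -expr2 lt0r sqrf_eq0 mn sqr_ge0].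
Qed.

End Energy.

Section NoGrowth.
Context {R : realType}.
Local Notation E3 := (R * R * R)%type.
Local Notation leb := (@lebesgue_measure R).
Variables (P : R -> R -> R) (f : R -> R) (g0 al0 : R) (rho : R -> R) (Rd b : R).
Hypothesis HP : hypP P g0 al0.
Hypothesis HE : hypEs P f rho Rd g0 al0.
Hypothesis rho0b : rho 0 < b.
Hypothesis Hf : Ck_on `[0, b]%classic 1 f.
Local Notation I := (`]0, Rd[%classic : set R).
Local Notation w := (weight1 P f rho).
Local Notation X := (X1rad P f rho Rd).
Local Notation H := (Hrad P f rho Rd).
Local Notation L := (Lform P f rho Rd).
Local Notation Q := (Qform P f rho Rd).
Local Notation NX := (X1sqnorm P f rho Rd).
Local Notation T := (Top rho).
Local Notation G := (coefG P f rho).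
Local Notation drho := (derive1 rho).

Let Rd0 : 0 < Rd. Proof. exact: (Es_radius HE). Qed.
Let mI : measurable (I : set (measurableTypeR R)). Proof. by []. Qed.
Let in_I s : I s -> 0 < s < Rd. Proof. by rewrite /= in_itv. Qed.
Let rho0 (s : R) : 0 < s < Rd -> 0 < rho s.
Proof. by move=> /andP[s0 sR]; apply: (rho_gt0 HE); rewrite ltW. Qed.
Let G0 (s : R) : 0 < s < Rd -> 0 <= G s.
Proof. by move=> /andP[s0 sR]; apply: (coefG_ge0 HP HE rho0b Hf); rewrite ltW. Qed.
Let mrho : measurable_fun I rho. Proof. exact: (measurable_rho HE). Qed.
Let mG : measurable_fun I G. Proof. exact: (measurable_coefG HP HE rho0b Hf). Qed.
Let mw : measurable_fun I w. Proof. exact: (measurable_weight1 HP HE rho0b Hf). Qed.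
Let w0 s : I s -> 0 < w s.
Proof. by move=> /in_I/andP[s0 sR]; apply: (weight1_gt0 HE rho0b); rewrite ltW. Qed.
Let mX eta : X eta -> measurable_fun I eta.
Proof. exact: (X_measurable HP HE rho0b Hf). Qed.

Local Notation entropic := (entropic P f rho Rd).
Local Notation kinetic := (kinetic rho Rd).

Hypothesis Lbil : bilinear_on X L.
Hypothesis Qcoer : coercive H NX Q.

Let Xlin c x y : X x -> X y -> X (c *: x + y).
Proof. exact: (X_lin HP HE rho0b Hf). Qed.

Let XZ c x : X x -> X (c *: x).
Proof.
by move=> Xx; rewrite (_ : c *: x = (c - 1) *: x + x); [exact: Xlin|rewrite scalerBl scale1r subrK].
Qed.

Let Xcomb c d x y : X x -> X y -> X (c *: x + d *: y).
Proof. by move=> Xx Xy; apply: Xlin => //; exact: XZ. Qed.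

Let combE (c d : R) (x y : R -> R) s : (c *: x + d *: y) s = c * x s + d * y s.
Proof. by []. Qed.

Let Hcomb c d x y : H x -> H y -> H (c *: x + d *: y).
Proof.
move=> [Xx zx] [Xy zy]; have Xxy := Xcomb c d Xx Xy; split => //.
have ix := X_integrable HP HE rho0b Hf Xx; have iy := X_integrable HP HE rho0b Hf Xy.
apply/(zero_meanE Rd0 (mX Xxy)).
move/(zero_meanE Rd0 (mX Xx)): zx => zx; move/(zero_meanE Rd0 (mX Xy)): zy => zy.
transitivity (\int[leb]_(s in I) (c * (s ^+ 2 * x s) + d * (s ^+ 2 * y s))).
  by apply: eq_Rintegral => s _; rewrite combE; ring.
rewrite RintegralD//; last 2 first.
- by have := integrableZl mI c ix; apply: eq_integrable.
- by have := integrableZl mI d iy; apply: eq_integrable.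
by rewrite !RintegralZl// zx zy !mulr0 addr0.
Qed.

(** When the entropy perturbation is the one transported by the flow, the energy
    of a state is given by the second variation. *)
Let energyE g h : X g -> entropic h -> {ae leb, forall s, I s -> h s = (g - T g) s} ->
  Q g g = L g g + 4 * pi * \int[leb]_(s in I) (s ^+ 2 * (G s * (h s * h s))).
Proof.
move=> Xg [mh ih] aeh; rewrite (QformE HP HE rho0b Hf Xg Xg); congr (_ + _ * _).
have mT : measurable_fun I (T g) by apply: (measurable_Top HE); exact: (X_integrable HP HE rho0b Hf Xg).
have mgT : measurable_fun I (g - T g) by apply: measurable_funB => //; exact: mX.
congr fine; apply: ae_eq_integral => //.
- apply/measurable_EFinP; apply: measurable_funM; first by apply: measurable_funX.
  by apply: measurable_funM => //; apply: measurable_funM.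
- apply/measurable_EFinP; apply: measurable_funM; first by apply: measurable_funX.
  by apply: measurable_funM => //; apply: measurable_funM.
by apply: ae_imp aeh => s hs Is; rewrite /= -(hs Is); congr EFin; ring.
Qed.

Let sum_eq0 (x1 x2 x3 x4 : R) : 0 <= x1 -> 0 <= x2 -> 0 <= x3 -> 0 <= x4 ->
  x1 + x2 + x3 + x4 = 0 -> [/\ x1 = 0, x2 = 0, x3 = 0 & x4 = 0].
Proof. by move=> *; split; lra. Qed.

(** Pair each eigenvalue equation with its own component of the mode and add: the
    terms with the imaginary part [c] of the eigenvalue cancel by symmetry, and
    what is left is the real part [a] times the total energy. It vanishes, so by
    coercivity the mode vanishes. *)
Lemma no_growing_radial_mode : ~ growing_radial_mode P f rho Rd.
Proof.
move=> [a [c [[[eta1 zeta1] u1] [[[eta2 zeta2] u2] [a0 [[ph1 ph2] [rs1 rs2] nn gg1 gg2]]]]]].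
have [B1 D1] : Bgraph P f rho Rd (Aop rho u1) (a *: eta1 - c *: eta2) (a *: zeta1 - c *: zeta2) /\
    Bdual_graph P f rho Rd (bigL1 P f rho Rd eta1) (bigL2 P f rho zeta1)
      (fun x => - (a *: u1 - c *: u2) x) by exact: gg1.
have [B2 D2] : Bgraph P f rho Rd (Aop rho u2) (c *: eta1 + a *: eta2) (c *: zeta1 + a *: zeta2) /\
    Bdual_graph P f rho Rd (bigL1 P f rho Rd eta2) (bigL2 P f rho zeta2)
      (fun x => - (c *: u1 + a *: u2) x) by exact: gg2.
have [g1 [h1 [m1 r1]]] := rs1; have [g2 [h2 [m2 r2]]] := rs2.
have e1 x : eball Rd x -> eta1 x = g1 (enorm x) by move=> /r1[].
have z1 x : eball Rd x -> zeta1 x = h1 (enorm x) by move=> /r1[].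
have v1 x : eball Rd x -> u1 x = (m1 (enorm x) / enorm x) *: x by move=> /r1[].
have e2 x : eball Rd x -> eta2 x = g2 (enorm x) by move=> /r2[].
have z2 x : eball Rd x -> zeta2 x = h2 (enorm x) by move=> /r2[].
have v2 x : eball Rd x -> u2 x = (m2 (enorm x) / enorm x) *: x by move=> /r2[].
have [Xg1 Eh1] := inX_profile HP HE rho0b Hf e1 z1 ph1.1; have Km1 := inY_profile HE v1 ph1.2.
have [Xg2 Eh2] := inX_profile HP HE rho0b Hf e2 z2 ph2.1; have Km2 := inY_profile HE v2 ph2.2.
pose kA := a *: g1 + (- c) *: g2; pose lA := a *: h1 + (- c) *: h2.
pose kB := c *: g1 + a *: g2; pose lB := c *: h1 + a *: h2.
pose nA := (- a) *: m1 + c *: m2; pose nB := (- c) *: m1 + (- a) *: m2.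
have hkA x : eball Rd x -> (a *: eta1 - c *: eta2) x = kA (enorm x).
  by move=> xR; rewrite /kA combE -e1// -e2// mulNr.
have hlA x : eball Rd x -> (a *: zeta1 - c *: zeta2) x = lA (enorm x).
  by move=> xR; rewrite /lA combE -z1// -z2// mulNr.
have hkB x : eball Rd x -> (c *: eta1 + a *: eta2) x = kB (enorm x).
  by move=> xR; rewrite /kB combE -e1// -e2.
have hlB x : eball Rd x -> (c *: zeta1 + a *: zeta2) x = lB (enorm x).
  by move=> xR; rewrite /lB combE -z1// -z2.
have hnA x : eball Rd x -> - (a *: u1 - c *: u2) x = (nA (enorm x) / enorm x) *: x.
  move=> xR; change (- (a *: u1 x - c *: u2 x) = (nA (enorm x) / enorm x) *: x).
  rewrite v1// v2// !scalerA -scalerBl -scaleNr; congr (_ *: _).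
  by rewrite /nA combE; ring.
have hnB x : eball Rd x -> - (c *: u1 + a *: u2) x = (nB (enorm x) / enorm x) *: x.
  move=> xR; change (- (c *: u1 x + a *: u2 x) = (nB (enorm x) / enorm x) *: x).
  rewrite v1// v2// !scalerA -scalerDl -scaleNr; congr (_ *: _).
  by rewrite /nB combE; ring.
have hq1 x : eball Rd x -> Aop rho u1 x = (rho (enorm x) * m1 (enorm x) / enorm x) *: x.
  by move=> xR; rewrite /Aop v1// scalerA mulrA.
have hq2 x : eball Rd x -> Aop rho u2 x = (rho (enorm x) * m2 (enorm x) / enorm x) *: x.
  by move=> xR; rewrite /Aop v2// scalerA mulrA.
have [XkA ElA] : X kA /\ entropic lA by have [_ iX _ _] := B1; exact: (inX_profile HP HE rho0b Hf hkA hlA iX).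
have [XkB ElB] : X kB /\ entropic lB by have [_ iX _ _] := B2; exact: (inX_profile HP HE rho0b Hf hkB hlB iX).
have KnA : kinetic nA by have [_ iY _] := D1; exact: (inY_profile HE hnA iY).
have KnB : kinetic nB by have [_ iY _] := D2; exact: (inY_profile HE hnB iY).
have [HkA aeA] := continuity_equation HP HE rho0b Hf hq1 hkA hlA Km1 XkA ElA.1 B1.
have [HkB aeB] := continuity_equation HP HE rho0b Hf hq2 hkB hlB Km2 XkB ElB.1 B2.
pose D := a ^+ 2 + c ^+ 2.
have D0 : 0 < D by rewrite ltr_wpDr ?sqr_ge0// exprn_gt0.
have Dn : D != 0 by rewrite gt_eqF.
have Hg1 : H g1.
  rewrite (_ : g1 = (a / D) *: kA + (c / D) *: kB); first exact: Hcomb.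
  by apply/funext => s; rewrite combE /kA /kB !combE /D; field.
have Hg2 : H g2.
  rewrite (_ : g2 = (- c / D) *: kA + (a / D) *: kB); first exact: Hcomb.
  by apply/funext => s; rewrite combE /kA /kB !combE /D; field.
have aeh : {ae leb, forall s, I s -> h1 s = (g1 - T g1) s /\ h2 s = (g2 - T g2) s}.
  apply: ae_imp (ae_and aeA aeB) => s [q1 q2] Is; have sI := in_I Is.
  have := q1 Is; have := q2 Is.
  change ((kA - T kA) s) with (kA s - T kA s); change ((kB - T kB) s) with (kB s - T kB s).
  change ((g1 - T g1) s) with (g1 s - T g1 s); change ((g2 - T g2) s) with (g2 s - T g2 s).
  rewrite !(TopE HE)// /kA /kB /lA /lB !combE !(enclosed_comb HP HE rho0b Hf)//.
  set t := _ / _; set j1 := enclosed g1 s; set j2 := enclosed g2 s => p2 p1.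
  have w1 : a * (h1 s - (g1 s - t * j1)) = c * (h2 s - (g2 s - t * j2)) by lra.
  have w2 : c * (h1 s - (g1 s - t * j1)) = - a * (h2 s - (g2 s - t * j2)) by lra.
  move: w1 w2; set x := h1 s - _; set y := h2 s - _ => w1 w2.
  have x0 : D * x = 0.
    have -> : D * x = a * (a * x) + c * (c * x) by rewrite /D; ring.
    by rewrite w1 w2; ring.
  have y0 : D * y = 0.
    have -> : D * y = c * (c * y) - a * (- a * y) by rewrite /D; ring.
    by rewrite -w1 -w2; ring.
  move/eqP: x0; rewrite mulf_eq0 (negbTE Dn)/= => /eqP x0.
  move/eqP: y0; rewrite mulf_eq0 (negbTE Dn)/= => /eqP y0.
  by split; apply/eqP; rewrite -subr_eq0; apply/eqP.
have aeh1 : {ae leb, forall s, I s -> h1 s = (g1 - T g1) s} by apply: ae_imp aeh => s hs /hs[].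
have aeh2 : {ae leb, forall s, I s -> h2 s = (g2 - T g2) s} by apply: ae_imp aeh => s hs /hs[].
have EQ1 := energy_pairing HP HE rho0b Hf e1 z1 hkA hlA hnA hq1 Xg1 Eh1 XkA ElA KnA Km1 D1 B1.
have EQ2 := energy_pairing HP HE rho0b Hf e2 z2 hkB hlB hnB hq2 Xg2 Eh2 XkB ElB KnB Km2 D2 B2.
have [mh1 ih1] := Eh1; have [mh2 ih2] := Eh2; have [mm1 im1] := Km1; have [mm2 im2] := Km2.
have rge s : 0 < s < Rd -> 0 <= rho s by move=> sI; exact: ltW (rho0 sI).
pose Gam x y := \int[leb]_(s in I) (s ^+ 2 * (G s * (x s * y s))).
pose Kin x y := \int[leb]_(s in I) (s ^+ 2 * (rho s * (x s * y s))).
have Gsym x y : Gam x y = Gam y x by apply: eq_Rintegral => s _; rewrite (mulrC (x s)).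
have Ksym x y : Kin x y = Kin y x by apply: eq_Rintegral => s _; rewrite (mulrC (x s)).
have GA : Gam h1 lA = a * Gam h1 h1 + - c * Gam h1 h2 := weighted_comb a (- c) mG G0 mh1 mh1 mh2 ih1 ih1 ih2.
have GB : Gam h2 lB = c * Gam h2 h1 + a * Gam h2 h2 := weighted_comb c a mG G0 mh2 mh1 mh2 ih2 ih1 ih2.
have KA : Kin m1 nA = - a * Kin m1 m1 + c * Kin m1 m2 := weighted_comb (- a) c mrho rge mm1 mm1 mm2 im1 im1 im2.
have KB : Kin m2 nB = - c * Kin m2 m1 + - a * Kin m2 m2 := weighted_comb (- c) (- a) mrho rge mm2 mm1 mm2 im2 im1 im2.
have LA : L g1 kA = a * L g1 g1 + - c * L g1 g2 := bilinear_comb a (- c) Xlin Lbil Xg1 Xg2 Xg1.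
have LB : L g2 kB = c * L g2 g1 + a * L g2 g2 := bilinear_comb c a Xlin Lbil Xg1 Xg2 Xg2.
have Lsym : L g1 g2 = L g2 g1 := Lform_sym HP HE rho0b Hf Xg1 Xg2.
move: EQ1 EQ2; rewrite -/(Gam h1 lA) -/(Gam h2 lB) -/(Kin nA m1) -/(Kin nB m2).
rewrite (Ksym nA) (Ksym nB) LA LB GA GB KA KB Lsym (Gsym h2 h1) (Ksym m2 m1) => EQ1 EQ2.
have Q1 : Q g1 g1 = L g1 g1 + 4 * pi * Gam h1 h1 := energyE Xg1 Eh1 aeh1.
have Q2 : Q g2 g2 = L g2 g2 + 4 * pi * Gam h2 h2 := energyE Xg2 Eh2 aeh2.
have p4 : 0 < 4 * pi :> R by rewrite mulr_gt0 ?pi_gt0.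
have tot : Q g1 g1 + Q g2 g2 + 4 * pi * Kin m1 m1 + 4 * pi * Kin m2 m2 = 0.
  suff : a * (Q g1 g1 + Q g2 g2 + 4 * pi * Kin m1 m1 + 4 * pi * Kin m2 m2) = 0.
    by move/eqP; rewrite mulf_eq0 (gt_eqF a0)/= => /eqP.
  rewrite Q1 Q2; move: EQ1 EQ2; move: (4 * pi) (L _ _) (L _ _) (L _ _) (Gam _ _) (Gam _ _) (Gam _ _) (Kin _ _) (Kin _ _) (Kin _ _).
  move=> t x1 x2 x3 x4 x5 x6 x7 x8 x9 /eqP; rewrite -subr_eq0 => /eqP E1 /eqP.
  rewrite -subr_eq0 => /eqP E2.
  by rewrite -[RHS]addr0 -[X in _ = X + _]E1 -[X in _ = _ + X]E2; ring.
have Kge m : 0 <= Kin m m.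
  apply: Rintegral_ge0 => s /in_I sI; apply: mulr_ge0; first exact: sqr_ge0.
  by apply: mulr_ge0; [exact: rge|rewrite -expr2 sqr_ge0].
have [kap kap0 hk] := Qcoer.
have Nge g : X g -> 0 <= NX g by move=> Xg; exact: (sqnorm_ge0 Rd0 mw w0).
have Qge g : H g -> 0 <= Q g g /\ (Q g g = 0 -> NX g = 0).
  move=> Hg; have Xg : X g by case: Hg.
  have q0 := hk g Hg; have n0 := Nge g Xg; split.
    by apply: le_trans q0; apply: mulr_ge0 => //; exact: ltW.
  move=> q; apply/eqP; rewrite eq_le n0 andbT.
  by rewrite -(ler_pM2l kap0) mulr0 -q.
have [q1 n1] := Qge g1 Hg1; have [q2 n2] := Qge g2 Hg2.
have k1 : 0 <= 4 * pi * Kin m1 m1 by apply: mulr_ge0 => //; exact: ltW.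
have k2 : 0 <= 4 * pi * Kin m2 m2 by apply: mulr_ge0 => //; exact: ltW.
have [t1 t2 t3 t4] := sum_eq0 q1 q2 k1 k2 tot.
have N1 : NX g1 = 0 := n1 t1.
have N2 : NX g2 = 0 := n2 t2.
have pn : 4 * pi != 0 :> R by rewrite gt_eqF.
have pz (x : R) : 4 * pi * x = 0 -> x = 0 by move/eqP; rewrite mulf_eq0 (negbTE pn) => /eqP.
have K1 : Kin m1 m1 = 0 := pz _ t3.
have K2 : Kin m2 m2 = 0 := pz _ t4.
have null (eta zeta : E3 -> R) (u : E3 -> E3) (g h m : R -> R) :
    (forall x, eball Rd x -> eta x = g (enorm x)) ->
    (forall x, eball Rd x -> zeta x = h (enorm x)) ->
    (forall x, eball Rd x -> u x = (m (enorm x) / enorm x) *: x) ->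
    X g -> measurable_fun I h -> kinetic m ->
    {ae leb, forall s, I s -> h s = (g - T g) s} ->
    NX g = 0 -> Kin m m = 0 -> null_state Rd (eta, zeta, u).
  move=> he hz hu Xg mh [mm im] ae_h Ng Km.
  have aeg : {ae leb, forall s, I s -> g s = 0}.
    by apply/(radial_ae_zero Rd0 (mX Xg)); apply/(sqnorm_eq0 Rd0 mw w0 Xg).
  have aem := weighted_eq0 mrho rho0 mm im Km.
  apply: (@ae_ball _ Rd (fun s => g s ^+ 2 + h s ^+ 2 + m s ^+ 2) _ Rd0).
  - by do 2 (apply: measurable_funD; last by apply: measurable_funX); apply: measurable_funX; exact: mX.
  - move=> x xR e; rewrite he// hz// hu//.
    have := sqr_ge0 (g (enorm x)); have := sqr_ge0 (h (enorm x)); have := sqr_ge0 (m (enorm x)) => s1 s2 s3.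
    have sq0 (t : R) : t ^+ 2 = 0 -> t = 0 by move/eqP; rewrite sqrf_eq0 => /eqP.
    have [y1 y2 y3 _] := sum_eq0 s3 s2 s1 (lexx 0) (etrans (addr0 _) e).
    by rewrite (sq0 _ y1) (sq0 _ y2) (sq0 _ y3) mul0r scale0r.
  apply: ae_imp (ae_and (ae_and aeg aem) ae_h) => s [[p1 p2] p3] Is.
  have sI := in_I Is; have /andP[_ sR] := sI.
  have := p3 Is; change ((g - T g) s) with (g s - T g s).
  rewrite (TopE HE)// (enclosed_ae0 (mX Xg) aeg sR) (p1 Is) (p2 Is) mulr0 subrr => ->.
  by rewrite expr0n/= !addr0.
apply: nn; split.
  exact: (null _ _ _ _ _ _ e1 z1 v1 Xg1 mh1 Km1 aeh1 N1 K1).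
exact: (null _ _ _ _ _ _ e2 z2 v2 Xg2 mh2 Km2 aeh2 N2 K2).
Qed.

End NoGrowth.

(** * Failure of the turning-point principle *)

Theorem theorem6p2 (R : realType)
    (P : R -> R -> R) (gamma0 alpha0 : R) (f : R -> R)
    (a b : R) (rho : R -> R -> R) (radius : R -> R) (mus : R)
    (hP : hypP P gamma0 alpha0)
    (hcenter : forall mu : R, a <= mu <= b -> rho mu 0 = mu)
    (hEs : forall mu : R, a <= mu <= b ->
       hypEs P f (rho mu) (radius mu) gamma0 alpha0)
    (hF : hypF P f a b rho radius)
    (hint : a < mus < b)
    (hext : simple_mass_extremum a b rho radius mus)
    (hc : derive_in `[a, b] (compactness rho radius) mus != 0)
    (hmorse : morse_index (X_ P f rho radius mus) (L_ P f rho radius mus) 1%N)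
    (hker : trivial_ker (radius mus) (X_ P f rho radius mus)
                        (L_ P f rho radius mus)) :
  [/\ coercive (H_ P f rho radius mus) (X_sqnorm P f rho radius mus)
               (Q_ P f rho radius mus),
      \forall mu \near mus,
        coercive (H_ P f rho radius mu) (X_sqnorm P f rho radius mu)
                 (Q_ P f rho radius mu) /\
        ~ growing_radial_mode P f (rho mu) (radius mu),
      ~ radial_stability_transition P f a b rho radius mus &
      is_first (simple_mass_extremum a b rho radius) mus ->
        ~ first_turning_point_principle P f a b rho radius].
Proof.
have [Imus hM _] := hext.
have [omega [mo o0 heq [_ cpL _] [ncQ cpQ _]]] := F_forms hF.
have wk m : a < m < b -> a <= m <= b by move=> /andP[h1 h2]; rewrite !ltW.
have unit := branch_coercive_unit hP hcenter hEs hF mo o0 heq hint cpL cpQ hM hmorse hker.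
have coer := branch_pull_coercive hP hcenter hEs mo o0 heq hint unit.
(* A coercive form has no kernel, whereas a transition requires one. *)
have notrans : ~ radial_stability_transition P f a b rho radius mus.
  move=> [_ _ [eta0 [[He k0] nz _]] _]; apply: nz.
  have HE := hEs _ (wk _ hint); have rb := branch_center hcenter hint.
  have Hf := branch_entropy hcenter hEs hint; have Rd0 := Es_radius HE.
  have Xe : X_ P f rho radius mus eta0 by case: He.
  have w0 s : (`]0, radius mus[%classic : set R) s -> 0 < weight1 P f (rho mus) s.
    by rewrite /= in_itv/= => /andP[s0 sR]; apply: (weight1_gt0 HE rb); rewrite ltW.
  have mw := measurable_weight1 hP HE rb Hf.
  apply/(sqnorm_eq0 Rd0 mw w0 Xe); apply/eqP.
  have [kap kap0 hk] := coer; have := hk _ He; rewrite (k0 _ He) => n0.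
  have n1 := sqnorm_ge0 Rd0 mw w0 Xe; rewrite eq_le n1 andbT.
  by rewrite -(ler_pM2l kap0) mulr0.
split => //.
(* The forms are norm-continuous on one fixed space, where coercivity is open. *)
- have [k k0 hk] := unit; have k2 : 0 < k / 2 by rewrite divr_gt0.
  have nab : \forall m \near mus, a < m < b.
    have : nbhs mus `]a, b[%classic.
      by apply: open_nbhs_nbhs; split; [exact: interval_open|rewrite /= in_itv].
    by apply: filterS => s; rewrite /= in_itv.
  have nQ := ncQ mus Imus _ k2.
  apply: filterS2 nab nQ => mu hmu hQ.
  have Imu : (`[a, b]%classic : set R) mu by rewrite /= in_itv/= wk.
  have unit' := coercive_perturb k0 hk (hQ Imu).
  have coer' := branch_pull_coercive hP hcenter hEs mo o0 heq hmu unit'.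
  split => //.
  apply: (no_growing_radial_mode hP (hEs _ (wk _ hmu)) (branch_center hcenter hmu)
    (branch_entropy hcenter hEs hmu) _ coer').
  exact: (branch_Lform_bilinear hEs mo o0 heq hmu cpL).
(* Both minimality properties identify [mus] with the alleged transition. *)
- move=> [_ fm] [mu [[tr _] [em fmu]]]; apply: notrans.
  have e : mus = mu by apply/eqP; rewrite eq_le fm// fmu.
  by rewrite e.
Qed.
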